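(* (Complex Darmois–Skitovich theorem) Let $s_1,\ldots,s_n$ be mutually independent complex random variables, and let $\alpha_k,\beta_k\in\mathbb{C}$, $k=1,\ldots,n$. If the linear forms $$x_1=\sum_{k=1}^n\alpha_k s_k\quad\text{and}\quad x_2=\sum_{k=1}^n\beta_k s_k$$ are independent, then every random variable $s_k$ for which $\alpha_k\beta_k\neq 0$ is complex normal.
   Context: A complex random variable is $s=s_R+\jmath s_I$ with $s_R,s_I$ real random variables on a common probability space. It is called complex normal (in the wide sense) if the real random vector $(s_R,s_I)^T$ is bivariate normal; no circularity is required, and the covariance matrix of $(s_R,s_I)^T$ may be singular (constants count as degenerate normal variables). *)

(* Defs.v *)
From HB Require Import structures.
From mathcomp Require Export all_boot all_order all_algebra.
From mathcomp Require Export all_classical all_reals all_analysis.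
From mathcomp Require Export complex.

Set Implicit Arguments.
Unset Strict Implicit.
Unset Printing Implicit Defensive.

Import Order.TTheory GRing.Theory Num.Theory.

Local Open Scope classical_set_scope.
Local Open Scope ring_scope.

(* Complex random variables are modelled as functions s : T -> R[i]; the field
   R[i] carries no sigma-algebra in the library, so measurability, laws and
   independence are expressed through the real vector (Re s, Im s) with values
   in R * R, equipped with the product sigma-algebra. *)
Definition real_vector (T : Type) (R : realType) (s : T -> R[i]) : T -> R * R :=
  fun t => (complex.Re (s t), complex.Im (s t)).

Definition complex_random_variable (d : measure_display) (T : measurableType d)
    (R : realType) (s : T -> R[i]) : Prop :=
  measurable_fun [set: T] (fun t => complex.Re (s t)) /\
  measurable_fun [set: T] (fun t => complex.Im (s t)).

Definition mutually_independent (d d' : measure_display) (T : measurableType d)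
    (T' : measurableType d') (R : realType) (P : probability T R)
    (I : finType) (X : I -> T -> T') : Prop :=
  forall (J : {set I}) (B : I -> set T'),
    (forall i, i \in J -> measurable (B i)) ->
    P (\bigcap_(i in [set` J]) (X i @^-1` B i)) =
    (\prod_(i in J) P (X i @^-1` B i))%E.

Definition independent (d d1 d2 : measure_display) (T : measurableType d)
    (T1 : measurableType d1) (T2 : measurableType d2) (R : realType)
    (P : probability T R) (X : T -> T1) (Y : T -> T2) : Prop :=
  forall (A : set T1) (B : set T2), measurable A -> measurable B ->
    P ((X @^-1` A) `&` (Y @^-1` B)) = (P (X @^-1` A) * P (Y @^-1` B))%E.

(* At standard deviation 0 the library's normal_prob m is the uniform law on
   [0, 1], not the degenerate normal law, hence the case distinction. *)
Definition normal_law (R : realType) (m sigma : R) : set R -> \bar R :=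
  if sigma == 0 then \d_m else normal_prob m sigma.

Definition normal_variable (d : measure_display) (T : measurableType d)
    (R : realType) (P : probability T R) (X : T -> R) : Prop :=
  exists m sigma : R, 0 <= sigma /\
    forall A : set R, measurable A -> P (X @^-1` A) = normal_law m sigma A.

(* The usual definition of a normal vector that allows a singular covariance
   matrix: every real linear form in the coordinates is a possibly degenerate
   normal variable. *)
Definition bivariate_normal (d : measure_display) (T : measurableType d)
    (R : realType) (P : probability T R) (X : T -> R * R) : Prop :=
  forall a b : R, normal_variable P (fun t => a * (X t).1 + b * (X t).2).

Definition complex_normal (d : measure_display) (T : measurableType d)
    (R : realType) (P : probability T R) (s : T -> R[i]) : Prop :=
  bivariate_normal P (real_vector s).

(* Main.v *)
Require Import Defs.
From mathcomp Require Import measurable_realfun ring lra zify.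
Import Order.TTheory GRing.Theory Num.Theory.
Import numFieldNormedType.Exports.

Set Implicit Arguments.
Unset Strict Implicit.
Unset Printing Implicit Defensive.
Local Open Scope classical_set_scope.
Local Open Scope ring_scope.

(** Let [q k w] be the squared modulus of the characteristic function of [s k]
    at the real linear form [Re (w s)].  Independence of [x1] and [x2] gives
    [prod q k (u alpha_k + v beta_k) = prod q k (u alpha_k) * prod q k (v beta_k)],
    and near 0 one may pass to [psi k = - ln (q k)].  Fix [k0] and a complex number
    [om].  Every summand other than those with [beta_k / alpha_k = beta_k0 / alpha_k0]
    is invariant along a direction on which [u + (beta_k0 / alpha_k0) v = om], so a
    finite number of differences kills it: the sum of the remaining
    [psi k (t om alpha_k)] is, by Frechet's theorem, a polynomial in [t] near 0.
    Hence a product of characteristic functions of independent variables, one of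
    them that of [Re (om alpha_k0 s_k0)], equals [exp (- p t)] near 0.

    Such a factor is normal (Cramer and Marcinkiewicz).  Even differences of the
    characteristic function at 0 bound the even moments of the sum, so the factors
    have exponential moments of every order and entire moment generating series.
    The one of the factor divides the zero-free function [exp (poly)]; its logarithm
    has polynomially bounded real part, so it is a polynomial [g] by Liouville's
    argument, and [|E exp (z X)| <= E exp (Re z X)] forces [g] to have degree at
    most 2.

    Entire functions are handled as real power series, evaluated along the rays
    [r exp (i t)] through their real and imaginary parts. *)

(** * Entire power series *)

(** Squared moduli are positive near 0, so [- ln] of them is a single-valued real function and no
    branch of a complex logarithm has to be followed. The price is that only moduli are known to be
    exponentials of polynomials; it is recovered by adding an independent reflected copy of the
    whole sum, which turns the squared modulus into a genuine characteristic function.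

    Complex coefficients do not disturb the difference argument: a step must satisfy one homogeneous
    equation, which fixes the argument of a given summand, and one equation prescribing the
    increment [om]. For distinct ratios this system is solvable over the complex numbers, whatever
    [om] is. Variables with equal ratios cannot be separated in this way, and this is what makes a
    factorization theorem for normal laws necessary. The polynomial comes without a usable bound on
    its degree, so the degree is cut to 2 only for the factor itself, by the positivity of its law.
    Letting [om] vary gives every real linear form of [s_k0]. *)

Section EntireSeries.
Variable R : realType.
Implicit Types (a b : nat -> R) (x r : R).

(** Infinite radius of convergence, put as a geometric bound for every ratio [e]: later estimates
    reduce to comparing geometric sequences. *)
Definition entire a := forall e : R, 0 < e ->
  exists A : R, forall n, `|a n| <= A * e ^+ n.

Definition psum a x := limn (pseries a x).

Lemma entire_bound a e : entire a -> 0 < e ->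
  exists2 A : R, 0 <= A & forall n, `|a n| <= A * e ^+ n.
Proof.
move=> ea e0; have [A HA] := ea e e0; exists A => //.
by have := HA 0%N; rewrite expr0 mulr1; exact: le_trans.
Qed.

(** The ratio 1/4 rather than 1/2 is a reserve: in [psum_conv] a sum of [n] terms of size [4^-n]
    must still decay, and [n <= 2^n]. *)
Lemma entire_quarter a r : entire a -> 0 <= r ->
  exists2 A : R, 0 <= A & forall n x, `|x| <= r -> `|a n * x ^+ n| <= A * 4^-1 ^+ n.
Proof.
move=> ea r0; have e0 : 0 < (4 * (r + 1))^-1 by rewrite invr_gt0; lra.
have [A A0 HA] := entire_bound ea e0; exists A => // n x xr.
rewrite normrM normrX; apply: le_trans (_ : A * (4 * (r + 1))^-1 ^+ n * (r + 1) ^+ n <= _).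
  by apply: ler_pM => //; rewrite ?exprn_ge0// lerXn2r ?nnegrE //; lra.
by rewrite -mulrA -exprMn invfM divfK //; lra.
Qed.

Lemma psum_cvg a x : entire a -> pseries a x @ \oo --> psum a x.
Proof.
move=> ea; have [A A0 HA] := entire_quarter ea (normr_ge0 x).
apply: normed_cvg; apply: (@series_le_cvg R _ (geometric A 4^-1)) => /=.
- by move=> n.
- by move=> n; rewrite mulr_ge0 // exprn_ge0 // invr_ge0.
- by move=> n; apply: HA.
- by apply: is_cvg_geometric_series; rewrite ger0_norm ?invr_ge0//; lra.
Qed.

Lemma psum_eq a x l : pseries a x @ \oo --> l -> psum a x = l.
Proof. by move=> h; exact: (cvg_lim (@Rhausdorff R) h). Qed.

Lemma psum_tail_bound a x (A : R) n : entire a -> 0 <= A ->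
  (forall m, `|a m * x ^+ m| <= A * 4^-1 ^+ m) ->
  `|psum a x - \sum_(i < n) a i * x ^+ i| <= A * 2 * 4^-1 ^+ n.
Proof.
move=> ea A0 HA.
(* The negative term makes the induction close: a new summand [4^-m] is at most
   [2 (4^-m - 4^-(m+1))]. *)
have part m : (n <= m)%N ->
  `|\sum_(i < m) a i * x ^+ i - \sum_(i < n) a i * x ^+ i| <=
   A * 2 * (4^-1 ^+ n - 4^-1 ^+ m).
  elim: m => [|m IH].
    by rewrite leqn0 => /eqP ->; rewrite !subrr normr0 mulr0.
  rewrite leq_eqVlt => /predU1P[->|nm]; first by rewrite !subrr normr0 mulr0.
  rewrite big_ord_recr/= addrAC; apply: le_trans (ler_normD _ _) _.
  apply: le_trans (lerD (IH nm) (HA m)) _.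
  have : 0 <= A * 4^-1 ^+ m by rewrite mulr_ge0// exprn_ge0.
  by rewrite exprS; set u := _ ^+ m; set v := _ ^+ n; lra.
apply: (@cvgr_to_le _ \oo _ _ (fun m => `|pseries a x m - \sum_(i < n) a i * x ^+ i|)).
  by apply: cvg_norm; apply: cvgB; [exact: psum_cvg|exact: cvg_cst].
exists n => // m /= nm.
rewrite /pseries /series/= big_mkord; apply: le_trans (part m nm) _.
have : 0 <= A * 4^-1 ^+ m by rewrite mulr_ge0// exprn_ge0.
by set u := _ ^+ m; set v := _ ^+ n; lra.
Qed.

Lemma psum_tail a r : entire a -> 0 <= r ->
  exists2 A : R, 0 <= A & forall n x, `|x| <= r ->
    `|psum a x - \sum_(i < n) a i * x ^+ i| <= A * 4^-1 ^+ n.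
Proof.
move=> ea r0; have [A A0 HA] := entire_quarter ea r0.
exists (A * 2) => [|n x xr]; first by rewrite mulr_ge0.
by apply: psum_tail_bound => // m; exact: HA.
Qed.

Lemma psum_fin a x n : (forall i, (n <= i)%N -> a i = 0) ->
  psum a x = \sum_(i < n) a i * x ^+ i.
Proof.
move=> a0; apply: psum_eq; rewrite -(cvg_shiftn n)/=.
rewrite (_ : (fun m => _) = cst (\sum_(i < n) a i * x ^+ i)); first exact: cvg_cst.
apply/funext => m; rewrite /pseries/series/= (@big_cat_nat _ _ _ n)//= ?leq_addl//.
by rewrite big_mkord [X in _ + X]big1_seq ?addr0// => i /andP[_]; rewrite mem_index_iota => /andP[ni _]; rewrite a0// mul0r.
Qed.

Lemma entire_fin a n : (forall i, (n <= i)%N -> a i = 0) -> entire a.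
Proof.
move=> a0 e e0; exists (\sum_(i < n) `|a i| / e ^+ i) => m.
have [nm|mn] := leqP n m.
  rewrite a0// normr0 mulr_ge0//; last by rewrite exprn_ge0// ltW.
  by apply: sumr_ge0 => i _; rewrite divr_ge0// exprn_ge0// ltW.
rewrite -ler_pdivrMr ?exprn_gt0// (bigD1 (Ordinal mn))//= lerDl.
by apply: sumr_ge0 => i _; rewrite divr_ge0// exprn_ge0// ltW.
Qed.

Lemma psum_ler a x b : entire a -> entire b -> (forall n, `|a n| <= b n) ->
  `|psum a x| <= psum b `|x|.
Proof.
move=> ea eb ab; apply: (@ler_cvg_to _ \oo _ _ (fun n => `|pseries a x n|) (pseries b `|x|)).
- by apply: cvg_norm; exact: psum_cvg.
- exact: psum_cvg.
- near=> n; apply: le_trans (ler_norm_sum _ _ _) _.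
  by apply: ler_sum => i _; rewrite normrM normrX ler_wpM2r// exprn_ge0.
Unshelve. all: by end_near. Qed.

Lemma psum0 a : psum a 0 = a 0%N.
Proof.
apply: psum_eq; rewrite -(cvg_shiftn 1)/=.
rewrite (_ : (fun n => _) = cst (a 0%N)); first exact: cvg_cst.
apply/funext => n; rewrite addn1 /pseries/series/= big_nat_recl//= expr0 mulr1.
by rewrite big1 ?addr0// => i _; rewrite expr0n mulr0.
Qed.

Lemma entireD a b : entire a -> entire b -> entire (fun n => a n + b n).
Proof.
move=> ea eb e e0; have [A HA] := ea e e0; have [B HB] := eb e e0.
exists (A + B) => n; rewrite mulrDl.
by apply: le_trans (ler_normD _ _) _; exact: lerD.
Qed.

Lemma entire_le a b : entire b -> (forall n, `|a n| <= `|b n|) -> entire a.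
Proof.
move=> eb ab e e0; have [B HB] := eb e e0; exists B => n.
exact: le_trans (ab n) (HB n).
Qed.

Lemma entireM_bounded a b : entire a -> (forall n, `|b n| <= 1) ->
  entire (fun n => a n * b n).
Proof.
by move=> ea b1; apply: entire_le ea _ => n; rewrite normrM ler_piMr.
Qed.

Lemma entireZ a c : entire a -> entire (fun n => c * a n).
Proof.
move=> ea e e0; have [A HA] := ea e e0; exists (`|c| * A) => n.
by rewrite normrM -mulrA ler_wpM2l.
Qed.

Lemma entireB a b : entire a -> entire b -> entire (fun n => a n - b n).
Proof.
move=> ea eb; apply: entireD ea _.
by apply: entire_le eb _ => n; rewrite normrN.
Qed.

Lemma natr_lt_exp2 n : n%:R <= (2 : R) ^+ n.
Proof. by rewrite -natrX ler_nat ltnW// ltn_expl. Qed.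

Lemma entire_diffs a : entire a -> entire (pseries_diffs a).
Proof.
move=> ea e e0; have [A A0 HA] := @entire_bound a (e / 2) ea (divr_gt0 e0 (ltr0Sn _ _)).
exists (A * e) => n; rewrite /pseries_diffs normrM ger0_norm//.
apply: le_trans (ler_pM _ _ (natr_lt_exp2 _) (HA n.+1)) _ => //.
have u0 : (2 : R) ^+ n.+1 != 0 by rewrite expf_neq0.
rewrite exprMn exprVn (exprS e); move: u0; set u := 2 ^+ _ => u0.
by rewrite le_eqVlt; apply/orP; left; apply/eqP; field.
Qed.

Lemma is_derive_psum a x : entire a ->
  is_derive x 1 (psum a) (psum (pseries_diffs a) x).
Proof.
move=> ea; have ed := entire_diffs ea; have edd := entire_diffs ed.
apply: (@pseries_snd_diffs _ _ (`|x| + 1)).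
- by apply/cvg_ex; eexists; exact: psum_cvg.
- by apply/cvg_ex; eexists; exact: psum_cvg.
- by apply/cvg_ex; eexists; exact: psum_cvg.
- by rewrite [ltRHS]ger0_norm ?ltrDl// addr_ge0.
Qed.

Lemma psumD a b x : entire a -> entire b ->
  psum (fun n => a n + b n) x = psum a x + psum b x.
Proof.
move=> ea eb; apply: psum_eq.
rewrite (_ : pseries _ x = fun n => pseries a x n + pseries b x n).
  by apply: cvgD; exact: psum_cvg.
apply/funext => n; rewrite /pseries/series/= -big_split/=.
by apply: eq_bigr => i _; rewrite mulrDl.
Qed.

Lemma psumZ c a x : entire a -> psum (fun n => c * a n) x = c * psum a x.
Proof.
move=> ea; apply: psum_eq.
rewrite (_ : pseries _ x = fun n => c * pseries a x n).
  by apply: cvgMr; exact: psum_cvg.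
apply/funext => n; rewrite /pseries/series/= mulr_sumr.
by apply: eq_bigr => i _; rewrite mulrA.
Qed.

Lemma psumB a b x : entire a -> entire b ->
  psum (fun n => a n - b n) x = psum a x - psum b x.
Proof.
move=> ea eb; apply: psum_eq.
rewrite (_ : pseries _ x = fun n => pseries a x n - pseries b x n).
  by apply: cvgB; exact: psum_cvg.
apply/funext => n; rewrite /pseries/series/= -sumrB/=.
by apply: eq_bigr => i _; rewrite mulrBl.
Qed.

(** Induction on [n] over all series: vanishing near 0 passes to the derived series, whose
    coefficient [n] is [(n+1) a_(n+1)]. *)
Lemma psum_eq0 a (d : R) : 0 < d -> entire a ->
  (forall x, `|x| < d -> psum a x = 0) -> forall n, a n = 0.
Proof.
move=> d0 ea a0 n; elim: n a ea a0 => [|n IH] a ea a0.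
  by rewrite -psum0 a0// normr0.
have : pseries_diffs a n = 0.
  apply: IH => [|x xd]; first exact: entire_diffs.
  have H1 := is_derive_psum x ea.
  have H2 : is_derive x (1 : R) (psum a) 0.
    apply: (@near_eq_is_derive _ _ _ (cst 0)).
    near=> y; rewrite a0//; near: y.
    exact: (@cvgr_norm_lt R R^o _ (nbhs x) _ id x).
  by rewrite -(@derive_val _ _ _ _ _ _ _ H1) (@derive_val _ _ _ _ _ _ _ H2).
by move/eqP; rewrite /pseries_diffs mulf_eq0 pnatr_eq0/= => /eqP.
Unshelve. all: by end_near. Qed.

Lemma psum_inj a b (d : R) : 0 < d -> entire a -> entire b ->
  (forall x, `|x| < d -> psum a x = psum b x) -> a = b.
Proof.
move=> d0 ea eb ab; apply/funext => n; apply/eqP; rewrite -subr_eq0; apply/eqP.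
apply: (psum_eq0 d0 (entireB ea eb)) => x /ab abx.
by rewrite psumB// abx subrr.
Qed.

Definition conv a b n := \sum_(i < n.+1) a i * b (n - i)%N.

Lemma entire_conv a b : entire a -> entire b -> entire (conv a b).
Proof.
move=> ea eb e e0; have e20 : 0 < e / 2 by rewrite divr_gt0.
have [A A0 HA] := entire_bound ea e20; have [B B0 HB] := entire_bound eb e20.
exists (A * B * 2) => n; apply: le_trans (ler_norm_sum _ _ _) _.
apply: (@le_trans _ _ (\sum_(i < n.+1) A * B * (e / 2) ^+ n)).
  apply: ler_sum => i _; rewrite normrM.
  rewrite -[in (e / 2) ^+ n](@subnKC i n) ?(leq_ord i)// exprD.
  by rewrite mulrACA; apply: ler_pM.
rewrite sumr_const card_ord -[X in X <= _]mulr_natr -!mulrA.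
rewrite ler_wpM2l// ler_wpM2l// exprMn exprVn -mulrA mulrC.
apply: ler_wpM2r; first by rewrite exprn_ge0// ltW.
rewrite mulrC ler_pdivrMr ?exprn_gt0//.
by rewrite -exprS natr_lt_exp2.
Qed.

Lemma sum_conv (u v : nat -> R) n :
  \sum_(k < n) conv u v k = \sum_(i < n) u i * \sum_(j < n - i) v j.
Proof.
elim: n => [|n IH]; first by rewrite !big_ord0.
rewrite big_ord_recr/= IH [in RHS]big_ord_recr/= subSnn big_ord1 /conv.
rewrite [X in _ + X]big_ord_recr/= subnn addrA; congr (_ + _).
rewrite -big_split/=; apply: eq_bigr => i _.
by rewrite subSn ?(ltnW (ltn_ord i))// big_ord_recr/= mulrDr.
Qed.

Lemma conv_exp a b x n :
  conv (fun i => a i * x ^+ i) (fun i => b i * x ^+ i) n = conv a b n * x ^+ n.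
Proof.
rewrite /conv mulr_suml; apply: eq_bigr => i _.
by rewrite mulrACA -exprD subnKC// (leq_ord i).
Qed.

(** Mertens' argument: the partial sum of the product differs from that of [a] times the full sum of
    [b] by the terms [a_i x^i] times tails of [b] of order [n - i]. Each of these [n] errors is at
    most [A B 4^-n]. *)
Lemma psum_conv a b x : entire a -> entire b ->
  psum (conv a b) x = psum a x * psum b x.
Proof.
move=> ea eb; apply: psum_eq.
have [A A0 HA] := entire_quarter ea (normr_ge0 x).
have [B B0 HB] := psum_tail eb (normr_ge0 x).
apply: (@cvg_sub0 _ _ _ \oo _ _ (fun n => pseries a x n * psum b x)); last first.
  by apply: cvgMl; exact: psum_cvg.
have key n : `|pseries (conv a b) x n - pseries a x n * psum b x| <=
    geometric (A * B) 2^-1 n.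
  rewrite /pseries /series /= !big_mkord.
  under eq_bigr do rewrite -conv_exp.
  rewrite sum_conv mulr_suml -sumrB.
  apply: le_trans (ler_norm_sum _ _ _) _.
  apply: (@le_trans _ _ (\sum_(i < n) A * B * 4^-1 ^+ n)).
    apply: ler_sum => i _; rewrite -mulrBr normrM.
    rewrite -[in X in _ <= X](@subnKC i n) ?(ltnW (ltn_ord i))// exprD mulrACA.
    by apply: ler_pM => //; [exact: HA|rewrite distrC; exact: HB].
  rewrite sumr_const card_ord -[X in X <= _]mulr_natr -!mulrA.
  rewrite ler_wpM2l// ler_wpM2l// (_ : 4 = 2 * 2 :> R); last by ring.
  rewrite invfM exprMn -mulrA ler_piMr ?exprn_ge0 ?invr_ge0//.
  by rewrite mulrC exprVn ler_pdivrMr ?exprn_gt0// mul1r natr_lt_exp2.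
apply/norm_cvg0P.
apply: (@squeeze_cvgr _ _ _ _ (cst 0) (geometric (A * B) 2^-1)).
- by near=> n; rewrite normr_ge0; exact: key.
- exact: cvg_cst.
- by apply: cvg_geometric; rewrite ger0_norm ?invr_ge0//; lra.
Unshelve. all: by end_near. Qed.

End EntireSeries.

(** * Differential equations on the real line *)

Section Derivatives.
Variable R : realType.
Implicit Types (f g u v : R -> R) (x : R).

Lemma is_derive1M f g x a b : is_derive x 1 f a -> is_derive x 1 g b ->
  is_derive x 1 (fun y => f y * g y) (a * g x + f x * b).
Proof.
move=> fa gb; apply: is_derive_eq (is_deriveM fa gb) _.
by rewrite addrC /GRing.scale/= (mulrC (g x)).
Qed.

Lemma is_derive1D f g x a b : is_derive x 1 f a -> is_derive x 1 g b ->
  is_derive x 1 (fun y => f y + g y) (a + b).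
Proof. by move=> fa gb; exact: is_deriveD. Qed.

Lemma is_derive1B f g x a b : is_derive x 1 f a -> is_derive x 1 g b ->
  is_derive x 1 (fun y => f y - g y) (a - b).
Proof. by move=> fa gb; exact: is_deriveB. Qed.

Lemma is_derive1N f x a : is_derive x 1 f a -> is_derive x 1 (fun y => - f y) (- a).
Proof. by move=> fa; exact: is_deriveN. Qed.

Lemma is_derive1_expR f x a : is_derive x 1 f a ->
  is_derive x 1 (fun y => expR (f y)) (expR (f x) * a).
Proof. by move=> fa; apply: (@is_derive1_comp _ expR f). Qed.

Lemma is_derive1_cos f x a : is_derive x 1 f a ->
  is_derive x 1 (fun y => cos (f y)) (- sin (f x) * a).
Proof. by move=> fa; apply: (@is_derive1_comp _ cos f). Qed.

Lemma is_derive1_sin f x a : is_derive x 1 f a ->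
  is_derive x 1 (fun y => sin (f y)) (cos (f x) * a).
Proof. by move=> fa; apply: (@is_derive1_comp _ sin f). Qed.

Lemma is_derive1Ml c x : is_derive x 1 (fun y : R => y * c) c.
Proof.
have := is_derive1M (is_derive_id x 1) (is_derive_cst c x 1).
by rewrite mul1r mulr0 addr0.
Qed.

Lemma zero_derive_cst f (x y : R) : (forall z : R, is_derive z (1 : R) f 0) -> f x = f y.
Proof. by move=> f0; apply: is_derive_0_is_cst. Qed.

(* The solution of [F' = h F] with [F 0 = 1] is the exponential of the primitive of [h],
   where [F = A + i B] and [u + i v] is that primitive. *)
Lemma complex_exp_ode A B A' B' u v u' v' :
  (forall x, is_derive x 1 A (A' x)) -> (forall x, is_derive x 1 B (B' x)) ->
  (forall x, is_derive x 1 u (u' x)) -> (forall x, is_derive x 1 v (v' x)) ->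
  (forall x, A' x = u' x * A x - v' x * B x) ->
  (forall x, B' x = u' x * B x + v' x * A x) ->
  A 0 = 1 -> B 0 = 0 -> u 0 = 0 -> v 0 = 0 ->
  forall x, A x = expR (u x) * cos (v x) /\ B x = expR (u x) * sin (v x).
Proof.
move=> dA dB du dv eA eB A0 B0 u0 v0 x.
(* [F] and [G] are the real and imaginary parts of [(A + i B) exp (- (u + i v))], whose derivative
   vanishes. *)
pose F y := expR (- u y) * (A y * cos (v y) + B y * sin (v y)).
pose G y := expR (- u y) * (B y * cos (v y) - A y * sin (v y)).
have dc y := is_derive1_cos (dv y); have ds y := is_derive1_sin (dv y).
have de y := is_derive1_expR (is_derive1N (du y)).
have F1 : F x = 1.
  transitivity (F 0).
    apply: zero_derive_cst => y.
    apply: (is_derive_eq (is_derive1M (de y) (is_derive1D (is_derive1M (dA y) (dc y)) (is_derive1M (dB y) (ds y))))).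
    by rewrite eA eB; ring.
  by rewrite /F u0 v0 A0 B0 oppr0 expR0 cos0 sin0 !mul1r mul0r addr0.
have G0 : G x = 0.
  transitivity (G 0).
    apply: zero_derive_cst => y.
    apply: (is_derive_eq (is_derive1M (de y) (is_derive1B (is_derive1M (dB y) (dc y)) (is_derive1M (dA y) (ds y))))).
    by rewrite eA eB; ring.
  by rewrite /G u0 v0 A0 B0 oppr0 expR0 cos0 sin0 mul0r mulr0 subrr mulr0.
have cs := cos2Dsin2 (v x); have ee : expR (u x) * expR (- u x) = 1.
  by rewrite -expRD subrr expR0.
rewrite /F /G in F1 G0; move: F1 G0 cs ee.
set a := A x; set b := B x; set c := cos _; set s := sin _.
set e := expR (u x); set e' := expR _ => F1 G0 cs ee.
have h1 : a * c + b * s = e by rewrite -[LHS]mul1r -ee -mulrA F1 mulr1.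
have h2 : b * c - a * s = 0 by rewrite -[LHS]mul1r -ee -mulrA G0 mulr0.
split; rewrite -h1.
- transitivity (a * (c ^+ 2 + s ^+ 2) + (b * c - a * s) * s); last by ring.
  by rewrite cs h2; ring.
- transitivity (b * (c ^+ 2 + s ^+ 2) - (b * c - a * s) * c); last by ring.
  by rewrite cs h2; ring.
Qed.

End Derivatives.

(** * Values along complex rays *)

Section Rays.
Variable R : realType.
Implicit Types (a b g : nat -> R) (x r t : R).

Lemma entire_cos a t : entire a -> entire (fun j => a j * cos (t *+ j)).
Proof. by move=> ea; apply: entireM_bounded => // n; exact: cos_max. Qed.

Lemma entire_sin a t : entire a -> entire (fun j => a j * sin (t *+ j)).
Proof. by move=> ea; apply: entireM_bounded => // n; exact: sin_max. Qed.

(* Real and imaginary parts of the sum of the series at [r * exp (i t)]. *)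
Definition psum_cos a t r := psum (fun j => a j * cos (t *+ j)) r.
Definition psum_sin a t r := psum (fun j => a j * sin (t *+ j)) r.

Lemma psum_cos_conv a b t r : entire a -> entire b ->
  psum_cos (conv a b) t r =
  psum_cos a t r * psum_cos b t r - psum_sin a t r * psum_sin b t r.
Proof.
move=> ea eb; have [ac as_] := (entire_cos t ea, entire_sin t ea).
have [bc bs] := (entire_cos t eb, entire_sin t eb).
rewrite /psum_cos /psum_sin -!psum_conv// -psumB; [|exact: entire_conv..].
congr psum; apply/funext => n; rewrite /conv mulr_suml -sumrB.
apply: eq_bigr => i _.
have -> : t *+ n = t *+ i + t *+ (n - i) by rewrite -mulrnDr subnKC ?leq_ord.
by rewrite cosD; ring.
Qed.

Lemma psum_sin_conv a b t r : entire a -> entire b ->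
  psum_sin (conv a b) t r =
  psum_sin a t r * psum_cos b t r + psum_cos a t r * psum_sin b t r.
Proof.
move=> ea eb; have [ac as_] := (entire_cos t ea, entire_sin t ea).
have [bc bs] := (entire_cos t eb, entire_sin t eb).
rewrite /psum_cos /psum_sin -!psum_conv// -psumD; [|exact: entire_conv..].
congr psum; apply/funext => n; rewrite /conv mulr_suml -big_split/=.
apply: eq_bigr => i _.
have -> : t *+ n = t *+ i + t *+ (n - i) by rewrite -mulrnDr subnKC ?leq_ord.
by rewrite sinD; ring.
Qed.

Lemma is_derive_psum_cos a t r : entire a ->
  is_derive r 1 (psum_cos a t)
    (cos t * psum_cos (pseries_diffs a) t r - sin t * psum_sin (pseries_diffs a) t r).
Proof.
move=> ea; have ed := entire_diffs ea.
apply: is_derive_eq; first exact/is_derive_psum/entire_cos.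
rewrite -!psumZ -?psumB; try exact: entire_cos; try exact: entire_sin.
- congr psum; apply/funext => n; rewrite /pseries_diffs (mulrSr t) cosD; ring.
- exact/entireZ/entire_cos.
- exact/entireZ/entire_sin.
Qed.

Lemma is_derive_psum_sin a t r : entire a ->
  is_derive r 1 (psum_sin a t)
    (cos t * psum_sin (pseries_diffs a) t r + sin t * psum_cos (pseries_diffs a) t r).
Proof.
move=> ea; have ed := entire_diffs ea.
apply: is_derive_eq; first exact/is_derive_psum/entire_sin.
rewrite -!psumZ -?psumD; try exact: entire_cos; try exact: entire_sin.
- congr psum; apply/funext => n; rewrite /pseries_diffs (mulrSr t) sinD; ring.
- exact/entireZ/entire_sin.
- exact/entireZ/entire_cos.
Qed.

Lemma entire_invfact : entire (fun j => (j`!%:R)^-1 : R).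
Proof.
move=> e e0; have ei : 0 <= e^-1 by rewrite invr_ge0 ltW.
exists (expR e^-1) => -[|n].
  rewrite fact0 invr1 normr1 expr0 mulr1.
  by apply: le_trans (expR_ge1Dx _); rewrite lerDl.
have := expR_ge1Dxn n ei; rewrite ger0_norm ?invr_ge0// => h.
rewrite -ler_pdivrMr ?exprn_gt0// mulrC -exprVn.
by apply: le_trans h; rewrite lerDr.
Qed.

Lemma psum_invfact x : psum (fun j => (j`!%:R)^-1) x = expR x.
Proof. by rewrite /psum /expR exp_coeffE. Qed.

(** The last two hypotheses say [m' = h m] on every ray, and [g] is the primitive of [h] vanishing
    at 0. Uniqueness for this linear equation gives [m = exp g], so that zero-freeness of [m] comes
    out instead of going in. *)
Lemma psum_diffs_log m h g t r : entire m -> entire h -> entire g -> m 0%N = 1 ->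
  g 0%N = 0 -> pseries_diffs g = h ->
  (forall t r, psum_cos (pseries_diffs m) t r =
     psum_cos h t r * psum_cos m t r - psum_sin h t r * psum_sin m t r) ->
  (forall t r, psum_sin (pseries_diffs m) t r =
     psum_sin h t r * psum_cos m t r + psum_cos h t r * psum_sin m t r) ->
  psum_cos m t r = expR (psum_cos g t r) * cos (psum_sin g t r) /\
  psum_sin m t r = expR (psum_cos g t r) * sin (psum_sin g t r).
Proof.
move=> em eh eg m0 g0 gh hc hs.
apply: (@complex_exp_ode R (psum_cos m t) (psum_sin m t) _ _ _ _ _ _
  (fun r => is_derive_psum_cos t r em) (fun r => is_derive_psum_sin t r em)
  (fun r => is_derive_psum_cos t r eg) (fun r => is_derive_psum_sin t r eg)).
- by move=> x; rewrite hc hs gh; ring.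
- by move=> x; rewrite hc hs gh; ring.
- by rewrite /psum_cos psum0 m0 mulr0n cos0 mulr1.
- by rewrite /psum_sin psum0 mulr0n sin0 mulr0.
- by rewrite /psum_cos psum0 g0 mul0r.
- by rewrite /psum_sin psum0 mulr0n sin0 mulr0.
Qed.

Lemma psum_cexp t r :
  psum_cos (fun j => (j`!%:R)^-1) t r = expR (r * cos t) * cos (r * sin t) /\
  psum_sin (fun j => (j`!%:R)^-1) t r = expR (r * cos t) * sin (r * sin t).
Proof.
have ei := entire_invfact.
have := @complex_exp_ode R _ _ _ _ (fun r => r * cos t) (fun r => r * sin t) _ _
  (fun r => is_derive_psum_cos t r ei) (fun r => is_derive_psum_sin t r ei)
  (is_derive1Ml _) (is_derive1Ml _).
apply.
- by move=> x; rewrite pseries_diffs_inv_fact.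
- by move=> x; rewrite pseries_diffs_inv_fact.
- by rewrite /psum_cos psum0 fact0 invr1 mulr0n cos0 mulr1.
- by rewrite /psum_sin psum0 mulr0n sin0 mulr0.
- by rewrite mul0r.
- by rewrite mul0r.
Qed.

End Rays.

(** * Power series of the exponential of a polynomial *)

Section ExpPoly.
Variable R : realType.
Implicit Types (p q : {poly R}) (x r : R).

(* Coefficients of the power series of [exp p], when [p`_0 = 0]. *)
Definition expcoef p j := \sum_(n < j.+1) (p ^+ n)`_j / n`!%:R.

(** A majorant: it turns bounds on the coefficients of [exp p] into values at a positive point, in
    [entire_expcoef] and again for the growth bound in [cramer_analytic]. *)
Definition normpoly p := \poly_(i < size p) `|p`_i|.

Lemma entire_poly p : entire (fun j => p`_j).
Proof. by apply: (@entire_fin _ _ (size p)) => i /leq_sizeP ->. Qed.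

Lemma psum_poly p x : psum (fun j => p`_j) x = p.[x].
Proof. by rewrite horner_coef; apply: psum_fin => i /leq_sizeP ->. Qed.

Lemma coef_normpoly p i : (normpoly p)`_i = `|p`_i|.
Proof.
rewrite coef_poly; case: ltnP => // /leq_sizeP ->//.
by rewrite normr0.
Qed.

(** The order of vanishing at 0 is multiplicative in the exponent. This is why cutting the
    exponential series at [n <= j] in [expcoef] loses nothing. *)
Lemma coef_exp_small p n j : p`_0 = 0 -> (j < n)%N -> (p ^+ n)`_j = 0.
Proof.
move=> p0; elim: n j => // n IH j; rewrite ltnS => jn.
rewrite exprS coefM big1// => -[[|i] /= ij] _; first by rewrite p0 mul0r.
by rewrite IH ?mulr0//; lia.
Qed.

Lemma coef_exp_norm p n j : `|(p ^+ n)`_j| <= (normpoly p ^+ n)`_j.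
Proof.
elim: n j => [|n IH] j; first by rewrite !expr0 coef1; case: eqP; rewrite ?normr1 ?normr0.
rewrite !exprS !coefM; apply: le_trans (ler_norm_sum _ _ _) _.
apply: ler_sum => i _; rewrite normrM coef_normpoly.
by apply: ler_wpM2l => //; exact: IH.
Qed.

Lemma expcoef_norm p j : `|expcoef p j| <= expcoef (normpoly p) j.
Proof.
apply: le_trans (ler_norm_sum _ _ _) _; apply: ler_sum => n _.
by rewrite normrM [`|_^-1|]ger0_norm ?invr_ge0// ler_wpM2r ?invr_ge0// coef_exp_norm.
Qed.

Lemma sum_exp_le x n : 0 <= x -> \sum_(i < n) x ^+ i / i`!%:R <= expR x.
Proof.
move=> x0; rewrite -psum_invfact.
apply: (@cvgr_to_ge _ \oo _ _ (pseries (fun j => (j`!%:R)^-1) x)).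
  exact/psum_cvg/entire_invfact.
exists n => // m /= nm; rewrite /pseries/series/= (@big_cat_nat _ _ _ n)//=.
rewrite big_mkord; under eq_bigr do rewrite mulrC.
by rewrite lerDl sumr_ge0// => i _; rewrite mulr_ge0 ?invr_ge0// exprn_ge0.
Qed.

(** Cauchy's estimate at radius [1 / e]: for a polynomial with nonnegative coefficients a single
    term is at most the value, and the truncated exponential series is at most [expR]. *)
Lemma entire_expcoef p : entire (expcoef p).
Proof.
move=> e e0; exists (expR (normpoly p).[e^-1]) => j.
apply: le_trans (expcoef_norm _ _) _.
have ei : 0 <= e^-1 by rewrite invr_ge0 ltW.
have co n i : 0 <= (normpoly p ^+ n)`_i by apply: le_trans (coef_exp_norm _ _ _).
have np0 : 0 <= (normpoly p).[e^-1].
  rewrite horner_coef; apply: sumr_ge0 => i _.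
  by rewrite mulr_ge0 ?exprn_ge0// coef_normpoly.
rewrite -ler_pdivrMr ?exprn_gt0//.
apply: le_trans (sum_exp_le j.+1 np0); rewrite mulr_suml.
apply: ler_sum => n _; rewrite mulrAC ler_wpM2r ?invr_ge0//.
rewrite -horner_exp horner_coef -exprVn.
have [js|] := ltnP j (size (normpoly p ^+ n)).
  rewrite (bigD1 (Ordinal js))//= lerDl.
  by apply: sumr_ge0 => i _; rewrite mulr_ge0// exprn_ge0.
move=> /leq_sizeP ->//; rewrite mul0r.
by apply: sumr_ge0 => i _; rewrite mulr_ge0// exprn_ge0.
Qed.

Lemma expcoef_wide p j N : p`_0 = 0 -> (j < N)%N ->
  expcoef p j = \sum_(n < N) (p ^+ n)`_j / n`!%:R.
Proof.
move=> p0 jN; rewrite /expcoef -!(big_mkord xpredT (fun n => (p ^+ n)`_j / n`!%:R)).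
rewrite [RHS](@big_cat_nat _ _ _ j.+1)//= [X in _ = _ + X]big1_seq ?addr0// => n.
rewrite mem_index_iota => /andP[_ /andP[jn _]].
by rewrite coef_exp_small// mul0r.
Qed.

Lemma diffs_expcoef p : p`_0 = 0 ->
  pseries_diffs (expcoef p) = conv (expcoef p) (fun j => (p^`())`_j).
Proof.
move=> p0; apply/funext => j; rewrite /pseries_diffs /conv.
rewrite /expcoef big_ord_recl expr0 coef1 mul0r add0r mulr_sumr.
(* All [expcoef p i] are rewritten with the common width [j + 1], so that the two sums can be
   exchanged. *)
under [RHS]eq_bigr => i _.
  rewrite -/(expcoef p i) (@expcoef_wide _ _ j.+1)// mulr_suml; over.
rewrite exchange_big; apply: eq_bigr => n _ /=.
have -> : j.+1%:R * ((p ^+ (bump 0 n))`_j.+1 / (bump 0 n)`!%:R) =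
  (p ^+ n * p^`())`_j / n`!%:R.
  rewrite mulrA mulr_natl -coef_deriv deriv_exp coefMn /bump/= add1n factS natrM.
  by rewrite add0n (mulrC p^`()) -(mulr_natr (_)`_j) invfM mulrA mulfK// pnatr_eq0.
by rewrite coefM mulr_suml; apply: eq_bigr => i _; rewrite mulrAC.
Qed.

Lemma psum_expcoef p x : p`_0 = 0 -> psum (expcoef p) x = expR p.[x].
Proof.
move=> p0; have ee := entire_expcoef p; have ep := entire_poly p.
have edp := entire_poly p^`().
pose F y := psum (expcoef p) y * expR (- psum (fun j => p`_j) y).
have F1 : F x = 1.
  transitivity (F 0); last first.
    rewrite /F !psum0 p0 oppr0 expR0 mulr1 /expcoef big_ord1 expr0 coef1 fact0.
    by rewrite divr1.
  apply: zero_derive_cst => y.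
  apply: (is_derive_eq (is_derive1M (is_derive_psum y ee)
    (is_derive1_expR (is_derive1N (is_derive_psum y ep))))).
  rewrite diffs_expcoef// psum_conv//.
  rewrite (_ : pseries_diffs (fun j => p`_j) = fun j => (p^`())`_j); first ring.
  by apply/funext => j; rewrite coef_deriv /pseries_diffs mulr_natl.
have := F1; rewrite /F psum_poly => h.
by rewrite -[LHS]mulr1 -(expR0 R) -(addNr p.[x]) expRD mulrA h mul1r.
Qed.

(** A formal identity obtained analytically: both sides have the same sum on an interval. *)
Lemma expcoef_conv p : p`_0 = 0 ->
  conv (expcoef p) (expcoef (- p)) = (fun n => (n == 0%N)%:R).
Proof.
move=> p0; have np0 : (- p)`_0 = 0 by rewrite coefN p0 oppr0.
have [e1 e2] := (entire_expcoef p, entire_expcoef (- p)).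
have d0 : forall i, (1 <= i)%N -> (fun n : nat => (n == 0%N)%:R : R) i = 0 by case.
apply: (@psum_inj _ _ _ 1) => // [||x _]; first exact: entire_conv.
  exact: entire_fin d0.
rewrite psum_conv// !psum_expcoef// hornerN -expRD subrr expR0 (psum_fin _ d0).
by rewrite big_ord1 eqxx mul1r expr0.
Qed.

Lemma coef_exp_odd p n j : (forall i, odd i -> p`_i = 0) -> odd j -> (p ^+ n)`_j = 0.
Proof.
move=> po; elim: n j => [|n IH] j oj; first by rewrite expr0 coef1; case: j oj.
rewrite exprS coefM big1// => i _.
have [oi|ei] := boolP (odd i); first by rewrite po ?mul0r.
by rewrite IH ?mulr0// oddB ?(leq_ord i)// oj (negbTE ei).
Qed.

Lemma expcoef_odd p j : (forall i, odd i -> p`_i = 0) -> odd j -> expcoef p j = 0.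
Proof. by move=> po oj; rewrite /expcoef big1// => n _; rewrite coef_exp_odd// mul0r. Qed.

End ExpPoly.

(** * Averages over roots of unity *)

Section Averages.
Variable R : realType.
Implicit Types (x t : R).

(** Let [Z = C + i S] be the sum of the [exp (i l x)]. Shifting [l] gives [Z = exp (i x) Z], and the
    real part of [conj Z (Z - exp (i x) Z)] is [(1 - cos x) |Z|^2]. *)
Lemma sum_cos_cycle n x : cos (x *+ n) = 1 -> sin (x *+ n) = 0 -> cos x != 1 ->
  \sum_(l < n) cos (x *+ l) = 0.
Proof.
move=> cn sn cx; set C := \sum_(l < n) _.
pose S := \sum_(l < n) sin (x *+ l).
have shiftC : \sum_(l < n) cos (x *+ l.+1) = C.
  apply: (addrI (cos (x *+ 0))).
  rewrite -(big_ord_recl n (fun l : 'I_n.+1 => cos (x *+ l)))/=.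
  by rewrite big_ord_recr/= cn mulr0n cos0 addrC.
have shiftS : \sum_(l < n) sin (x *+ l.+1) = S.
  apply: (addrI (sin (x *+ 0))).
  rewrite -(big_ord_recl n (fun l : 'I_n.+1 => sin (x *+ l)))/=.
  by rewrite big_ord_recr/= sn mulr0n sin0 addrC.
have eC : C = C * cos x - S * sin x.
  rewrite -{1}shiftC !mulr_suml -sumrB; apply: eq_bigr => l _.
  by rewrite mulrSr cosD.
have eS : S = S * cos x + C * sin x.
  rewrite -{1}shiftS !mulr_suml -big_split/=; apply: eq_bigr => l _.
  by rewrite mulrSr sinD addrC (mulrC (cos _)) addrC.
have h : (1 - cos x) * (C ^+ 2 + S ^+ 2) = 0.
  transitivity (C * (C - C * cos x) + S * (S - S * cos x)); first by ring.
  rewrite {2}eC {3}eS; ring.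
move/eqP: h; rewrite mulf_eq0 subr_eq0 eq_sym (negbTE cx)/=.
by rewrite paddr_eq0 ?sqr_ge0// !sqrf_eq0 => /andP[/eqP].
Qed.

Lemma cos_neq1 x : 0 < x < pi *+ 2 -> cos x != 1.
Proof.
move=> /andP[x0 x2]; have xx : x = (x / 2) *+ 2 by rewrite -mulr_natr divfK.
have : 0 < sin (x / 2).
  by apply: sin_gt0_pi; rewrite divr_gt0//= ltr_pdivrMr// mulr_natr.
apply: contraTneq => c1; rewrite xx cos_mulr2n cos2sin2 in c1.
have -> : sin (x / 2) = 0; last by rewrite ltxx.
apply/eqP; rewrite -sqrf_eq0; apply/eqP; move: c1; set u := _ ^+ 2; lra.
Qed.

Lemma cos_2pi_mul n : cos (pi *+ 2 *+ n : R) = 1.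
Proof. by have := periodicn (@cosD2pi R) n 0; rewrite add0r cos0. Qed.

Lemma sin_2pi_mul n : sin (pi *+ 2 *+ n : R) = 0.
Proof. by have := periodicn (@sinD2pi R) n 0; rewrite add0r sin0. Qed.

Definition angle N (l : nat) : R := (pi *+ 2 / N%:R) *+ l.

Lemma sum_cos_angle N k : (0 < k < N)%N -> \sum_(l < N) cos (angle N l *+ k) = 0.
Proof.
move=> /andP[k0 kN]; have N0 : (N%:R : R) != 0 by rewrite pnatr_eq0; lia.
pose x : R := (pi *+ 2 / N%:R) *+ k.
under eq_bigr => l _ do rewrite /angle mulrnAC -/x.
have xN : x *+ N = pi *+ 2 *+ k.
  by rewrite /x mulrnAC -(mulr_natr (_ / _)) divfK.
apply: sum_cos_cycle; rewrite ?xN ?cos_2pi_mul ?sin_2pi_mul//.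
apply: cos_neq1; rewrite /x -mulr_natr mulr_gt0 ?ltr0n//=; last first.
  by apply: divr_gt0; [rewrite mulrn_wgt0// pi_gt0|rewrite ltr0n; lia].
rewrite mulrAC ltr_pdivrMr ?ltr0n; last lia.
by rewrite ltr_pM2l ?ltr_nat// mulrn_wgt0// pi_gt0.
Qed.

(** The bound on [j + n] excludes aliasing: [j + n] and, for distinct [j] and [n], their distance
    lie strictly between 0 and [N]. *)
Lemma sum_cos_cos_angle N j n : (0 < n)%N -> (j + n < N)%N ->
  \sum_(l < N) cos (angle N l *+ j) * cos (angle N l *+ n) = N%:R / 2 * (j == n)%:R.
Proof.
move=> n0 jnN.
transitivity (2^-1 * (\sum_(l < N) cos (angle N l *+ (j + n)) +
    \sum_(l < N) cos (angle N l *+ j - angle N l *+ n))).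
  rewrite -big_split/= mulr_sumr; apply: eq_bigr => l _.
  by rewrite mulrnDr cosD cosB; field.
rewrite sum_cos_angle ?add0r; last by lia.
case: ltngtP => jn; last first.
- by rewrite jn; under eq_bigr do rewrite subrr cos0; rewrite sumr_const card_ord mulr1 mulrC.
- under eq_bigr => l _ do rewrite -mulrnBr ?(ltnW jn)//.
  by rewrite sum_cos_angle ?mulr0//; lia.
- under eq_bigr => l _ do rewrite -cosN opprB -mulrnBr ?(ltnW jn)//.
  by rewrite sum_cos_angle ?mulr0//; lia.
Qed.

End Averages.

(** * Entire logarithms of moment generating functions *)

Section Liouville.
Variable R : realType.
Implicit Types (g : nat -> R) (x r t K : R).

Lemma exp_quarter_cvg0 (A : R) : A * 4^-1 ^+ n @[n --> \oo] --> 0.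
Proof. by apply: (@cvg_geometric R A 4^-1); rewrite ger0_norm; lra. Qed.

(* Averages the bound against the nonnegative kernel [1 + s * cos (n t)] over the
   [N]-th roots of unity. *)
Lemma psum_cos_average g n r (s K : R) : entire g -> (0 < n)%N -> 0 <= r ->
  s = 1 \/ s = -1 -> (forall t, psum_cos g t r <= K) ->
  g 0%N + s * g n * r ^+ n / 2 <= K.
Proof.
move=> eg n0 r0 s1 gK; have [A A0 HA] := entire_quarter eg r0.
have tail J t : `|psum_cos g t r - \sum_(j < J) g j * cos (t *+ j) * r ^+ j| <= A * 2 * 4^-1 ^+ J.
  apply: psum_tail_bound => // [|m]; first exact: entire_cos.
  rewrite mulrAC normrM; apply: le_trans (HA m r _); last by rewrite ger0_norm.
  by rewrite ler_piMr// cos_max.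
have main J : (n < J)%N -> g 0%N + s * g n * r ^+ n / 2 <= K + A * 2 * 4^-1 ^+ J.
  (* [N] exceeds every [j + n] with [j < J], so that the average isolates the coefficients 0 and [n]
     exactly. *)
  move=> nJ; pose N := (J + n).+1; have N0 : (0 : R) < N%:R by rewrite ltr0n.
  rewrite -(ler_pM2l N0).
  have sw l : 0 <= 1 + s * cos (angle R N l *+ n).
    have := cos_max (angle R N l *+ n); rewrite ler_norml => /andP[].
    by case: s1 => ->; lra.
  have step : \sum_(l < N) (\sum_(j < J) g j * cos (angle R N l *+ j) * r ^+ j) *
      (1 + s * cos (angle R N l *+ n)) <=
      \sum_(l < N) (K + A * 2 * 4^-1 ^+ J) * (1 + s * cos (angle R N l *+ n)).
    apply: ler_sum => l _; apply: ler_wpM2r => //.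
    have := gK (angle R N l); have := tail J (angle R N l).
    by rewrite ler_norml => /andP[]; lra.
  have e1 : \sum_(l < N) (K + A * 2 * 4^-1 ^+ J) * (1 + s * cos (angle R N l *+ n)) =
      N%:R * (K + A * 2 * 4^-1 ^+ J).
    rewrite -mulr_sumr big_split/= sumr_const card_ord -mulr_sumr sum_cos_angle; last by lia.
    by rewrite mulr0 addr0 mulrC.
  have e2 : \sum_(l < N) (\sum_(j < J) g j * cos (angle R N l *+ j) * r ^+ j) *
      (1 + s * cos (angle R N l *+ n)) = N%:R * (g 0%N + s * g n * r ^+ n / 2).
    under eq_bigr => l _ do rewrite mulr_suml.
    rewrite exchange_big/=.
    transitivity (\sum_(j < J) g j * r ^+ j *
       (N%:R * (j == 0 :> nat)%:R + s * (N%:R / 2 * (j == n :> nat)%:R))).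
      apply: eq_bigr => j _.
      rewrite -sum_cos_cos_angle//; last by have := ltn_ord j; lia.
      have -> : N%:R * (j == 0 :> nat)%:R = \sum_(l < N) cos (angle R N l *+ j).
        case: eqP => [->|/eqP j0].
          by under [RHS]eq_bigr do rewrite mulr0n cos0; rewrite sumr_const card_ord mulr1.
        by rewrite sum_cos_angle ?mulr0//; have := ltn_ord j; lia.
      rewrite mulr_sumr -big_split/= mulr_sumr; apply: eq_bigr => l _; ring.
    under eq_bigr do rewrite mulrDr.
    rewrite big_split/= (bigD1 (Ordinal (ltn_trans n0 nJ)))//= big1 => [|j j0]; last first.
      by rewrite (_ : (j == 0 :> nat) = false) ?mulr0//; apply/negbTE; move: j0; rewrite -val_eqE.
    rewrite (bigD1 (Ordinal nJ))//= big1 => [|j j0]; last first.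
      by rewrite (_ : (j == n :> nat) = false) ?mulr0//; apply/negbTE; move: j0; rewrite -val_eqE.
    by rewrite (eqxx n) expr0 /=; move: (N%:R : R) => M; field.
  by rewrite e1 e2 in step.
apply: (@cvgr_to_ge _ \oo _ _ (fun J => K + A * 2 * 4^-1 ^+ J)).
  rewrite -[X in _ --> X]addr0; apply: cvgD; first exact: cvg_cst.
  exact: exp_quarter_cvg0.
by exists n.+1 => // J /= nJ; exact: main.
Qed.

Lemma le0_of_linear_bound (a C : R) : (forall r, 1 <= r -> a * r <= C) -> a <= 0.
Proof.
move=> h; rewrite leNgt; apply/negP => a0.
have C0 : 0 <= `|C| / a by rewrite divr_ge0// ltW.
have := h (`|C| / a + 1); rewrite mulrDr mulr1 mulrCA divff ?gt_eqF// mulr1.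
have := ler_norm C; lra.
Qed.

(** A one-sided bound suffices: averaging with both signs [s] gives
    [g_0 + s g_n r^n / 2 <= K (1 + r^d)], and [r r^d <= r^n] because [n > d], so [s g_n] cannot be
    positive. *)
Lemma real_part_liouville g d K : entire g ->
  (forall r t, 0 <= r -> psum_cos g t r <= K * (1 + r ^+ d)) ->
  forall n, (d < n)%N -> g n = 0.
Proof.
move=> eg gK n dn; have n0 : (0 < n)%N by lia.
have main s : s = 1 \/ s = -1 -> s * g n <= 0.
  move=> s1; apply: (@le0_of_linear_bound _ (4 * `|K| + 2 * `|g 0%N|)) => r r1.
  have r0 : 0 <= r by lra.
  have := psum_cos_average eg n0 r0 s1 (fun t => gK r t r0).
  have rd : 1 <= r ^+ d by exact: exprn_ege1.
  have rn : r * r ^+ d <= r ^+ n.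
    by rewrite -exprS ler_weXn2l.
  move=> h; have rd0 : 0 < r ^+ d by lra.
  rewrite leNgt; apply/negP => neg.
  have : 0 < s * g n * r by apply: le_lt_trans neg; rewrite addr_ge0 ?mulr_ge0.
  move=> sgr; have sg : 0 < s * g n by rewrite pmulr_lgt0// in sgr; lra.
  have b1 : s * g n * r * r ^+ d <= s * g n * r ^+ n by rewrite -mulrA ler_pM2l.
  have b2 : (4 * `|K| + 2 * `|g 0%N|) * r ^+ d < s * g n * r * r ^+ d by rewrite ltr_pM2r.
  have b3 : K * (1 + r ^+ d) <= `|K| * (2 * r ^+ d).
    apply: le_trans (ler_wpM2r _ (ler_norm K)) _; first by lra.
    by rewrite ler_wpM2l//; lra.
  have b4 : `|g 0%N| <= `|g 0%N| * r ^+ d by rewrite ler_peMr.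
  have := ler_norm (- g 0%N); rewrite normrN.
  by move: h b1 b2 b3 b4; lra.
apply/eqP; rewrite eq_le; apply/andP; split.
  by have := main 1 (or_introl erefl); rewrite mul1r.
by have := main (-1) (or_intror erefl); rewrite mulN1r oppr_le0.
Qed.

Lemma poly_le0_lead n (c : nat -> R) :
  (forall r, 1 <= r -> \sum_(j < n.+1) c j * r ^+ j <= 0) -> c n <= 0.
Proof.
case: n => [|n] h.
  by have := h 1 (lexx _); rewrite big_ord1 expr0 mulr1.
apply: (@le0_of_linear_bound _ (\sum_(j < n.+1) `|c j|)) => r r1.
have r0 : 0 <= r by lra.
have rn : 0 < r ^+ n by rewrite exprn_gt0//; lra.
rewrite -(ler_pM2r rn) -mulrA -exprS.
have := h r r1; rewrite big_ord_recr/= => hr.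
apply: (@le_trans _ _ (- \sum_(j < n.+1) c j * r ^+ j)); first by lra.
rewrite -sumrN mulr_suml; apply: ler_sum => j _.
apply: le_trans (ler_norm _) _; rewrite normrN normrM normrX (ger0_norm r0).
by rewrite ler_wpM2l// ler_weXn2l// -ltnS.
Qed.

Lemma cos_exp_lt1 t n : 0 < t < pi -> (0 < n)%N -> `|cos t ^+ n| < 1.
Proof.
move=> /sin_gt0_pi st n0; rewrite normrX exprn_ilt1// -?lt0n//.
rewrite -(@ltr_pXn2r _ 2) ?nnegrE// expr1n -normrX ger0_norm ?sqr_ge0//.
have s2 : 0 < sin t ^+ 2 by rewrite exprn_gt0.
by rewrite cos2sin2; lra.
Qed.

(* If [D > 2] is the degree, the leading terms at the angles [2 pi / D] and [pi / D]
   give [g D <= 0] and [0 <= g D]. *)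
Lemma poly_positive_type g d :
  (forall n, (d < n)%N -> g n = 0) ->
  (forall r t, 0 <= r -> psum_cos g t r <= psum g (r * cos t)) ->
  forall n, (2 < n)%N -> g n = 0.
Proof.
elim: d => [|d IH] gd gt n n2; first by apply: gd; lia.
have [d2|d2] := leqP d.+1 2; first by apply: gd; lia.
apply: IH n2 => // m; rewrite leq_eqVlt => /predU1P[<-|]; last exact: gd.
set D := d.+1 in gd d2 *.
(* This is the leading coefficient of [Re g (r exp (i t)) - g (r cos t)], a polynomial in [r] that
   is nonpositive for [r >= 1]. *)
have key t : g D * (cos (t *+ D) - cos t ^+ D) <= 0.
  apply: (@poly_le0_lead D (fun j => g j * (cos (t *+ j) - cos t ^+ j))) => r r1.
  have := gt r t (le_trans ler01 r1).
  rewrite /psum_cos !(@psum_fin _ _ _ D.+1) => [||i Di]; last first.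
    by rewrite gd ?mul0r.
  - exact: gd.
  - rewrite -subr_le0 -sumrB; apply: le_trans; rewrite le_eqVlt; apply/orP; left.
    by apply/eqP; apply: eq_bigr => j _; rewrite exprMn; ring.
have D0 : (0 : R) < D%:R by rewrite ltr0n.
(* Here [D > 2] enters: for [D = 2] the angle would be [pi] and the inequality [key] void, which is
   how the quadratic term survives. *)
have t1 : 0 < (pi *+ 2 / D%:R : R) < pi.
  apply/andP; split; first by rewrite divr_gt0// mulrn_wgt0// pi_gt0.
  by rewrite ltr_pdivrMr// -(mulr_natr pi) ltr_pM2l ?pi_gt0// ltr_nat.
have t2 : 0 < (pi / D%:R : R) < pi.
  rewrite divr_gt0 ?pi_gt0//= ltr_pdivrMr// ltr_pMr ?pi_gt0//.
  by rewrite ltr1n; lia.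
have := key (pi / D%:R); have := key (pi *+ 2 / D%:R).
have := @cos_exp_lt1 _ D t1 isT; have := @cos_exp_lt1 _ D t2 isT.
rewrite -!(mulr_natr (_ / _)) !divfK ?gt_eqF// cos2pi cospi !ltr_norml.
move=> /andP[h1 h2] /andP[h3 h4] k1 k2.
apply/eqP; rewrite eq_le; apply/andP; split.
  by rewrite -(@pmulr_lle0 _ (1 - cos (pi *+ 2 / D%:R) ^+ D))//; lra.
rewrite -oppr_le0 -(@pmulr_lle0 _ (1 + cos (pi / D%:R) ^+ D)); last by lra.
by move: k2; set u := cos _ ^+ _; lra.
Qed.

End Liouville.

Section CramerAnalytic.
Variable R : realType.
Implicit Types (x r t : R).

Lemma psum_cos_pow0 m x : psum_cos m 0 x = psum m x :> R.
Proof. by congr psum; apply/funext => n; rewrite mul0rn cos0 mulr1. Qed.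

Lemma psum_sin_pow0 m x : psum_sin m 0 x = 0 :> R.
Proof.
rewrite /psum_sin (@psum_fin _ _ _ 0) ?big_ord0// => i _.
by rewrite mul0rn sin0 mulr0.
Qed.

Lemma horner_le_pow (q : {poly R}) r : (forall i, 0 <= q`_i) -> 0 <= r ->
  q.[r] <= q.[1] * (1 + r ^+ (size q)).
Proof.
move=> q0 r0; rewrite !horner_coef mulr_suml; apply: ler_sum => i _.
rewrite expr1n mulr1 ler_wpM2l//.
have [r1|r1] := lerP r 1.
  by apply: le_trans (_ : 1 <= _); [exact: exprn_ile1|rewrite lerDl exprn_ge0].
apply: le_trans (_ : r ^+ size q <= _); last by rewrite lerDr.
by rewrite ler_weXn2l ?(ltW r1)// ltnW.
Qed.

Lemma entire_primitive (h : nat -> R) : entire h ->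
  entire (fun j => if j is i.+1 then h i / i.+1%:R else 0).
Proof.
move=> eh e e0; have [A A0 HA] := entire_bound eh e0.
exists (A / e) => -[|i]; first by rewrite normr0 mulr_ge0 ?divr_ge0 ?exprn_ge0// ltW.
rewrite exprS mulrA divfK ?gt_eqF//; apply: le_trans (HA i).
by rewrite normrM ler_piMr// ger0_norm ?invr_ge0// invf_le1 ?ltr0n// ler1n.
Qed.

Lemma diffs_primitive (h : nat -> R) :
  pseries_diffs (fun j => if j is i.+1 then h i / i.+1%:R else 0) = h.
Proof.
by apply/funext => i; rewrite /pseries_diffs mulrC divfK// pnatr_eq0.
Qed.

(* With [c = conv m w] and [d] its inverse series, [h = conv m' (conv w d)] is the
   logarithmic derivative [m' / m], although [m] is not known to be zero-free. *)
Lemma cramer_analytic (m w : nat -> R) (p : {poly R}) (a c : R) :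
  entire m -> entire w -> m 0%N = 1 ->
  p`_0 = 0 -> (forall i, odd i -> p`_i = 0) ->
  (forall j, conv m w j = expcoef p j * cos (pi / 2 *+ j)) ->
  (forall x, 0 <= psum m x) ->
  (forall r t, psum_cos m t r ^+ 2 + psum_sin m t r ^+ 2 <= psum m (r * cos t) ^+ 2) ->
  0 <= a -> 0 < c -> (forall x, c * expR (- (a * `|x|)) <= psum w x) ->
  exists b1 b2 : R, 0 <= b2 /\ forall x, psum m x = expR (b1 * x + b2 * x ^+ 2).
Proof.
move=> em ew m0 p0 po mw mpos mle a0 c0 wge.
pose cc := conv m w.
pose d j := expcoef (- p) j * cos (pi / 2 *+ j).
have ecc : entire cc by exact: entire_conv.
have ed : entire d by apply/entire_cos/entire_expcoef.
(* The angle [pi / 2 *+ j] encodes the factor [i^j], that is, the substitution of [i x] for [x].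
   Since [p] is even, [exp p] has only even coefficients, and on these [i^j] is real. *)
have sinodd j : expcoef p j * sin (pi / 2 *+ j) = 0.
  have [oj|ej] := boolP (odd j); first by rewrite expcoef_odd ?mul0r.
  have -> : sin (pi / 2 *+ j) = 0 :> R; last by rewrite mulr0.
  rewrite -(odd_double_half j) (negbTE ej) add0n -mul2n mulrnA.
  rewrite -[pi / 2 *+ 2]mulr_natr divfK// -[_ *+ _]add0r.
  have := alternatingn (@sinDpi R) (j./2) 0 => ->.
  by rewrite sin0 mulr0.
(* The substitution of [i x] is multiplicative, so the rotated series of [exp p] and [exp (- p)] are
   still inverse to each other. *)
have ccd : conv cc d = fun n => (n == 0%N)%:R.
  rewrite -(expcoef_conv p0); apply/funext => n; rewrite /conv.
  transitivity (\sum_(i < n.+1) expcoef p i * expcoef (- p) (n - i) * cos (pi / 2 *+ n)).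
    apply: eq_bigr => i _; rewrite /cc mw /d.
    have -> : pi / 2 *+ n = pi / 2 *+ i + pi / 2 *+ (n - i) :> R.
      by rewrite -mulrnDr subnKC ?leq_ord.
    rewrite cosD mulrBr.
    have -> : expcoef p i * expcoef (- p) (n - i) * (sin (pi / 2 *+ i) * sin (pi / 2 *+ (n - i))) = 0.
      by rewrite mulrACA sinodd mul0r.
    by rewrite subr0; ring.
  rewrite -mulr_suml -/(conv (expcoef p) (expcoef (- p)) n) expcoef_conv//.
  by case: n => [|n]; rewrite ?mulr0n ?cos0 ?mulr1 ?mul0r.
pose h := conv (pseries_diffs m) (conv w d).
have ewd : entire (conv w d) by exact: entire_conv.
have edm := entire_diffs em.
have eh : entire h by exact: entire_conv.
pose g j := if j is i.+1 then h i / i.+1%:R else 0 : R.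
have eg : entire g by exact: entire_primitive.
have gh : pseries_diffs g = h by exact: diffs_primitive.
have d0 : forall i, (1 <= i)%N -> (fun n : nat => (n == 0%N)%:R : R) i = 0 by case.
have Ec t r : psum_cos cc t r * psum_cos d t r - psum_sin cc t r * psum_sin d t r = 1.
  rewrite -psum_cos_conv// ccd /psum_cos (@psum_fin _ _ _ 1) => [|i /d0 ->]; last by rewrite mul0r.
  by rewrite big_ord1 eqxx mulr0n cos0 !mul1r expr0.
have Es t r : psum_sin cc t r * psum_cos d t r + psum_cos cc t r * psum_sin d t r = 0.
  rewrite -psum_sin_conv// ccd /psum_sin (@psum_fin _ _ _ 1) => [|i /d0 ->]; last by rewrite mul0r.
  by rewrite big_ord1 mulr0n sin0 mulr0 mul0r.
(* From [m w d = 1] one gets [m' = m' (m w d) = (m' w d) m = h m]. *)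
have hmc t r : psum_cos (pseries_diffs m) t r =
    psum_cos h t r * psum_cos m t r - psum_sin h t r * psum_sin m t r.
  have := Ec t r; have := Es t r; rewrite /cc /h !(psum_cos_conv, psum_sin_conv)//.
  move: (psum_cos m t r) (psum_sin m t r) (psum_cos w t r) (psum_sin w t r)
    (psum_cos d t r) (psum_sin d t r) (psum_cos (pseries_diffs m) t r)
    (psum_sin (pseries_diffs m) t r) => mc ms wc ws dc ds m'c m's e2 e1.
  by rewrite -[LHS]mulr1 -e1 -[LHS]subr0 -(mulr0 m's) -e2; ring.
have hms t r : psum_sin (pseries_diffs m) t r =
    psum_sin h t r * psum_cos m t r + psum_cos h t r * psum_sin m t r.
  have := Ec t r; have := Es t r; rewrite /cc /h !(psum_cos_conv, psum_sin_conv)//.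
  move: (psum_cos m t r) (psum_sin m t r) (psum_cos w t r) (psum_sin w t r)
    (psum_cos d t r) (psum_sin d t r) (psum_cos (pseries_diffs m) t r)
    (psum_sin (pseries_diffs m) t r) => mc ms wc ws dc ds m'c m's e2 e1.
  by rewrite -[LHS]mulr1 -e1 -[LHS]addr0 -(mulr0 m'c) -e2; ring.
have log t r := psum_diffs_log t r em eh eg m0 erefl gh hmc hms.
have mg x : psum m x = expR (psum g x).
  have [+ _] := log 0 x; by rewrite !psum_cos_pow0 psum_sin_pow0 cos0 mulr1.
(* The modulus [|m z| = exp (Re g z)] is at most [m (Re z) = exp (g (Re z))]. *)
have gle r t : psum_cos g t r <= psum g (r * cos t).
  rewrite -ler_expR -(@ler_pXn2r _ 2) ?nnegrE ?expR_ge0// -mg.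
  apply: le_trans (mle r t); have [-> ->] := log t r.
  by rewrite !exprMn -mulrDr cos2Dsin2 mulr1.
pose q := normpoly p.
have q0 i : 0 <= q`_i by rewrite coef_normpoly.
(* On the real line [m w] is at most [exp (q |x|)] while [w] is at least [c exp (- a |x|)]. Then
   [gle] carries this bound for [g] from the real line to the whole plane. *)
have gb x : psum g x <= q.[`|x|] + a * `|x| - ln c.
  rewrite -ler_expR -mg expRD expRN lnK ?posrE// ler_pdivlMr//.
  have : psum m x * psum w x <= expR q.[`|x|].
    rewrite -psum_conv//; apply: le_trans (ler_norm _) _.
    rewrite -psum_expcoef; last by rewrite coef_normpoly p0 normr0.
    apply: psum_ler => //; first exact: entire_expcoef.
    move=> n; rewrite mw normrM; apply: le_trans (expcoef_norm _ _).
    by rewrite ler_piMr// cos_max.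
  have := ler_wpM2l (mpos x) (wge x); rewrite expRN expRD => h1 h2.
  by have := le_trans h1 h2; rewrite mulrA ler_pdivrMr ?expR_gt0.
have gn0 : forall n, (2 < n)%N -> g n = 0.
  (* The exponent [size q + 1] dominates the linear term [a x] even when [q] is zero. *)
  apply: (@poly_positive_type _ g (size q).+1) => [|r t _]; last exact: gle.
  pose K := q.[1] * 2 + a + `|ln c|.
  apply: (@real_part_liouville _ g _ K) => // r t r0.
  apply: le_trans (gle r t) _; apply: le_trans (gb _) _.
  have xr : `|r * cos t| <= r by rewrite normrM (ger0_norm r0) ler_piMr// cos_max.
  set x := `|r * cos t| in xr *; have x0 : 0 <= x by exact: normr_ge0.
  have q1 : 0 <= q.[1].
    by rewrite horner_coef; apply: sumr_ge0 => i _; rewrite expr1n mulr1.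
  have rn : 0 <= r ^+ (size q).+1 by exact: exprn_ge0.
  have rle k : (k <= (size q).+1)%N -> r ^+ k <= 1 + r ^+ (size q).+1.
    move=> ks; have [r1|r1] := lerP r 1.
      by apply: le_trans (_ : 1 <= _); [exact: exprn_ile1|rewrite lerDl].
    apply: le_trans (_ : r ^+ (size q).+1 <= _); last by rewrite lerDr.
    by apply: ler_weXn2l => //; exact: ltW.
  have b1 : q.[x] <= q.[1] * 2 * (1 + r ^+ (size q).+1).
    apply: le_trans (horner_le_pow q0 x0) _; rewrite -mulrA ler_wpM2l//.
    have := rle (size q) (leqnSn _).
    have : x ^+ size q <= r ^+ size q by rewrite lerXn2r ?nnegrE.
    by lra.
  have b2 : a * x <= a * (1 + r ^+ (size q).+1).
    by rewrite ler_wpM2l// (le_trans xr)//; have := rle 1%N isT; rewrite expr1.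
  have b3 : - ln c <= `|ln c| * (1 + r ^+ (size q).+1).
    apply: le_trans (ler_norm _) _; rewrite normrN ler_peMr//; lra.
  by rewrite /K !mulrDl; lra.
exists (g 1%N), (g 2%N); split.
  (* At the point [i] the inequality reads [g_0 - g_2 <= g_0]. *)
  have := gle 1 (pi / 2); rewrite cos_pihalf mulr0 psum0 /psum_cos.
  rewrite (@psum_fin _ _ _ 3) => [|i /gn0 ->]; last by rewrite mul0r.
  rewrite !big_ord_recr big_ord0/= mulr1n cos_pihalf !expr1n.
  by rewrite -(mulr_natr (pi / 2) 2) divfK// cospi; lra.
move=> x; rewrite mg (@psum_fin _ g _ 3) => [|i /gn0 ->//].
by rewrite !big_ord_recr big_ord0/= mul0r !add0r expr1.
Qed.

End CramerAnalytic.

(** * Finite differences *)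

Section Frechet.
Variable R : realType.
Implicit Types (f : R -> R) (h t x : R).

Definition fdiff h f t := f (t + h) - f t.

Definition sdiff (a : nat -> R) j := a j.+1 - a j.

Lemma iter_fdiffS m h f t :
  iter m.+1 (fdiff h) f t = iter m (fdiff h) f (t + h) - iter m (fdiff h) f t.
Proof. by []. Qed.

Lemma iter_sdiff_fdiff m h f t0 j :
  iter m sdiff (fun i => f (t0 + i%:R * h)) j = iter m (fdiff h) f (t0 + j%:R * h).
Proof.
elim: m j => [//|m IH] j; rewrite [LHS]/= /sdiff !IH iter_fdiffS.
by rewrite -natr1 mulrDl mul1r addrA.
Qed.

Lemma newton_series m N (a : nat -> R) :
  (forall j, (j + m <= N)%N -> iter m sdiff a j = 0) ->
  forall j, (j <= N)%N -> a j = \sum_(i < m) iter i sdiff a 0 * 'C(j, i)%:R.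
Proof.
elim: m N a => [|m IH] N a am j jN.
  by rewrite big_ord0; apply: am; rewrite addn0.
elim: j jN => [_|j IHj jN].
  by rewrite big_ord_recl bin0 mulr1 big1 ?addr0// => i _; rewrite bin0n mulr0.
rewrite -(subrK (a j) (a j.+1)) -/(sdiff a j) IHj; last by lia.
rewrite (IH N.-1 (sdiff a)); last 2 first.
- by move=> k kN; rewrite -iterSr am//; lia.
- by lia.
rewrite [in RHS]big_ord_recl [X in _ + X = _]big_ord_recl !bin0 addrCA.
congr (_ + _); rewrite -big_split/=; apply: eq_bigr => i _.
by rewrite /bump/= add1n binS natrD mulrDr addrC -iterSr.
Qed.

Definition binpoly i : {poly R} := (i`!%:R)^-1 *: \prod_(k < i) ('X - k%:R%:P).

Lemma size_binpoly i : (size (binpoly i) <= i.+1)%N.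
Proof.
by apply: leq_trans (size_scale_leq _ _) _; rewrite size_prod_XsubC [index_enum _]unlock -enumT size_enum_ord.
Qed.

Lemma binpolyE i j : (binpoly i).[j%:R] = 'C(j, i)%:R.
Proof.
rewrite /binpoly hornerZ.
suff -> : (\prod_(k < i) ('X - k%:R%:P)).[j%:R] = (j ^_ i)%:R :> R.
  by rewrite -bin_ffact natrM mulrC mulfK// pnatr_eq0 -lt0n fact_gt0.
elim: i => [|i IH]; first by rewrite big_ord0 hornerC.
rewrite big_ord_recr/= hornerM IH ffactnSr hornerXsubC natrM.
have [ij|ji] := leqP i j; first by rewrite natrB.
by rewrite ffact_small// !mul0r.
Qed.

Lemma poly_of_sdiff m N (a : nat -> R) :
  (forall j, (j + m <= N)%N -> iter m sdiff a j = 0) ->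
  exists2 q : {poly R}, (size q <= m)%N & forall j, (j <= N)%N -> a j = q.[j%:R].
Proof.
move=> am; exists (\sum_(i < m) iter i sdiff a 0 *: binpoly i).
  apply: (leq_trans (size_sum _ _ _)); apply/bigmax_leqP => i _.
  exact: leq_trans (size_scale_leq _ _) (leq_trans (size_binpoly i) (ltn_ord i)).
move=> j jN; rewrite (newton_series am jN) horner_sum; apply: eq_bigr => i _.
by rewrite hornerZ binpolyE.
Qed.

Lemma poly_eq_grid (p q : {poly R}) m (c : R) : 0 < c ->
  (size p <= m)%N -> (size q <= m)%N ->
  (forall j, (j <= m)%N -> p.[j%:R * c] = q.[j%:R * c]) -> p = q.
Proof.
move=> c0 sp sq pq; apply/eqP; rewrite -subr_eq0; apply/negPn/negP => nz.
pose rs := [seq j%:R * c | j <- iota 0 m.+1].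
have /(max_poly_roots nz) : all (root (p - q)) rs.
  apply/allP => x /mapP[j jm ->]; move: jm; rewrite mem_iota/= add0n ltnS => jm.
  by rewrite rootE hornerD hornerN pq// subrr.
have -> : uniq rs.
  rewrite map_inj_uniq ?iota_uniq// => i j /(mulIf (lt0r_neq0 c0)) /eqP.
  by rewrite eqr_nat => /eqP.
rewrite size_map size_iota => /(_ isT); apply/negP; rewrite -leqNgt.
apply: leq_trans (size_polyD _ _) _; rewrite size_polyN geq_max.
by rewrite !(leq_trans _ (leqnSn m)).
Qed.

(** On each grid of step [1 / (m (K + 1))] Newton's formula makes [f] a polynomial of size at most
    [m]. All these grids contain the [m + 1] points [i / m], so the polynomial is the same for every
    [K]; density of the grids and continuity finish. *)
Lemma frechet_unit f m : (0 < m)%N ->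
  (forall t, 0 <= t <= 1 -> {for t, continuous f}) ->
  (forall t h, 0 <= t -> 0 <= h -> t + m%:R * h <= 1 -> iter m (fdiff h) f t = 0) ->
  exists p : {poly R}, forall t, 0 <= t <= 1 -> f t = p.[t].
Proof.
move=> m0 fc fd.
have grid K : exists2 q : {poly R}, (size q <= m)%N & forall j, (j <= m * K.+1)%N ->
    f (j%:R / (m * K.+1)%:R) = q.[j%:R / (m * K.+1)%:R].
  pose N := (m * K.+1)%N; pose h : R := N%:R^-1.
  have N0 : (0 < N)%N by rewrite muln_gt0 m0.
  have NR : (0 : R) < N%:R by rewrite ltr0n.
  have := @poly_of_sdiff m N (fun j => f (0 + j%:R * h)).
  case=> [j jN|q sq qf].
    rewrite iter_sdiff_fdiff add0r fd ?mulr_ge0 ?invr_ge0//.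
    by rewrite -mulrDl -natrD ler_pdivrMr// mul1r ler_nat.
  exists (q \Po (N%:R *: 'X)).
    apply: leq_trans (size_comp_poly_leq _ _) _.
    have := sq; rewrite size_scale ?gt_eqF// size_polyX/= muln1.
    have [->|] := eqVneq (size q) 0%N; first by [].
    by lia.
  move=> j jN; rewrite -[j%:R / _]add0r qf// add0r horner_comp hornerZ hornerX.
  by rewrite mulrC divfK// gt_eqF.
have [p sp pf] := grid 0%N.
have pg K j : (j <= m * K.+1)%N -> f (j%:R / (m * K.+1)%:R) = p.[j%:R / (m * K.+1)%:R].
  have [q sq qf] := grid K; suff -> : p = q by exact: qf.
  apply: (@poly_eq_grid _ _ m m%:R^-1) => //; first by rewrite invr_gt0 ltr0n.
  move=> i im; have := pf i; rewrite muln1 => <-//.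
  have := qf (i * K.+1)%N; rewrite leq_mul2r im orbT => /(_ isT).
  by rewrite !natrM -mulf_div divff ?mulr1 ?pnatr_eq0.
exists p => t /andP[t0 t1].
pose u K : R := (Num.truncn (t * (m * K.+1)%:R))%:R / (m * K.+1)%:R.
have mK K : (0 : R) < (m * K.+1)%:R by rewrite ltr0n muln_gt0 m0.
have ub K : `|t - u K| <= K.+1%:R^-1.
  have /andP[l1 l2] := truncn_itv (mulr_ge0 t0 (ltW (mK K))).
  have a1 : u K <= t by rewrite /u ler_pdivrMr.
  have a2 : t <= u K + (m * K.+1)%:R^-1.
    by rewrite /u -[X in _ + X]mul1r -mulrDl ler_pdivlMr// natr1 ltW.
  rewrite ger0_norm ?subr_ge0//.
  apply: (@le_trans _ _ (m * K.+1)%:R^-1); first by rewrite lerBlDl.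
  by rewrite lef_pV2 ?posrE ?mK ?ltr0n// ler_nat leq_pmull.
have ut : u K @[K --> \oo] --> t.
  apply/cvgrPdist_le => e e0; near=> K; apply: le_trans (ub K) _.
  near: K; have := near_infty_natSinv_lt (PosNum e0).
  by apply: filterS => K /ltW.
have fu K : f (u K) = p.[u K].
  apply: pg; rewrite -(ler_nat R).
  have /andP[l1 _] := truncn_itv (mulr_ge0 t0 (ltW (mK K))).
  by apply: le_trans l1 _; rewrite ler_piMl// ltW.
have c1 : f (u K) @[K --> \oo] --> f t.
  by apply: continuous_cvg ut; apply: fc; rewrite t0 t1.
have c2 : p.[u K] @[K --> \oo] --> p.[t].
  by apply: continuous_cvg ut; exact: continuous_horner.
apply: (cvg_unique (@Rhausdorff R) c1).
by rewrite (_ : (fun K => f (u K)) = (fun K => p.[u K])) //; exact/funext.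
Unshelve. all: by end_near. Qed.

Lemma iter_fdiff_affine m f b c h t :
  iter m (fdiff h) (fun x => f (b + c * x)) t = iter m (fdiff (c * h)) f (b + c * t).
Proof.
elim: m t => [//|m IH] t; rewrite !iter_fdiffS !IH.
by congr (iter m _ f _ - _); ring.
Qed.

Lemma frechet f m (d : R) : 0 < d -> (0 < m)%N ->
  (forall t, `|t| <= d -> {for t, continuous f}) ->
  (forall t h, `|t| <= d -> 0 <= h -> `|t + m%:R * h| <= d -> iter m (fdiff h) f t = 0) ->
  exists p : {poly R}, forall t, `|t| <= d -> f t = p.[t].
Proof.
move=> d0 m0 fc fd.
have [||p pf] := @frechet_unit (fun x => f (- d + (2 * d) * x)) m m0.
- move=> t /andP[t0 t1]; have : {for - d + 2 * d * t, continuous f}.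
    by apply: fc; rewrite ler_norml; apply/andP; split; nra.
  move=> fct; apply: (@continuous_comp _ _ _ (fun x => - d + 2 * d * x) f) => //.
  apply: cvgD; first exact: cvg_cst.
  by apply: cvgM; [exact: cvg_cst|exact: cvg_id].
- move=> t h t0 h0 th; rewrite iter_fdiff_affine fd//.
  + rewrite ler_norml; apply/andP; split; first nra.
    have : 0 <= m%:R * h by rewrite mulr_ge0.
    by nra.
  + by rewrite !mulr_ge0// ltW.
  + have mh : 0 <= m%:R * h by rewrite mulr_ge0.
    by rewrite ler_norml; apply/andP; split; nra.
exists (p \Po ((2 * d)^-1 *: ('X + d%:P))) => t td.
have d20 : 2 * d != 0 by rewrite gt_eqF// mulr_gt0.
rewrite horner_comp hornerZ hornerD hornerX hornerC -pf.
  by congr f; field; rewrite gt_eqF.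
move: td; rewrite ler_norml => /andP[t1 t2]; rewrite mulrC.
rewrite divr_ge0 ?mulr_ge0 ?(ltW d0)//=; last by lra.
by rewrite ler_pdivrMr ?mulr_gt0//; lra.
Qed.

End Frechet.

(** * Symmetric second differences *)

Section SecondDifference.
Variable R : realType.
Implicit Types (f : R -> R) (h t x s : R).

Lemma mvt_ineq f f' (a b C : R) : a <= b -> (forall x, is_derive x (1 : R) f (f' x)) ->
  (forall x, a <= x <= b -> `|f' x| <= C) -> `|f b - f a| <= C * (b - a).
Proof.
rewrite le_eqVlt => /predU1P[->|ab] df Cf; first by rewrite !subrr normr0 mulr0.
have [|c] := @MVT _ f f' a b ab (fun x _ => df x).
  apply: derivable_within_continuous => x _; exact: (@ex_derive _ _ _ _ _ _ _ (df x)).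
rewrite in_itv/= => /andP[ac cb] ->; rewrite normrM (@ger0_norm _ (b - a)); last by rewrite subr_ge0 ltW.
by apply: ler_wpM2r; [rewrite subr_ge0 ltW|apply: Cf; rewrite !ltW].
Qed.

(** Signed so that on [cos (y s)] it multiplies by the nonnegative number [2 - 2 cos (h s)]. *)
Definition fdiff2 h f t := 2 * f t - f (t + h) - f (t - h).

Lemma is_derive_shift f f' h : (forall x, is_derive x (1 : R) f (f' x)) ->
  forall x, is_derive x (1 : R) (fun y => f (y + h)) (f' (x + h)).
Proof.
move=> df x; rewrite -[f' _]mulr1.
apply: (@is_derive1_comp _ f (fun y => y + h)).
by rewrite -[X in is_derive _ _ _ X]addr0; apply: is_derive1D.
Qed.

Lemma fdiff2_bound f f' f'' h t (C : R) : 0 <= h ->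
  (forall x, is_derive x (1 : R) f (f' x)) -> (forall x, is_derive x (1 : R) f' (f'' x)) ->
  (forall x, `|x - t| <= h -> `|f'' x| <= C) -> `|fdiff2 h f t| <= 2 * h ^+ 2 * C.
Proof.
move=> h0 df df' bf.
have C0 : 0 <= C by apply: le_trans (bf t _) => //; rewrite subrr normr0.
pose p s := f (s + t) + f (t - s) - 2 * f t.
have dp s : is_derive s (1 : R) p (f' (s + t) - f' (t - s)).
  have d1 := is_derive_shift t df s.
  have d2 : is_derive s (1 : R) (fun y => f (t - y)) (f' (t - s) * -1).
    apply: (@is_derive1_comp _ f (fun y => t - y)).
    by have := is_derive1B (is_derive_cst t s (1 : R)) (is_derive_id s (1 : R)); rewrite sub0r.
  have := is_derive1B (is_derive1D d1 d2) (is_derive_cst (2 * f t) s (1 : R)).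
  by rewrite mulrN1 subr0.
have bp s : 0 <= s <= h -> `|f' (s + t) - f' (t - s)| <= C * (2 * h).
  move=> /andP[s0 sh]; apply: (@le_trans _ _ (C * (s + t - (t - s)))); last first.
    by rewrite ler_wpM2l//; lra.
  apply: (mvt_ineq _ df'); first by lra.
  by move=> x /andP[x1 x2]; apply: bf; rewrite ler_norml; lra.
have := mvt_ineq h0 dp bp; rewrite subr0 {2}/p add0r subr0.
have -> : p h - (f t + f t - 2 * f t) = - fdiff2 h f t.
  by rewrite /p /fdiff2 (addrC h t); ring.
rewrite normrN => /le_trans; apply; rewrite le_eqVlt; apply/orP; left; apply/eqP; ring.
Qed.

(** Stated for a chain of successive derivatives because [fdiff2 h] maps such a chain to another
    one; the induction peels off the innermost difference. *)
Lemma iter_fdiff2_bound k (F : nat -> R -> R) n h t (C : R) : 0 <= h ->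
  (forall n x, is_derive x (1 : R) (F n) (F n.+1 x)) ->
  (forall x, `|x - t| <= k%:R * h -> `|F (n + k.*2)%N x| <= C) ->
  `|iter k (fdiff2 h) (F n) t| <= (2 * h ^+ 2) ^+ k * C.
Proof.
move=> h0; elim: k F n C => [|k IH] F n C dF bF.
  by rewrite expr0 mul1r /=; have := bF t; rewrite addn0 subrr normr0 mul0r; apply.
rewrite iterSr exprSr -mulrA.
apply: (IH (fun n => fdiff2 h (F n))) => [m x|x xk].
- apply: is_derive1B; last exact: (is_derive_shift (- h) (dF m)).
  apply: is_derive1B; last exact: (is_derive_shift h (dF m)).
- apply: (@fdiff2_bound _ (F (n + k.*2).+1) (F (n + k.*2).+2)) => //.
  move=> y yx; rewrite -addnS -addnS -doubleS; apply: bF.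
  rewrite (_ : y - t = (y - x) + (x - t)); last by ring.
  by apply: le_trans (ler_normD _ _) _; rewrite -natr1; lra.
Qed.

Lemma iter_fdiff2_local k f g h t : 0 <= h ->
  (forall x, `|x - t| <= k%:R * h -> f x = g x) ->
  iter k (fdiff2 h) f t = iter k (fdiff2 h) g t.
Proof.
move=> h0; elim: k t => [|k IH] t fg; first by apply: fg; rewrite subrr normr0 mul0r.
rewrite !iterS {1 3}/fdiff2 !IH// => x xt; apply: fg.
- rewrite (_ : x - t = (x - (t - h)) - h); last by ring.
  by apply: le_trans (ler_normB _ _) _; rewrite (ger0_norm h0) -natr1; lra.
- rewrite (_ : x - t = (x - (t + h)) + h); last by ring.
  by apply: le_trans (ler_normD _ _) _; rewrite (ger0_norm h0) -natr1; lra.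
- by apply: le_trans xt _; rewrite ler_wpM2r// ler_nat.
Qed.

Lemma iter_fdiff2_cos k h s t :
  iter k (fdiff2 h) (fun y => cos (y * s)) t = (2 - 2 * cos (h * s)) ^+ k * cos (t * s).
Proof.
elim: k t => [|k IH] t; first by rewrite expr0 mul1r.
by rewrite iterS /fdiff2 !IH (mulrDl t h s) (mulrBl s t h) cosD cosB exprS; ring.
Qed.

Lemma iter_diffs_bound n (a : nat -> R) (A e : R) : 0 <= A -> 0 <= e ->
  (forall j, `|a j| <= A * e ^+ j) ->
  forall j, `|iter n (@pseries_diffs R) a j| <= A * (2 * e) ^+ n * n`!%:R * (2 * e) ^+ j.
Proof.
move=> A0 e0 aA j.
have -> : iter n (@pseries_diffs R) a j = ('C(j + n, n) * n`!)%:R * a (j + n)%N.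
  elim: n j => [|n IH] j; first by rewrite bin0 fact0 mul1r addn0.
  rewrite iterS /pseries_diffs IH addSnnS mulrA -natrM; congr (_%:R * _).
  by rewrite factS mulnA [RHS]mulnA (mulnC _ n.+1) mul_bin_left (_ : j + n.+1 - n = j.+1)%N//; lia.
rewrite normrM ger0_norm//.
apply: (@le_trans _ _ ((2 ^ (j + n) * n`!)%:R * (A * e ^+ (j + n)))).
  apply: ler_pM => //; rewrite ler_nat leq_mul2r.
  rewrite -[in (2 ^ _)%N]addn1 ?addn0.
  have -> : (2 ^ (j + n) = \sum_(i < (j + n).+1) 'C(j + n, i))%N.
    rewrite -[2%N]/(1 + 1)%N expnDn; apply: eq_bigr => i _.
    by rewrite !exp1n !muln1.
  have jn : (n < (j + n).+1)%N by lia.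
  by rewrite (bigD1 (Ordinal jn))//= leq_addr orbT.
rewrite natrM natrX le_eqVlt; apply/orP; left; apply/eqP.
by rewrite !exprMn !exprD; ring.
Qed.

(** Cauchy's estimate for the derivative of order [2 k], with [e] as small as desired because the
    series is entire. The condition [k h <= 1] keeps the sample points in [[-1, 1]]. *)
Lemma psum_fdiff2_bound (a : nat -> R) (e : R) : entire a -> 0 < e ->
  exists2 A : R, 0 <= A & forall k h, 0 <= h -> k%:R * h <= 1 ->
    `|iter k (fdiff2 h) (psum a) 0| <= A * (h ^+ 2 * e) ^+ k * (k.*2)`!%:R.
Proof.
move=> ea e0; pose q : R := Num.min (e / 8) (1 / 8).
have q0 : 0 < q by rewrite lt_min !divr_gt0.
have [qe q8] : q <= e / 8 /\ q <= 1 / 8 by rewrite !ge_min !lexx orbT.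
have [A A0 HA] := entire_bound ea q0.
exists (A * 2) => [|k h h0 kh]; first by rewrite mulr_ge0.
pose F n := psum (iter n (@pseries_diffs R) a).
have eF n : entire (iter n (@pseries_diffs R) a).
  by elim: n => // n IH; exact: entire_diffs.
have q20 : 0 <= 2 * q by rewrite mulr_ge0// ltW.
have /= := @iter_fdiff2_bound k F 0 h 0 (A * 2 * (2 * q) ^+ k.*2 * (k.*2)`!%:R) h0.
rewrite /F/= => /(_ (fun n x => is_derive_psum x (eF n))) H.
apply: le_trans (H _) _.
  move=> x; rewrite subr0 => /le_trans /(_ kh) x1.
  have := @psum_tail_bound R (iter k.*2 (@pseries_diffs R) a) x
    (A * (2 * q) ^+ k.*2 * (k.*2)`!%:R) 0 (eF _).
  rewrite big_ord0 subr0 add0n expr0 mulr1 => B.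
  apply: le_trans (B _ _) _.
  - by rewrite !mulr_ge0// exprn_ge0.
  - move=> m; rewrite normrM normrX.
    apply: le_trans (_ : _ <= `|iter k.*2 (@pseries_diffs R) a m|) _.
      by rewrite ler_piMr// exprn_ile1.
    apply: le_trans (iter_diffs_bound k.*2 A0 (ltW q0) HA m) _.
    rewrite ler_wpM2l ?lerXn2r ?nnegrE//; last lra.
    by rewrite !mulr_ge0// exprn_ge0.
  - by rewrite le_eqVlt; apply/orP; left; apply/eqP; ring.
have -> : (2 * h ^+ 2) ^+ k * (A * 2 * (2 * q) ^+ k.*2 * (k.*2)`!%:R) =
    A * 2 * (2 * h ^+ 2 * (2 * q) ^+ 2) ^+ k * (k.*2)`!%:R.
  by rewrite -mul2n exprM !exprMn; ring.
rewrite ler_wpM2r// ler_wpM2l ?mulr_ge0//.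
have qq : 2 * (2 * q) ^+ 2 <= e by rewrite exprMn; nra.
have qq0 : 0 <= 2 * (2 * q) ^+ 2 by rewrite mulr_ge0// exprn_ge0.
have -> : 2 * h ^+ 2 * (2 * q) ^+ 2 = h ^+ 2 * (2 * (2 * q) ^+ 2) by ring.
have h2 : 0 <= h ^+ 2 by rewrite exprn_ge0.
rewrite lerXn2r ?nnegrE//; [exact: mulr_ge0|exact: mulr_ge0 (ltW e0)|].
exact: ler_wpM2l.
Qed.

(** One has [2 - 2 cos x = 4 sin (x / 2)^2], and [sin y >= y / 2] as long as [cos >= 1 / 2] on
    [[0, y]]. *)
Lemma cos_quadratic_bound : exists2 c : R, 0 < c & forall x, `|x| <= c -> x ^+ 2 / 4 <= 2 - 2 * cos x.
Proof.
have /cvgrPdist_le /(_ (1 / 2)) := @continuous_cos R 0.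
rewrite divr_gt0// => /(_ isT) /nbhs_ballP [c /= c0 bc].
exists c => // x xc.
have sx y : 0 <= y -> y <= c / 2 -> y / 2 <= sin y.
  move=> y0 yc.
  have d z : is_derive z (1 : R) (fun z => z - sin z) (1 - cos z) by exact: is_derive1B.
  have := @mvt_ineq _ _ 0 y (1 / 2) y0 d.
  rewrite sin0 !subr0 => B.
  have : `|y - sin y| <= 1 / 2 * y.
    apply: B => z /andP[z0 zy]; have := bc z; rewrite cos0; apply.
    by rewrite /ball/= sub0r normrN ger0_norm//; lra.
  by rewrite ler_norml => /andP[]; lra.
wlog x0 : x xc / 0 <= x.
  move=> H; have [|x0] := lerP 0 x; first exact: H.
  by rewrite -sqrrN -cosN; apply: H; rewrite ?normrN//; lra.
have -> : 2 - 2 * cos x = 4 * sin (x / 2) ^+ 2.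
  rewrite {1}(_ : x = (x / 2) *+ 2) ?cos_mulr2n ?cos2sin2; first by ring.
  by rewrite -mulr_natr divfK.
have := sx (x / 2); rewrite ger0_norm// in xc.
have -> : x ^+ 2 / 4 = 4 * (x / 2 / 2) ^+ 2 by field.
move=> sx2; rewrite ler_pM2l// lerXn2r ?nnegrE//; last by apply: sx2; lra.
- by rewrite !divr_ge0.
- by apply: le_trans (sx2 _ _); rewrite ?divr_ge0//; lra.
Qed.

End SecondDifference.

(** * Expectations and exponential moments *)

Section Integrals.
Context d (T : measurableType d) (R : realType) (P : probability T R).
Implicit Types (f g : T -> R) (c C : R).

Definition integ f := P.-integrable [set: T] (EFin \o f).

Lemma integ_measurable f : integ f -> measurable_fun setT f.
Proof. by move=> /integrableP[/measurable_EFinP]. Qed.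

Lemma integ_le f g : measurable_fun setT f -> integ g ->
  (forall x, `|f x| <= g x) -> integ f.
Proof.
move=> mf ig fg; apply: (le_integrable measurableT _ _ ig).
  exact/measurable_EFinP.
by move=> x _; rewrite /= lee_fin; apply: le_trans (fg x) (ler_norm _).
Qed.

Lemma integ_cst c : integ (fun=> c).
Proof. exact: finite_measure_integrable_cst. Qed.

Lemma integ_bounded f C : measurable_fun setT f -> (forall x, `|f x| <= C) -> integ f.
Proof. by move=> mf fC; apply: integ_le mf (integ_cst C) fC. Qed.

Lemma integD f g : integ f -> integ g -> integ (fun x => f x + g x).
Proof. by move=> i1 i2; exact: (integrableD measurableT i1 i2). Qed.

Lemma integZ c f : integ f -> integ (fun x => c * f x).
Proof. by move=> i1; exact: (integrableZl measurableT c i1). Qed.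

Lemma integB f g : integ f -> integ g -> integ (fun x => f x - g x).
Proof. by move=> i1 i2; exact: (integrableB measurableT i1 i2). Qed.

Lemma integ_sum (I : Type) (s : seq I) (Q : pred I) (h : I -> T -> R) :
  (forall i, integ (h i)) -> integ (fun x => \sum_(i <- s | Q i) h i x).
Proof.
move=> ih; rewrite /integ.
rewrite (_ : EFin \o _ = fun x => (\sum_(i <- s | Q i) (h i x)%:E)%E).
  by apply: integrable_sum => // i _; exact: ih.
by apply/funext => x /=; rewrite sumEFin.
Qed.

Lemma Rint_cst c : \int[P]_x c = c.
Proof.
rewrite (Rintegral_cst P measurableT) -[RHS]mulr1; congr (c * _).
exact: (congr1 fine (probability_setT P)).
Qed.

Lemma RintD f g : integ f -> integ g -> \int[P]_x (f x + g x) = \int[P]_x f x + \int[P]_x g x.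
Proof. exact: RintegralD. Qed.

Lemma RintB f g : integ f -> integ g -> \int[P]_x (f x - g x) = \int[P]_x f x - \int[P]_x g x.
Proof. exact: RintegralB. Qed.

Lemma RintZ c f : integ f -> \int[P]_x (c * f x) = c * \int[P]_x f x.
Proof. exact: RintegralZl. Qed.

Lemma Rint_le f g : integ f -> integ g -> (forall x, f x <= g x) ->
  \int[P]_x f x <= \int[P]_x g x.
Proof. by move=> i1 i2 fg; apply: le_Rintegral. Qed.

Lemma Rint_norm f : integ f -> `|\int[P]_x f x| <= \int[P]_x `|f x|.
Proof. exact: le_normr_Rintegral. Qed.

Lemma Rint_sum (I : Type) (s : seq I) (h : I -> T -> R) : (forall i, integ (h i)) ->
  \int[P]_x (\sum_(i <- s) h i x) = \sum_(i <- s) \int[P]_x h i x.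
Proof.
move=> ih; elim: s => [|i s IH].
  by rewrite big_nil -[RHS]Rint_cst; apply: eq_Rintegral => x _; rewrite big_nil.
rewrite big_cons -IH -RintD//; last exact: integ_sum.
by apply: eq_Rintegral => x _; rewrite big_cons.
Qed.

Lemma RintE f : integ f -> (\int[P]_x (f x)%:E)%E = (\int[P]_x f x)%:E.
Proof. by move=> fi; rewrite /Rintegral fineK//; exact: integrable_fin_num. Qed.

Lemma Rint_dct (fn : nat -> T -> R) f g : (forall n, measurable_fun setT (fn n)) ->
  integ g -> (forall n x, `|fn n x| <= g x) -> (forall x, fn n x @[n --> \oo] --> f x) ->
  integ f /\ \int[P]_x fn n x @[n --> \oo] --> \int[P]_x f x.
Proof.
move=> mfn ig fg cv; have mf : measurable_fun setT f.
  by apply: (measurable_fun_cvg mfn) => x _; exact: cv.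
have fi : integ f.
  apply: (integ_le mf ig) => x; apply: (@cvgr_to_le _ \oo _ _ (fun n => `|fn n x|)).
    by apply: cvg_norm; exact: cv.
  by apply: nearW => n; exact: fg.
have fni n : integ (fn n) by apply: (integ_le (mfn n) ig); exact: fg.
split => //; apply: fine_cvg; rewrite -/(Rintegral P setT f) -RintE//.
apply: (@dominated_cvg _ _ _ P _ measurableT (fun n => EFin \o fn n) (EFin \o f) (EFin \o g)) => //.
- by move=> n; exact/measurable_EFinP.
- by move=> x _; apply: cvg_EFin; [exact: nearW|exact: cv].
- by move=> n x _; rewrite lee_fin; exact: fg.
Qed.

Lemma Rint_fatou (fn : nat -> T -> R) f C : (forall n, integ (fn n)) ->
  (forall n x, 0 <= fn n x) -> (forall n, \int[P]_x fn n x <= C) ->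
  (forall x, fn n x @[n --> \oo] --> f x) -> integ f.
Proof.
move=> ifn fn0 fC cv; have mfn n := integ_measurable (ifn n).
have mf : measurable_fun setT f.
  by apply: (measurable_fun_cvg mfn) => x _; exact: cv.
have f0 x : 0 <= f x.
  by apply: (@cvgr_to_ge _ \oo _ _ (fn ^~ x)); [exact: cv|exact: nearW].
apply/integrableP; split; first exact/measurable_EFinP.
apply: (@le_lt_trans _ _ C%:E); last exact: ltry.
have mE n : measurable_fun setT (EFin \o fn n) by exact/measurable_EFinP.
have h := @fatou _ _ _ P setT measurableT (fun n => EFin \o fn n) mE (fun n x _ => fn0 n x).
apply: (@le_trans _ _ (limn_einf (fun n => \int[P]_x (fn n x)%:E)%E)).
  apply: le_trans h; rewrite le_eqVlt; apply/orP; left; apply/eqP.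
  apply: eq_integral => x _; rewrite /= ger0_norm//.
  by apply/esym; apply: (cvg_limn_einf_sup _).1; apply: cvg_EFin; [exact: nearW|exact: cv].
rewrite limn_einf_lim; apply: lime_le; first exact: is_cvg_einfs.
apply: nearW => n; apply: (@le_trans _ _ (\int[P]_x (fn n x)%:E)%E).
  by apply: ereal_inf_lbound; exists n => /=.
by rewrite RintE// lee_fin.
Qed.

End Integrals.

Section ExponentialMoments.
Context d (T : measurableType d) (R : realType) (P : probability T R).
Implicit Types (X S : T -> R) (f : R -> R).

Lemma measurable_comp_cont f X : continuous f -> measurable_fun setT X ->
  measurable_fun setT (fun x => f (X x)).
Proof. by move=> cf mX; apply: measurableT_comp mX; exact: continuous_measurable_fun. Qed.

Lemma measurable_cosM t X : measurable_fun setT X -> measurable_fun setT (fun x => cos (t * X x)).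
Proof.
move=> mX; apply: (@measurable_comp_cont (fun y => cos (t * y))) => //.
by move=> y; apply: continuous_comp; [exact: mulrl_continuous|exact: continuous_cos].
Qed.

Lemma measurable_sinM t X : measurable_fun setT X -> measurable_fun setT (fun x => sin (t * X x)).
Proof.
move=> mX; apply: (@measurable_comp_cont (fun y => sin (t * y))) => //.
by move=> y; apply: continuous_comp; [exact: mulrl_continuous|exact: continuous_sin].
Qed.

Lemma measurable_expRM t X : measurable_fun setT X -> measurable_fun setT (fun x => expR (t * X x)).
Proof.
move=> mX; apply: (@measurable_comp_cont (fun y => expR (t * y))) => //.
by move=> y; apply: continuous_comp; [exact: mulrl_continuous|exact: continuous_expR].
Qed.

Lemma measurable_exprn n X : measurable_fun setT X -> measurable_fun setT (fun x => X x ^+ n).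
Proof.
by move=> mX; apply: (@measurable_comp_cont (fun y => y ^+ n)) => //; exact: exprn_continuous.
Qed.

Lemma measurable_abs X : measurable_fun setT X -> measurable_fun setT (fun x => `|X x|).
Proof.
by move=> mX; apply: (@measurable_comp_cont (fun y => `|y|)) => //; exact: norm_continuous.
Qed.

Definition exp_integrable X := forall l : R, integ P (fun x => expR (l * `|X x|)).

Lemma integ_cos t X : measurable_fun setT X -> integ P (fun x => cos (t * X x)).
Proof.
by move=> mX; apply: (@integ_bounded _ _ _ _ _ 1); [exact: measurable_cosM|move=> x; exact: cos_max].
Qed.

Lemma integ_sin t X : measurable_fun setT X -> integ P (fun x => sin (t * X x)).
Proof.
by move=> mX; apply: (@integ_bounded _ _ _ _ _ 1); [exact: measurable_sinM|move=> x; exact: sin_max].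
Qed.

Lemma Rint_cos0 X : \int[P]_x cos (0 * X x) = 1.
Proof.
by rewrite -[RHS](Rint_cst P); apply: eq_Rintegral => x _; rewrite mul0r cos0.
Qed.

Lemma Rint_sin0 X : \int[P]_x sin (0 * X x) = 0.
Proof.
by rewrite -[RHS](Rint_cst P); apply: eq_Rintegral => x _; rewrite mul0r sin0.
Qed.

Lemma Rint_cosN t X : \int[P]_x cos (- t * X x) = \int[P]_x cos (t * X x).
Proof. by apply: eq_Rintegral => x _; rewrite mulNr cosN. Qed.

Lemma Rint_sinN t X : measurable_fun setT X ->
  \int[P]_x sin (- t * X x) = - \int[P]_x sin (t * X x).
Proof.
move=> mX; rewrite -[RHS]mulN1r -RintZ; last exact: integ_sin.
by apply: eq_Rintegral => x _; rewrite mulNr sinN mulN1r.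
Qed.

Lemma iter_fdiff2_int k h (phi : R -> T -> R) t : (forall y, integ P (phi y)) ->
  integ P (fun x => iter k (fdiff2 h) (phi ^~ x) t) /\
  iter k (fdiff2 h) (fun y => \int[P]_x phi y x) t = \int[P]_x iter k (fdiff2 h) (phi ^~ x) t.
Proof.
move=> iphi; elim: k t => [|k IH] t; first by split; first exact: iphi.
rewrite iterS {2}/fdiff2.
have [[i0 e0] [i1 e1] [i2 e2]] := And3 (IH t) (IH (t + h)) (IH (t - h)).
rewrite e0 e1 e2; have i20 := integZ 2 i0; split.
  by apply: integB => //; exact: integB.
by rewrite -RintZ// -RintB// -RintB//; exact: integB.
Qed.

(* The [k]-th iterate of [fdiff2 h] applied to [E cos (y S)] at 0 is [E (2 - 2 cos (h S)) ^ k],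
   which dominates [(h / 2) ^ 2k] times the truncated [2k]-th moment for [h] small. *)
Lemma exp_integrable_of_analytic S (a : nat -> R) (dl : R) : measurable_fun setT S ->
  entire a -> 0 < dl ->
  (forall t, `|t| < dl -> \int[P]_x cos (t * S x) = psum a t) -> exp_integrable S.
Proof.
move=> mS ea d0 cf l.
wlog l0 : l / 0 < l.
  move=> H; have [l0|l0] := ltrP 0 l; first exact: H.
  apply: (@integ_bounded _ _ _ _ _ 1) => [|x]; first exact/measurable_expRM/measurable_abs.
  by rewrite ger0_norm// -expR0 ler_expR mulr_le0_ge0.
(* Chosen so that [4 e l^2 = 1 / 4]: the term of order [2 k] in the series below then has
   expectation at most [2 A 4^-k]. *)
pose e := (16 * l ^+ 2)^-1; have e0 : 0 < e by rewrite invr_gt0 mulr_gt0// exprn_gt0.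
have [A A0 HA] := psum_fdiff2_bound ea e0.
have [c c0 sl] := @cos_quadratic_bound R.
pose D n := [set x | `|S x| <= n%:R].
have mD n : measurable (D n).
  rewrite (_ : D n = setT `&` (fun x => `|S x|) @^-1` `]-oo, n%:R]%classic).
    by apply: (measurable_abs mS) => //; exact: measurable_itv.
  by apply/seteqP; split => x /=; rewrite in_itv/=; tauto.
pose b n x : R := \1_(D n) x.
have b01 n x : 0 <= b n x <= 1 by rewrite /b indicE; case: (_ \in _); rewrite ?lexx ?ler01.
have mb n : measurable_fun setT (b n) by exact: measurable_indic.
have bS n x : b n x = 0 \/ `|S x| <= n%:R.
  rewrite /b indicE; case: (boolP (x \in D n)); last by left.
  by rewrite inE; right.
have ib n j : integ P (fun x => b n x * S x ^+ j).
  apply: (@integ_bounded _ _ _ _ _ (n%:R ^+ j)).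
    by apply: measurable_funM => //; exact: measurable_exprn.
  move=> x; case: (bS n x) => [->|sx]; first by rewrite mul0r normr0 exprn_ge0.
  have /andP[b0 b1] := b01 n x.
  rewrite normrM normrX (ger0_norm b0); apply: le_trans (_ : `|S x| ^+ j <= _).
    by rewrite ler_piMl// exprn_ge0.
  by rewrite lerXn2r ?nnegrE.
have even n k : \int[P]_x (b n x * S x ^+ k.*2) <= A * (4 * e) ^+ k * (k.*2)`!%:R.
  (* The three bounds keep the sample points where the characteristic function is [psum a], keep
     them in [[-1, 1]], and keep [h S] in the range of [cos_quadratic_bound] when [|S| <= n]. *)
  pose h := Num.min (dl / 2 / k.+1%:R) (Num.min k.+1%:R^-1 (c / n.+1%:R)).
  have h0 : 0 < h by rewrite !lt_min invr_gt0 ltr0n !divr_gt0.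
  have [h1 [h2 h3]] : h <= dl / 2 / k.+1%:R /\ h <= k.+1%:R^-1 /\ h <= c / n.+1%:R.
    by rewrite /h !ge_min !lexx !orbT.
  have kh1 : k%:R * h <= 1.
    by move: h2; rewrite -[X in _ <= X]mul1r ler_pdivlMr ?ltr0n// -natr1; nra.
  have khd : k%:R * h < dl.
    by move: h1; rewrite ler_pdivlMr ?ltr0n// -natr1; nra.
  have nh : n%:R * h <= c.
    by move: h3; rewrite ler_pdivlMr ?ltr0n// -natr1; nra.
  have [ii ee] := @iter_fdiff2_int k h (fun y x => cos (y * S x)) 0 (fun y => integ_cos y mS).
  have ib2 : integ P (fun x => (4 / h ^+ 2) ^+ k * iter k (fdiff2 h) (fun y => cos (y * S x)) 0).
    exact: integZ.
  apply: (le_trans (Rint_le (ib n k.*2) ib2 _)).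
    move=> x; rewrite iter_fdiff2_cos mul0r cos0 mulr1 -exprMn.
    have cc : 0 <= 2 - 2 * cos (h * S x) by have := cos_le1 (h * S x); lra.
    have h2p : 0 < h ^+ 2 by rewrite exprn_gt0.
    case: (bS n x) => [->|sx].
      by rewrite mul0r exprn_ge0// mulr_ge0// divr_ge0// ltW.
    have /andP[b0 b1] := b01 n x.
    apply: le_trans (_ : S x ^+ k.*2 <= _).
      by rewrite ler_piMl// -mul2n exprM exprn_ge0// sqr_ge0.
    rewrite -mul2n exprM lerXn2r ?nnegrE ?sqr_ge0//.
      by rewrite mulr_ge0// divr_ge0// ltW.
    have := sl (h * S x); rewrite normrM (ger0_norm (ltW h0)) => /(_ _)/wrap[].
      by apply: le_trans nh; rewrite mulrC ler_wpM2r// ltW.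
    by move=> hh; rewrite mulrAC ler_pdivlMr//; move: hh; rewrite exprMn; lra.
  rewrite RintZ// -ee.
  rewrite (@iter_fdiff2_local _ k _ (psum a) h 0 (ltW h0)); last first.
    by move=> x; rewrite subr0 => xk; apply: cf; exact: le_lt_trans khd.
  have h2p : 0 < h ^+ 2 by rewrite exprn_gt0.
  apply: (@le_trans _ _ ((4 / h ^+ 2) ^+ k * (A * (h ^+ 2 * e) ^+ k * (k.*2)`!%:R))).
    rewrite ler_wpM2l ?exprn_ge0 ?divr_ge0 ?(ltW h2p)//.
    exact: le_trans (ler_norm _) (HA k h (ltW h0) kh1).
  rewrite le_eqVlt; apply/orP; left; apply/eqP.
  have -> : 4 * e = 4 / h ^+ 2 * (h ^+ 2 * e) by field; rewrite gt_eqF.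
  by rewrite [in RHS]exprMn; ring.
(* Truncated series of [exp (l S) + exp (- l S)]: odd terms cancel, so bounds on even moments
   suffice, and the rest is nonnegative as Fatou's lemma requires. *)
pose g n x := \sum_(j < n) (l ^+ j + (- l) ^+ j) / j`!%:R * (b n x * S x ^+ j).
have ig n : integ P (g n) by apply: integ_sum => j; exact: integZ.
suff ichi : integ P (fun x => expR (l * S x) + expR (- (l * S x))).
  apply: (integ_le _ ichi) => [|x]; first exact/measurable_expRM/measurable_abs.
  rewrite ger0_norm//; have [sx|sx] := lerP 0 (S x).
    by rewrite ger0_norm// lerDl.
  by rewrite ler0_norm ?(ltW sx)// mulrN lerDr.
apply: (@Rint_fatou _ _ _ P g _ (A * 4) ig).
- move=> n x; apply: sumr_ge0 => j _.
  have /andP[b0 b1] := b01 n x.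
  have [oj|ej] := boolP (odd j).
    by rewrite (exprNn l) -signr_odd oj expr1 mulN1r subrr !mul0r.
  rewrite (exprNn l) -signr_odd (negbTE ej) expr0 mul1r.
  apply: mulr_ge0; last by apply: mulr_ge0 => //; exact: exprn_even_ge0.
  by rewrite divr_ge0// addr_ge0// exprn_ge0// ltW.
- move=> n; rewrite Rint_sum => [|j]; last exact: integZ.
  apply: (@le_trans _ _ (\sum_(j < n) A * 2 * 2^-1 ^+ j)); last first.
    rewrite -mulr_sumr -mulrA ler_wpM2l//.
    have : \sum_(j < n) 2^-1 ^+ j = 2 - 2 * 2^-1 ^+ n :> R.
      elim: n => [|n IH]; first by rewrite big_ord0 expr0; ring.
      by rewrite big_ord_recr/= IH exprS; field.
    move=> ->; have : 0 <= (2^-1 : R) ^+ n by rewrite exprn_ge0// invr_ge0.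
    lra.
  apply: ler_sum => j _; rewrite RintZ//.
  have [oj|ej] := boolP (odd j).
    rewrite -(odd_double_half j) oj exprS -mul2n !exprM [in (- l) ^+ _]exprS exprM sqrrN mulNr.
    by rewrite addrN !mul0r !mulr_ge0// exprn_ge0// invr_ge0.
  have -> : val j = (j./2).*2 by rewrite -[LHS](odd_double_half j) (negbTE ej).
  set k := j./2; rewrite -(mul2n k) !exprM sqrrN mul2n.
  have := even n k; rewrite -ler_pdivrMr ?ltr0n ?fact_gt0// => ev.
  have l2 : 0 < (l ^+ 2) ^+ k by rewrite !exprn_gt0.
  rewrite -mulrA [X in _ * X]mulrC.
  apply: (@le_trans _ _ ((l ^+ 2) ^+ k * 2 * (A * (4 * e) ^+ k))).
    have -> : (l ^+ 2) ^+ k + (l ^+ 2) ^+ k = (l ^+ 2) ^+ k * 2 by ring.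
    by rewrite ler_pM2l ?mulr_gt0.
  rewrite le_eqVlt; apply/orP; left; apply/eqP.
  have -> : (2^-1 ^+ 2 : R) = l ^+ 2 * (4 * e) by rewrite /e; field; rewrite gt_eqF.
  by rewrite [in RHS]exprMn; ring.
- move=> x.
  have cv : (fun n => pseries (fun j => (j`!%:R)^-1) (l * S x) n +
     pseries (fun j => (j`!%:R)^-1) (- (l * S x)) n) @ \oo -->
     expR (l * S x) + expR (- (l * S x)).
    by apply: cvgD; rewrite -psum_invfact; apply/psum_cvg/entire_invfact.
  apply: cvg_trans cv; apply: near_eq_cvg; near=> n.
  have bx : b n x = 1.
    rewrite /b indicE mem_set//= /D/=.
    apply: le_trans (ltW (truncnS_gt _)) _.
    by rewrite ler_nat; near: n; exact: nbhs_infty_ge.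
  rewrite /g /pseries/series/= !big_mkord -big_split/=; apply: eq_bigr => j _.
  by rewrite bx mul1r -mulNr !exprMn; ring.
Unshelve. all: by end_near. Qed.

End ExponentialMoments.

(** * Moments and moment generating functions *)

Section Moments.
Context d (T : measurableType d) (R : realType) (P : probability T R).
Implicit Types (X : T -> R) (r t : R).

(* The exponential generating normalization: [moment X] is the coefficient sequence of
   the moment generating function. *)
Definition moment X j := (\int[P]_x X x ^+ j) / j`!%:R.

Lemma pow_fact_le_expR (y : R) j : 0 <= y -> y ^+ j / j`!%:R <= expR y.
Proof.
move=> y0; apply: le_trans (sum_exp_le j.+1 y0).
rewrite big_ord_recr/= lerDr sumr_ge0// => i _.
by rewrite divr_ge0// exprn_ge0.
Qed.

Lemma pow_le_expR (l y : R) j : 0 < l -> `|y| ^+ j / j`!%:R <= expR (l * `|y|) / l ^+ j.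
Proof.
move=> l0; rewrite ler_pdivlMr ?exprn_gt0// mulrAC -exprMn mulrC mulrC.
rewrite (mulrC `|y|); apply: pow_fact_le_expR.
by rewrite mulr_ge0// ltW.
Qed.

Lemma integ_pow X j : measurable_fun setT X -> exp_integrable P X ->
  integ P (fun x => X x ^+ j).
Proof.
move=> mX eX; apply: (integ_le (measurable_exprn j mX) (integZ j`!%:R (eX 1))) => x.
rewrite normrX mulrC -ler_pdivrMr ?ltr0n ?fact_gt0//.
by have := pow_le_expR (X x) j ltr01; rewrite expr1n divr1.
Qed.

(** From [|y|^j / j! <= exp (|y| / e) e^j]: exponential moments of all orders give geometric bounds
    with all ratios. *)
Lemma entire_moment X : measurable_fun setT X -> exp_integrable P X -> entire (moment X).
Proof.
move=> mX eX e e0; exists (\int[P]_x expR (e^-1 * `|X x|)) => j.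
have ip := integ_pow j mX eX.
rewrite normrM [`|_^-1|]ger0_norm ?invr_ge0//.
apply: le_trans (ler_wpM2r _ (Rint_norm ip)) _; first by rewrite invr_ge0.
have ipn : integ P (fun x => `|X x ^+ j|).
  apply: (integ_le _ (integZ j`!%:R (eX 1))) => [|x]; first exact/measurable_abs/measurable_exprn.
  rewrite normr_id normrX mulrC -ler_pdivrMr ?ltr0n ?fact_gt0//.
  by have := pow_le_expR (X x) j ltr01; rewrite expr1n divr1.
rewrite mulrC -RintZ// [leRHS]mulrC -RintZ; last exact: eX.
apply: Rint_le => [||x]; [exact: integZ|exact/integZ/eX|].
have ei : 0 < e^-1 by rewrite invr_gt0.
have := pow_le_expR (X x) j ei; rewrite normrX exprVn invrK mulrC.
by rewrite (mulrC (e ^+ j)).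
Qed.

(** The weights [w] stand for [cos (t j)], [sin (t j)] or 1, so that one dominated convergence,
    under [exp (|r| |X|)], serves every direction in the plane. *)
Lemma moment_cvg X (w : nat -> R) (f : T -> R) r : measurable_fun setT X ->
  exp_integrable P X -> (forall j, `|w j| <= 1) ->
  (forall x, psum (fun j => (j`!%:R)^-1 * w j) (r * X x) = f x) ->
  integ P f /\ psum (fun j => moment X j * w j) r = \int[P]_x f x.
Proof.
move=> mX eX w1 wf; have ef := entireM_bounded (@entire_invfact R) w1.
have em := entireM_bounded (entire_moment mX eX) w1.
have it j := integZ (r ^+ j / j`!%:R * w j) (integ_pow j mX eX).
pose fn n x := pseries (fun j => (j`!%:R)^-1 * w j) (r * X x) n.
have fnE n x : fn n x = \sum_(j < n) (r ^+ j / j`!%:R * w j) * X x ^+ j.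
  rewrite /fn /pseries/series/= big_mkord; apply: eq_bigr => j _.
  by rewrite exprMn; ring.
have ifn n : integ P (fn n).
  by rewrite (funext (fnE n)); exact: integ_sum.
have [||i cv] := Rint_dct (fun n => integ_measurable (ifn n)) (eX `|r|) (f := f).
- move=> n x; rewrite /fn -normrM /pseries/series/= big_mkord.
  apply: le_trans (ler_norm_sum _ _ _) _.
  apply: le_trans (sum_exp_le n (normr_ge0 (r * X x))); apply: ler_sum => j _.
  rewrite (normrM _ (_ ^+ j)) normrX normrM [`|_^-1|]ger0_norm ?invr_ge0// mulrC.
  by apply: ler_wpM2l; [rewrite exprn_ge0|rewrite ler_piMr// invr_ge0].
- by move=> x; rewrite -wf; exact: psum_cvg.
split => //; apply: psum_eq; move: cv; apply: cvg_trans.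
apply: near_eq_cvg; apply: nearW => n.
transitivity (\int[P]_x \sum_(j < n) (r ^+ j / j`!%:R * w j) * X x ^+ j).
  by apply: eq_Rintegral => x _; exact: fnE.
rewrite Rint_sum// /pseries/series/= big_mkord; apply: eq_bigr => j _.
by rewrite RintZ ?/moment; [ring|exact: integ_pow].
Qed.

Lemma psum_cos_moment X t r : measurable_fun setT X -> exp_integrable P X ->
  integ P (fun x => expR (r * X x * cos t) * cos (r * X x * sin t)) /\
  psum_cos (moment X) t r = \int[P]_x (expR (r * X x * cos t) * cos (r * X x * sin t)).
Proof.
move=> mX eX; apply: moment_cvg => // [j|x]; first exact: cos_max.
exact: (psum_cexp t (r * X x)).1.
Qed.

Lemma psum_sin_moment X t r : measurable_fun setT X -> exp_integrable P X ->
  integ P (fun x => expR (r * X x * cos t) * sin (r * X x * sin t)) /\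
  psum_sin (moment X) t r = \int[P]_x (expR (r * X x * cos t) * sin (r * X x * sin t)).
Proof.
move=> mX eX; apply: moment_cvg => // [j|x]; first exact: sin_max.
exact: (psum_cexp t (r * X x)).2.
Qed.

Lemma psum_moment X r : measurable_fun setT X -> exp_integrable P X ->
  integ P (fun x => expR (r * X x)) /\ psum (moment X) r = \int[P]_x expR (r * X x).
Proof.
move=> mX eX; have := @moment_cvg X (fun=> 1) (fun x => expR (r * X x)) r mX eX.
case=> [j|x|i e]; first by rewrite normr1.
- by rewrite -psum_invfact; congr psum; apply/funext => j; rewrite mulr1.
- by split => //; rewrite -e; congr psum; apply/funext => j; rewrite mulr1.
Qed.

Lemma psum_cos_moment_pihalf X r : measurable_fun setT X -> exp_integrable P X ->
  psum_cos (moment X) (pi / 2) r = \int[P]_x cos (r * X x).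
Proof.
move=> mX eX; rewrite (psum_cos_moment _ _ mX eX).2; apply: eq_Rintegral => x _.
by rewrite cos_pihalf sin_pihalf mulr0 expR0 mul1r mulr1.
Qed.

Lemma psum_sin_moment_pihalf X r : measurable_fun setT X -> exp_integrable P X ->
  psum_sin (moment X) (pi / 2) r = \int[P]_x sin (r * X x).
Proof.
move=> mX eX; rewrite (psum_sin_moment _ _ mX eX).2; apply: eq_Rintegral => x _.
by rewrite cos_pihalf sin_pihalf mulr0 expR0 mul1r mulr1.
Qed.

Lemma moment0 X : moment X 0 = 1.
Proof.
rewrite /moment fact0 divr1 -[RHS](Rint_cst P); apply: eq_Rintegral => x _.
by rewrite expr0.
Qed.

(** Let [a + i b] be the complex expectation, [s] its modulus and [u = r X sin t]. Then [s^2] is the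
    expectation of [exp (r X cos t) (a cos u + b sin u)], whose second factor is at most [s] by
    Cauchy-Schwarz; it remains to divide by [s]. *)
Lemma psum_moment_modulus X r t : measurable_fun setT X -> exp_integrable P X ->
  psum_cos (moment X) t r ^+ 2 + psum_sin (moment X) t r ^+ 2 <=
  psum (moment X) (r * cos t) ^+ 2.
Proof.
move=> mX eX; have [ic ec] := psum_cos_moment t r mX eX.
have [is_ es] := psum_sin_moment t r mX eX.
have [im em] := psum_moment (r * cos t) mX eX.
set a := psum_cos _ _ _ in ec *; set b := psum_sin _ _ _ in es *.
set m := psum _ _ in em *.
pose s := Num.sqrt (a ^+ 2 + b ^+ 2).
have ss : s ^+ 2 = a ^+ 2 + b ^+ 2 by rewrite sqr_sqrtr// addr_ge0// sqr_ge0.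
have s0 : 0 <= s by exact: sqrtr_ge0.
have key : s ^+ 2 <= s * m.
  rewrite ss !expr2 {2}ec {2}es em -!RintZ// -RintD; [|exact: integZ..].
  apply: Rint_le => [||x]; [by apply: integD; exact: integZ|exact: integZ|].
  rewrite mulrAC; set u := _ * sin t; set e := expR _.
  have e0 : 0 <= e by exact: expR_ge0.
  rewrite (_ : a * _ + _ = (a * cos u + b * sin u) * e); last by ring.
  rewrite ler_wpM2r//; apply: le_trans (ler_norm _) _.
  rewrite -(@ler_pXn2r _ 2) ?nnegrE// -normrX ger0_norm ?sqr_ge0// ss.
  have cs := cos2Dsin2 u.
  have -> : a ^+ 2 + b ^+ 2 = (a * cos u + b * sin u) ^+ 2 + (a * sin u - b * cos u) ^+ 2.
    by rewrite -[LHS]mulr1 -cs; ring.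
  by rewrite lerDl sqr_ge0.
rewrite -ss lerXn2r ?nnegrE//.
  by rewrite em; apply: Rintegral_ge0 => x _; exact: expR_ge0.
have [->|s1] := eqVneq s 0.
  by rewrite em; apply: Rintegral_ge0 => x _; exact: expR_ge0.
by rewrite -(@ler_pM2l _ s) ?lt_neqAle ?s0 1?eq_sym ?s1// -expr2.
Qed.

(* A measurable cut-off function rather than an event, to stay within real integrals. *)
Lemma tight X (e : R) : measurable_fun setT X -> e < 1 -> exists (a : R) (b : T -> R),
  [/\ 0 <= a, measurable_fun setT b, forall x, 0 <= b x <= 1,
     forall x, b x = 0 \/ `|X x| <= a & e <= \int[P]_x b x].
Proof.
move=> mX e1; pose D n := [set x | `|X x| <= n%:R].
have mD n : measurable (D n).
  rewrite (_ : D n = setT `&` (fun x => `|X x|) @^-1` `]-oo, n%:R]%classic).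
    by apply: (measurable_abs mX) => //; exact: measurable_itv.
  by apply/seteqP; split => x /=; rewrite in_itv/=; tauto.
pose b n x : R := \1_(D n) x.
have b01 n x : 0 <= b n x <= 1 by rewrite /b indicE; case: (_ \in _); rewrite ?lexx ?ler01.
have mb n : measurable_fun setT (b n) by exact: measurable_indic.
have [|x|i cv] := Rint_dct mb (integ_cst P 1) (f := fun=> 1).
- by move=> n x; have /andP[b0 b1] := b01 n x; rewrite ger0_norm.
- apply: (@cvg_near_cst _ _ _ _ _ _) ; near=> n.
  rewrite /b indicE mem_set//= /D/=.
  apply: le_trans (ltW (truncnS_gt _)) _.
  by rewrite ler_nat; near: n; exact: nbhs_infty_ge.
rewrite Rint_cst in cv.
have /cvgrPdist_le /(_ (1 - e)) := cv; rewrite subr_gt0 => /(_ e1)[N _ /(_ N (leqnn N))/=].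
rewrite ler_norml => /andP[_ h].
exists N%:R, (b N); split => //; last by lra.
move=> x; rewrite /b indicE; case: (boolP (x \in D N)); last by left.
by rewrite inE; right.
Unshelve. all: by end_near. Qed.

End Moments.

(** * Independent sums on a product space *)

Section ProductExpectation.
Context d1 d2 (T1 : measurableType d1) (T2 : measurableType d2) (R : realType)
  (P1 : probability T1 R) (P2 : probability T2 R).
Implicit Types (f : T1 -> R) (g : T2 -> R).
Local Notation PP := (P1 \x P2)%E.

Lemma measurable_fst_comp f : measurable_fun setT f ->
  measurable_fun setT (fun z : T1 * T2 => f z.1).
Proof. by move=> mf; apply: measurableT_comp mf _; exact: measurable_fst. Qed.

Lemma measurable_snd_comp g : measurable_fun setT g ->
  measurable_fun setT (fun z : T1 * T2 => g z.2).
Proof. by move=> mg; apply: measurableT_comp mg _; exact: measurable_snd. Qed.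

Lemma integ_prod f g : integ P1 f -> integ P2 g ->
  integ PP (fun z => f z.1 * g z.2) /\
  \int[PP]_z (f z.1 * g z.2) = (\int[P1]_x f x) * (\int[P2]_y g y).
Proof.
move=> i1 i2; have [m1 m2] := (integ_measurable i1, integ_measurable i2).
have mfg : measurable_fun setT (fun z : T1 * T2 => f z.1 * g z.2).
  by apply: measurable_funM; [exact: measurable_fst_comp|exact: measurable_snd_comp].
have a1 : integ P1 (fun x => `|f x|).
  by apply: (integ_le _ (integrable_norm i1)) => [|x]; [exact: measurable_abs|rewrite normr_id].
have a2 : integ P2 (fun x => `|g x|).
  by apply: (integ_le _ (integrable_norm i2)) => [|x]; [exact: measurable_abs|rewrite normr_id].
have ii : integ PP (fun z => f z.1 * g z.2).
  apply/integrable12ltyP; first exact/measurable_EFinP.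
  rewrite (_ : (\int[P1]_x _)%E = (\int[P1]_x ((\int[P2]_y `|g y|) * `|f x|)%:E)%E).
    by rewrite RintE ?ltry//; exact: integZ.
  apply: eq_integral => x _.
  rewrite mulrC -(RintZ `|f x| a2) -RintE; last exact: integZ.
  by apply: eq_integral => y _ /=; rewrite normrM.
split => //; rewrite {1}/Rintegral -integral12_prod_meas1//.
rewrite (eq_integral (fun x => ((\int[P2]_y g y) * f x)%:E)).
  by rewrite RintE; [rewrite /= RintZ// mulrC|exact: integZ].
move=> x _; rewrite /fubini_F/= mulrC -(RintZ (f x) i2) -RintE//.
exact: integZ.
Qed.

Lemma integ_prod_left f g : measurable_fun setT f -> integ P2 g -> 0 < \int[P2]_y g y ->
  integ PP (fun z => f z.1 * g z.2) -> integ P1 f.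
Proof.
move=> mf ig g0 /integrable_fubini_F.
rewrite (_ : fubini_F _ _ = EFin \o (fun x => (\int[P2]_y g y) * f x)).
  move=> /(integZ (\int[P2]_y g y)^-1).
  by rewrite /integ; congr (_.-integrable _ _); apply/funext => x /=; rewrite mulKf// gt_eqF.
apply/funext => x; rewrite /fubini_F/= mulrC -(RintZ (f x) ig) -RintE//.
exact: integZ.
Qed.

Variables (X : T1 -> R) (W : T2 -> R).
Hypotheses (mX : measurable_fun setT X) (mW : measurable_fun setT W).

Definition sum_pair (z : T1 * T2) := X z.1 + W z.2.

Lemma measurable_sum_pair : measurable_fun setT sum_pair.
Proof. by apply: measurable_funD; [exact: measurable_fst_comp|exact: measurable_snd_comp]. Qed.

Lemma cos_sum_pair t : \int[PP]_z cos (t * sum_pair z) =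
  (\int[P1]_x cos (t * X x)) * (\int[P2]_y cos (t * W y)) -
  (\int[P1]_x sin (t * X x)) * (\int[P2]_y sin (t * W y)).
Proof.
have [i1 e1] := integ_prod (integ_cos P1 t mX) (integ_cos P2 t mW).
have [i2 e2] := integ_prod (integ_sin P1 t mX) (integ_sin P2 t mW).
rewrite -e1 -e2 -RintB//; apply: eq_Rintegral => z _.
by rewrite /sum_pair mulrDr cosD.
Qed.

Lemma sin_sum_pair t : \int[PP]_z sin (t * sum_pair z) =
  (\int[P1]_x sin (t * X x)) * (\int[P2]_y cos (t * W y)) +
  (\int[P1]_x cos (t * X x)) * (\int[P2]_y sin (t * W y)).
Proof.
have [i1 e1] := integ_prod (integ_sin P1 t mX) (integ_cos P2 t mW).
have [i2 e2] := integ_prod (integ_cos P1 t mX) (integ_sin P2 t mW).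
rewrite -e1 -e2 -RintD//; apply: eq_Rintegral => z _.
by rewrite /sum_pair mulrDr sinD.
Qed.

(** Where [|W| <= a] one has [|X| <= |X + W| + a]. The cut-off [b] restricts to this set; its
    integral is at least 1/2, so [integ_prod_left] can divide it out. *)
Lemma exp_integrable_left : exp_integrable PP sum_pair -> exp_integrable P1 X.
Proof.
move=> eS l; wlog l0 : l / 0 <= l.
  move=> H; have [l0|l0] := lerP 0 l; first exact: H.
  apply: (@integ_bounded _ _ _ _ _ 1) => [|x]; first exact/measurable_expRM/measurable_abs.
  by rewrite ger0_norm// -expR0 ler_expR mulr_le0_ge0// ltW.
have h1 : 1 / 2 < 1 :> R by lra.
have [a [b [a0 mb b01 bW bh]]] := tight P2 mW h1.
have ib : integ P2 b.
  by apply: (@integ_bounded _ _ _ _ _ 1) => // y; have /andP[b0 b1] := b01 y; rewrite ger0_norm.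
have me : measurable_fun setT (fun x => expR (l * `|X x|)) by exact/measurable_expRM/measurable_abs.
apply: (@integ_prod_left (fun x => expR (l * `|X x|)) b) => //; first by lra.
apply: (integ_le _ (integZ (expR (l * a)) (eS l))).
  by apply: measurable_funM; [exact: (measurable_fst_comp me)|exact: measurable_snd_comp].
move=> z; have /andP[b0 b1] := b01 z.2.
rewrite ger0_norm ?mulr_ge0//; case: (bW z.2) => [->|wa].
  by rewrite mulr0 mulr_ge0.
apply: le_trans (_ : expR (l * `|X z.1|) <= _); first by rewrite ler_piMr.
rewrite -expRD ler_expR -mulrDr ler_wpM2l// /sum_pair.
rewrite -[X in `|X| <= _](addrK (W z.2)).
by apply: le_trans (ler_normB _ _) _; rewrite addrC lerD2r.
Qed.

(** Division by [j!] turns the binomial formula into a Cauchy product. *)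
Lemma moment_sum_pair j : exp_integrable P1 X -> exp_integrable P2 W ->
  conv (moment P1 X) (moment P2 W) j = moment PP sum_pair j.
Proof.
move=> eX eW.
have ip k : integ PP (fun z => X z.1 ^+ (j - k) * W z.2 ^+ k) /\
    \int[PP]_z (X z.1 ^+ (j - k) * W z.2 ^+ k) = (\int[P1]_x X x ^+ (j - k)) * (\int[P2]_y W y ^+ k).
  exact: (integ_prod (integ_pow (j - k) mX eX) (integ_pow k mW eW)).
have eM : \int[PP]_z (sum_pair z ^+ j) = \sum_(k < j.+1) 'C(j, k)%:R *
    ((\int[P1]_x X x ^+ (j - k)) * (\int[P2]_y W y ^+ k)).
  transitivity (\int[PP]_z \sum_(k < j.+1) 'C(j, k)%:R * (X z.1 ^+ (j - k) * W z.2 ^+ k)).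
    by apply: eq_Rintegral => z _; rewrite /sum_pair exprDn; apply: eq_bigr => k _; rewrite mulr_natl.
  rewrite Rint_sum => [|k]; last exact: (integZ _ (ip k).1).
  by apply: eq_bigr => k _; rewrite RintZ ?(ip k).2//; exact: (ip k).1.
rewrite [RHS]/moment eM /conv mulr_suml (reindex_inj rev_ord_inj)/=; apply: eq_bigr => k _.
rewrite /moment subSS; have kj : (k <= j)%N by rewrite -ltnS.
rewrite subKn// -(bin_fact kj) !natrM; field.
by rewrite !pnatr_eq0 -!lt0n !fact_gt0 bin_gt0 kj.
Qed.

End ProductExpectation.

Section EvenPart.
Variable R : realType.

(** In [cramer_moment] the function [- p] is even near 0, so its even part may replace it; the odd
    coefficients then vanish by construction. *)
Definition neg_even_part (p : {poly R}) : {poly R} :=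
  \poly_(i < size p) (if odd i then 0 else - p`_i).

Lemma coef_neg_even_part p i : (neg_even_part p)`_i = if odd i then 0 else - p`_i.
Proof.
rewrite coef_poly; case: ltnP => // /leq_sizeP ->//.
by rewrite oppr0; case: ifP.
Qed.

Lemma horner_neg_even_part p t : (neg_even_part p).[t] = - (p.[t] + p.[- t]) / 2.
Proof.
rewrite /neg_even_part horner_poly !horner_coef -big_split/= -sumrN mulr_suml.
apply: eq_bigr => i _; rewrite (exprNn t) -signr_odd.
by case: ifP => oi; rewrite ?expr1 ?expr0; field.
Qed.

End EvenPart.

(** * Factors of a characteristic function with polynomial exponent *)

Section Cramer.
Context d1 d2 (T1 : measurableType d1) (T2 : measurableType d2) (R : realType)
  (P1 : probability T1 R) (P2 : probability T2 R).

(* [X] and [W] live on two spaces; the hypotheses say that the characteristic function of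
   [X + W] on the product space is [exp (- p)] near 0. *)
Lemma cramer_moment (X : T1 -> R) (W : T2 -> R) (p : {poly R}) (dl : R) :
  measurable_fun setT X -> measurable_fun setT W -> 0 < dl ->
  (forall t, `|t| < dl ->
    (\int[P1]_x cos (t * X x)) * (\int[P2]_y cos (t * W y)) -
    (\int[P1]_x sin (t * X x)) * (\int[P2]_y sin (t * W y)) = expR (- p.[t])) ->
  (forall t, `|t| < dl ->
    (\int[P1]_x sin (t * X x)) * (\int[P2]_y cos (t * W y)) +
    (\int[P1]_x cos (t * X x)) * (\int[P2]_y sin (t * W y)) = 0) ->
  exp_integrable P1 X /\ exists b1 b2 : R, 0 <= b2 /\
    forall x, psum (moment P1 X) x = expR (b1 * x + b2 * x ^+ 2).
Proof.
move=> mX mW d0 hc hs; pose q := neg_even_part p.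
have pE t : `|t| < dl -> p.[- t] = p.[t].
  move=> td; apply: oppr_inj; apply: expR_inj.
  rewrite -(hc t td) -hc ?normrN//.
  by rewrite !Rint_cosN !Rint_sinN// mulrNN.
have qE t : `|t| < dl -> q.[t] = - p.[t].
  by move=> td; rewrite horner_neg_even_part pE//; field.
have q0 : q`_0 = 0.
  rewrite -horner_coef0; apply: expR_inj; rewrite expR0 qE ?normr0// -hc ?normr0//.
  by rewrite !Rint_cos0 !Rint_sin0 mulr1 mulr0 subr0.
have qodd i : odd i -> q`_i = 0 by move=> oi; rewrite coef_neg_even_part oi.
pose a := expcoef q; have ea : entire a by exact: entire_expcoef.
have ha t : `|t| < dl -> expR (- p.[t]) = psum a t.
  by move=> td; rewrite psum_expcoef// qE.
have mS := measurable_sum_pair mX mW.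
have eS : exp_integrable (P1 \x P2)%E (sum_pair X W).
  by apply: (exp_integrable_of_analytic mS ea d0) => t td; rewrite cos_sum_pair// hc// ha.
have eS' : exp_integrable (P2 \x P1)%E (sum_pair W X).
  apply: (exp_integrable_of_analytic (measurable_sum_pair mW mX) ea d0) => t td.
  by rewrite cos_sum_pair// -ha// -hc//; ring.
have eX := exp_integrable_left mX mW eS; have eW := exp_integrable_left mW mX eS'.
split => //.
pose c := moment (P1 \x P2)%E (sum_pair X W).
have ec : entire c by exact: entire_moment.
(* Uniqueness of power series turns the two equations near 0 into [c_j i^j = a_j] for all [j], split
   into real and imaginary parts. *)
have cc : (fun j => c j * cos (pi / 2 *+ j)) = a.
  apply: (psum_inj d0) => //; first exact: entire_cos.
  by move=> t td; rewrite -/(psum_cos c (pi / 2) t) psum_cos_moment_pihalf// cos_sum_pair// hc// ha.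
have cs : (fun j => c j * sin (pi / 2 *+ j)) = fun=> 0.
  have e0 : entire (fun=> 0 : R) by apply: (@entire_fin _ _ 0).
  apply: (psum_inj d0) => //; first exact: entire_sin.
  move=> t td; rewrite -/(psum_sin c (pi / 2) t) psum_sin_moment_pihalf// sin_sum_pair// hs//.
  by rewrite (@psum_fin _ _ _ 0)// big_ord0.
have cE j : conv (moment P1 X) (moment P2 W) j = expcoef q j * cos (pi / 2 *+ j).
  rewrite moment_sum_pair// -/(c j) -/(a j) -cc.
  have := congr1 (fun u => u j) cs => /= csj.
  (* This undoes the rotation by [i^j], the sine part being zero by [cs]. *)
  transitivity (c j * (cos (pi / 2 *+ j) ^+ 2 + sin (pi / 2 *+ j) ^+ 2)).
    by rewrite cos2Dsin2 mulr1.
  by rewrite mulrDr !expr2 !mulrA csj mul0r addr0.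
have h1 : 1 / 2 < 1 :> R by lra.
have [al [b [a0 mb b01 bW bh]]] := tight P2 mW h1.
have ib : integ P2 b.
  by apply: (@integ_bounded _ _ _ _ _ 1) => // y; have /andP[b0 b1] := b01 y; rewrite ger0_norm.
apply: (@cramer_analytic _ (moment P1 X) (moment P2 W) q al (1 / 2)) => //.
- exact: entire_moment.
- exact: entire_moment.
- exact: moment0.
- by move=> x; rewrite (psum_moment x mX eX).2; apply: Rintegral_ge0 => y _; exact: expR_ge0.
- by move=> r t; exact: psum_moment_modulus.
(* Only the part where [|W| <= al] is kept, of mass at least 1/2; there [x W >= - al |x|]. *)
- move=> x; have [iw ->] := psum_moment x mW eW.
  apply: (@le_trans _ _ (\int[P2]_y (expR (- (al * `|x|)) * b y))).
    by rewrite RintZ// mulrC ler_wpM2l.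
  apply: Rint_le => [||y]; [exact: integZ|by []|].
  have /andP[b0 b1] := b01 y; case: (bW y) => [->|wa]; first by rewrite mulr0.
  apply: le_trans (_ : expR (- (al * `|x|)) <= _); first by rewrite ler_piMr.
  rewrite ler_expR lerNl -normrN; apply: le_trans (ler_norm _) _.
  by rewrite !normrN normrM mulrC ler_wpM2r.
Qed.

End Cramer.

(** * Uniqueness of the law and the normal case *)

Section TrigClass.
Context d1 d2 (T1 : measurableType d1) (T2 : measurableType d2) (R : realType)
  (P1 : probability T1 R) (P2 : probability T2 R) (X : T1 -> R) (Z : T2 -> R).
Hypotheses (mX : measurable_fun setT X) (mZ : measurable_fun setT Z).
Implicit Types (h : R -> R) (t c : R).

Hypothesis eq_cos : forall t, \int[P1]_x cos (t * X x) = \int[P2]_x cos (t * Z x).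
Hypothesis eq_sin : forall t, \int[P1]_x sin (t * X x) = \int[P2]_x sin (t * Z x).

(* Closed under products with sines, hence rich enough to contain approximations of the
   indicator of a half-line. *)
Definition same_trig h := [/\ measurable_fun setT h, exists C, forall x, `|h x| <= C &
  forall w n, \int[P1]_x (h (X x) * cos (w * X x + n)) = \int[P2]_x (h (Z x) * cos (w * Z x + n))].

Lemma continuous_cos_affine w n : continuous (fun x : R => cos (w * x + n)).
Proof.
move=> x; apply: (@continuous_comp _ _ _ (fun x => w * x + n) cos); last exact: continuous_cos.
by apply: cvgD; [exact: mulrl_continuous|exact: cvg_cst].
Qed.

Lemma continuous_sin_affine w n : continuous (fun x : R => sin (w * x + n)).
Proof.
move=> x; apply: (@continuous_comp _ _ _ (fun x => w * x + n) sin); last exact: continuous_sin.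
by apply: cvgD; [exact: mulrl_continuous|exact: cvg_cst].
Qed.

Lemma integ_bounded_comp d (T : measurableType d) (P : probability T R) (Y : T -> R) h :
  measurable_fun setT Y -> measurable_fun setT h -> (exists C, forall x, `|h x| <= C) ->
  integ P (fun x => h (Y x)).
Proof.
move=> mY mh [C hC]; apply: (@integ_bounded _ _ _ _ _ C) => // .
exact: measurableT_comp mh mY.
Qed.

Lemma bounded_mul_cos h w n : measurable_fun setT h -> (exists C, forall x, `|h x| <= C) ->
  measurable_fun setT (fun x => h x * cos (w * x + n)) /\
  exists C, forall x, `|h x * cos (w * x + n)| <= C.
Proof.
move=> mh [C hC]; split.
  by apply: measurable_funM => //; apply: continuous_measurable_fun; exact: continuous_cos_affine.
exists C => x; rewrite normrM; apply: le_trans (hC x).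
by rewrite ler_piMr// cos_max.
Qed.

Lemma same_trig1 : same_trig (fun=> 1).
Proof.
split; [exact: measurable_cst|by exists 1 => x; rewrite normr1|move=> w n].
have aux d (T : measurableType d) (P : probability T R) (Y : T -> R) : measurable_fun setT Y ->
    \int[P]_x (1 * cos (w * Y x + n)) =
    cos n * (\int[P]_x cos (w * Y x)) - sin n * (\int[P]_x sin (w * Y x)).
  move=> mY; have [ic is_] := (integ_cos P w mY, integ_sin P w mY).
  rewrite -!RintZ// -RintB; [|exact: integZ..].
  by apply: eq_Rintegral => x _; rewrite mul1r cosD; ring.
by rewrite !aux// eq_cos eq_sin.
Qed.

Lemma same_trigD h g a : same_trig h -> same_trig g -> same_trig (fun x => h x + a * g x).
Proof.
move=> [mh bh eh] [mg bg eg].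
split.
- by apply: measurable_funD => //; apply: measurable_funM.
- have [[C hC] [D gD]] := (bh, bg); exists (C + `|a| * D) => x.
  by apply: le_trans (ler_normD _ _) _; rewrite lerD// normrM ler_wpM2l.
- move=> w n; have aux d (T : measurableType d) (P : probability T R) (Y : T -> R) :
      measurable_fun setT Y ->
      \int[P]_x ((h (Y x) + a * g (Y x)) * cos (w * Y x + n)) =
      \int[P]_x (h (Y x) * cos (w * Y x + n)) + a * (\int[P]_x (g (Y x) * cos (w * Y x + n))).
    move=> mY; have [m1 b1] := bounded_mul_cos w n mh bh.
    have [m2 b2] := bounded_mul_cos w n mg bg.
    have i1 := integ_bounded_comp P mY m1 b1; have i2 := integ_bounded_comp P mY m2 b2.
    rewrite -RintZ// -RintD//; last exact: integZ.
    by apply: eq_Rintegral => x _; ring.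
  by rewrite !aux// eh eg.
Qed.

Lemma same_trig_sin h t c : same_trig h -> same_trig (fun x => h x * sin (t * x + c)).
Proof.
move=> [mh bh eh]; split.
- by apply: measurable_funM => //; apply: continuous_measurable_fun; exact: continuous_sin_affine.
- have [C hC] := bh; exists C => x; rewrite normrM; apply: le_trans (hC x).
  by rewrite ler_piMr// sin_max.
(* The product formula yields sines; shifts by [pi / 2] bring them back to the cosines with phase
   that [same_trig] tests against. *)
- move=> w n; have aux d (T : measurableType d) (P : probability T R) (Y : T -> R) :
      measurable_fun setT Y ->
      \int[P]_x (h (Y x) * sin (t * Y x + c) * cos (w * Y x + n)) =
      2^-1 * (\int[P]_x (h (Y x) * cos ((t + w) * Y x + (c + n - pi / 2)))) +
      2^-1 * (\int[P]_x (h (Y x) * cos ((t - w) * Y x + (c - n - pi / 2)))).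
    move=> mY; have [m1 b1] := bounded_mul_cos (t + w) (c + n - pi / 2) mh bh.
    have [m2 b2] := bounded_mul_cos (t - w) (c - n - pi / 2) mh bh.
    have i1 := integ_bounded_comp P mY m1 b1; have i2 := integ_bounded_comp P mY m2 b2.
    rewrite -!RintZ// -RintD//; [|exact: integZ..].
    apply: eq_Rintegral => x _; rewrite !(addrA _ _ (- (pi / 2))) !cosBpihalf.
    have -> : (t + w) * Y x + (c + n) = (t * Y x + c) + (w * Y x + n) by ring.
    have -> : (t - w) * Y x + (c - n) = (t * Y x + c) - (w * Y x + n) by ring.
    by rewrite (sinD (t * Y x + c)) (sinB (t * Y x + c)); field.
  by rewrite !aux// !eh.
Qed.

(** A sine rescaled to [[0, 1]], so that the threshold 1/2 of [steep] falls where the sine changes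
    sign. *)
Definition sin_unit t c x := (1 + sin (t * x + c)) / 2.

Lemma sin_unit01 t c x : 0 <= sin_unit t c x <= 1.
Proof.
have := sin_max (t * x + c); rewrite ler_norml /sin_unit => /andP[s1 s2].
by apply/andP; split; lra.
Qed.

Lemma same_trig_ext h g : (forall x, h x = g x) -> same_trig h -> same_trig g.
Proof. by move=> /funext ->. Qed.

Lemma same_trig_pow t c h n : same_trig h -> same_trig (fun x => h x * sin_unit t c x ^+ n).
Proof.
move=> sh; elim: n => [|n IH].
  by apply: same_trig_ext sh => x; rewrite expr0 mulr1.
(* The zero function: [same_trigD] scales only its second argument, so a multiple is obtained by
   adding it to zero. *)
have z : same_trig (fun x => h x * sin_unit t c x ^+ n - h x * sin_unit t c x ^+ n).
  by apply: same_trig_ext (same_trigD (-1) IH IH) => x; rewrite mulN1r.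
apply: same_trig_ext (same_trigD 2^-1 (same_trigD 2^-1 z IH) (same_trig_sin t c IH)) => x.
by rewrite exprSr /sin_unit; field.
Qed.

Lemma same_trig_steep t c n m : same_trig (fun x => (1 - sin_unit t c x ^+ n) ^+ m).
Proof.
elim: m => [|m IH]; first by apply: same_trig_ext same_trig1 => x; rewrite expr0.
apply: same_trig_ext (same_trigD (-1) IH (same_trig_pow t c n IH)) => x.
by rewrite exprSr; ring.
Qed.

Lemma same_int_steep t c n m :
  \int[P1]_x (1 - sin_unit t c (X x) ^+ n) ^+ m = \int[P2]_x (1 - sin_unit t c (Z x) ^+ n) ^+ m.
Proof.
have [_ _ /(_ 0 0)] := same_trig_steep t c n m.
have e d (T : measurableType d) (P : probability T R) (Y : T -> R) :
    \int[P]_x ((1 - sin_unit t c (Y x) ^+ n) ^+ m * cos (0 * Y x + 0)) =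
    \int[P]_x (1 - sin_unit t c (Y x) ^+ n) ^+ m.
  by apply: eq_Rintegral => x _; rewrite mul0r addr0 cos0 mulr1.
by rewrite !e.
Qed.

End TrigClass.

Section Steep.
Variable R : realType.
Implicit Types (y z : R).

Lemma bernoulli_sub y m : 0 <= y <= 1 -> 1 - y *+ m <= (1 - y) ^+ m.
Proof.
move=> /andP[y0 y1]; elim: m => [|m IH]; first by rewrite mulr0n subr0 expr0.
have ym : 0 <= y *+ m by rewrite mulrn_wge0.
rewrite exprS mulrSr; apply: le_trans (ler_wpM2l _ IH); last by lra.
by nra.
Qed.

Lemma bernoulli_add y m : 0 <= y -> 1 + y *+ m <= (1 + y) ^+ m.
Proof.
move=> y0; elim: m => [|m IH]; first by rewrite mulr0n addr0 expr0.
have ym : 0 <= y *+ m by rewrite mulrn_wge0.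
rewrite exprS mulrSr; apply: le_trans (ler_wpM2l _ IH); last by lra.
by nra.
Qed.

(** Write [z = w^2]: then [n w^n] is bounded by the geometric sum [1 / (1 - w)], and the other
    factor [w^n] tends to 0. *)
Lemma mulrn_exp_cvg0 z : 0 <= z < 1 -> z ^+ n *+ n @[n --> \oo] --> 0.
Proof.
move=> /andP[z0 z1]; pose w := Num.sqrt z.
have w0 : 0 <= w by exact: sqrtr_ge0.
have ww : w ^+ 2 = z by rewrite sqr_sqrtr.
have w1 : w < 1 by rewrite -(@ltr_pXn2r _ 2) ?nnegrE// ww expr1n.
have b n : w ^+ n *+ n <= (1 - w)^-1.
  rewrite -(ler_pM2r (x := 1 - w)) ?subr_gt0// mulVf ?gt_eqF ?subr_gt0//.
  apply: (@le_trans _ _ ((\sum_(i < n) w ^+ i) * (1 - w))).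
    rewrite ler_wpM2r ?subr_ge0 ?(ltW w1)// -[n in X in _ *+ X <= _]card_ord -sumr_const.
    by apply: ler_sum => i _; rewrite ler_wiXn2l ?(ltW w1)// ltnW.
  by rewrite mulrC -opprB mulNr -subrX1 opprB lerBlDr lerDl exprn_ge0.
apply: (@squeeze_cvgr _ _ _ _ (cst 0) (geometric (1 - w)^-1 w)).
- apply: nearW => n; rewrite /= mulrn_wge0 ?exprn_ge0//=.
  rewrite -ww exprAC expr2 -mulrnAr mulrC.
  by apply: ler_wpM2r; [rewrite exprn_ge0|exact: b].
- exact: cvg_cst.
- by apply: cvg_geometric; rewrite ger0_norm.
Qed.

(* The exponent makes [y ^ n] times the number of factors, [(2 y) ^ n * n], tend to 0
   exactly when [y < 1 / 2]. *)
Definition steep n y := (1 - y ^+ n) ^+ (n * 2 ^ n).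

Lemma steep01 n y : 0 <= y <= 1 -> 0 <= steep n y <= 1.
Proof.
move=> /andP[y0 y1]; have h1 : y ^+ n <= 1 by exact: exprn_ile1.
have h0 : 0 <= y ^+ n by exact: exprn_ge0.
by apply/andP; split; [rewrite exprn_ge0//; lra|apply: exprn_ile1; lra].
Qed.

Lemma steep_cvg y : 0 <= y <= 1 -> steep n y @[n --> \oo] --> ((y < 1 / 2)%R%:R : R).
Proof.
move=> y01; have /andP[y0 y1] := y01.
have pw n : 0 <= y ^+ n <= 1 by rewrite exprn_ge0//= exprn_ile1.
have [yh|yh] := ltrP y (1 / 2).
  have z01 : 0 <= 2 * y < 1 by apply/andP; split; lra.
  apply: (@squeeze_cvgr _ _ _ _ (fun n => 1 - (2 * y) ^+ n *+ n) (cst 1)).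
  - apply: nearW => n; have /andP[_ ->] := steep01 n y01; rewrite andbT.
    apply: le_trans (bernoulli_sub (n * 2 ^ n) (pw n)).
    by rewrite exprMn mulrnA -(mulr_natl (_ *+ n)) natrX -mulrnAr.
  - rewrite -[X in _ --> X]subr0; apply: cvgB; first exact: cvg_cst.
    exact: mulrn_exp_cvg0.
  - exact: cvg_cst.
(* For [y >= 1 / 2] put [u = y^n] and [M = n 2^n]: then [(1 - u)^M (1 + u)^M <= 1], while
   [(1 + u)^M >= 1 + M u >= n + 1]. *)
apply: (@squeeze_cvgr _ _ _ _ (cst 0) (fun n => n.+1%:R^-1)).
- apply: nearW => n; have /andP[-> _] := steep01 n y01; rewrite andTb.
  have u01 := pw n; move: u01; set u := y ^+ n => /andP[u0 u1].
  rewrite -[X in _ <= X]mul1r ler_pdivlMr ?ltr0n//.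
  apply: (@le_trans _ _ (steep n y * (1 + u) ^+ (n * 2 ^ n))).
    have /andP[s0 _] := steep01 n y01; apply: ler_wpM2l => //.
    apply: le_trans (bernoulli_add _ u0).
    rewrite -natr1 addrC lerD2l mulrnA mulrnAC -[leLHS]/(1 *+ n) lerMn2r; apply/orP; right.
    rewrite -mulr_natr natrX /u -exprMn; apply: exprn_ege1; lra.
  rewrite /steep -exprMn; apply: exprn_ile1.
    by rewrite -/u mulr_ge0//; lra.
  by rewrite -/u; nra.
- exact: cvg_cst.
- apply/cvgrPdist_le => e e0; near=> n; rewrite sub0r normrN ger0_norm ?invr_ge0//.
  near: n; have := near_infty_natSinv_lt (PosNum e0).
  by apply: filterS => n /ltW.
Unshelve. all: by end_near. Qed.

End Steep.

Section LawUniqueness.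
Context d1 d2 (T1 : measurableType d1) (T2 : measurableType d2) (R : realType)
  (P1 : probability T1 R) (P2 : probability T2 R) (X : T1 -> R) (Z : T2 -> R).
Hypotheses (mX : measurable_fun setT X) (mZ : measurable_fun setT Z).
Hypothesis eq_cos : forall t, \int[P1]_x cos (t * X x) = \int[P2]_x cos (t * Z x).
Hypothesis eq_sin : forall t, \int[P1]_x sin (t * X x) = \int[P2]_x sin (t * Z x).

Lemma measurable_sin_unit t c : measurable_fun setT (sin_unit t c : R -> R).
Proof.
apply: measurable_funM => //; apply: measurable_funD => //.
by apply: continuous_measurable_fun; exact: continuous_sin_affine.
Qed.

Lemma steep_dct d (T : measurableType d) (P : probability T R) (Y : T -> R) t c :
  measurable_fun setT Y ->
  integ P (fun x => ((sin_unit t c (Y x) < 1 / 2)%R%:R : R)) /\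
  \int[P]_x steep n (sin_unit t c (Y x)) @[n --> \oo] -->
  \int[P]_x ((sin_unit t c (Y x) < 1 / 2)%R%:R : R).
Proof.
move=> mY; apply: (Rint_dct _ (integ_cst P 1)).
- move=> n; apply: measurable_exprn; apply: measurable_funB => //; apply: measurable_exprn.
  exact: (measurableT_comp (measurable_sin_unit t c) mY).
- move=> n x; have /andP[s0 s1] := steep01 n (sin_unit01 t c (Y x)).
  by rewrite ger0_norm.
- by move=> x; apply: steep_cvg; exact: sin_unit01.
Qed.

Lemma eq_int_sin_neg t c : \int[P1]_x ((sin_unit t c (X x) < 1 / 2)%R%:R : R) =
  \int[P2]_x ((sin_unit t c (Z x) < 1 / 2)%R%:R : R).
Proof.
have [_ c1] := steep_dct P1 t c mX; have [_ c2] := steep_dct P2 t c mZ.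
apply: (cvg_unique (@Rhausdorff R) c1); apply: cvg_trans c2.
by apply: near_eq_cvg; apply: nearW => n; rewrite /steep (same_int_steep mX mZ eq_cos eq_sin).
Qed.

(** For large [n] the number [(x - a) / (n + 1)] lies in [(-1, 1)], where the sine has the sign of
    its argument: stretching the period lets a periodic test detect a half-line. *)
Lemma sin_unit_lt (a x : R) :
  (fun n => (sin_unit (n.+1%:R^-1) (- (a / n.+1%:R)) x < 1 / 2)%R%:R : R) @ \oo -->
  ((x < a)%R%:R : R).
Proof.
apply: (@cvg_near_cst _ _ _ _ _ _); near=> n.
have n0 : (0 : R) < n.+1%:R by rewrite ltr0n.
congr (_%:R); congr nat_of_bool.
pose u := (x - a) / n.+1%:R.
have u1 : `|u| < 1.
  rewrite normrM [`|_^-1|]gtr0_norm ?invr_gt0// ltr_pdivrMr// mul1r.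
  apply: lt_trans (truncnS_gt _) _.
  by rewrite ltr_nat ltnS; near: n; exact: nbhs_infty_ge.
have -> : (sin_unit n.+1%:R^-1 (- (a / n.+1%:R)) x < 1 / 2) = (sin u < 0).
  rewrite /sin_unit (_ : _ * x + _ = u); last by rewrite /u; ring.
  by apply/idP/idP; lra.
have -> : (x < a) = (u < 0) by rewrite /u pmulr_llt0 ?invr_gt0// subr_lt0.
have pi1 : 1 <= (pi : R) by have := pi_ge2 R; lra.
move: u1; rewrite ltr_norml => /andP[u1 u2].
case: (ltrgt0P u) => [up|un|->].
- by apply/negbTE; rewrite -leNgt ltW// sin_gt0_pi// up/=; lra.
- by rewrite -oppr_gt0 -sinN sin_gt0_pi//; apply/andP; split; lra.
- by rewrite sin0 ltxx.
Unshelve. all: by end_near. Qed.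

Lemma eq_int_lt a : \int[P1]_x ((X x < a)%R%:R : R) = \int[P2]_x ((Z x < a)%R%:R : R).
Proof.
have dct d (T : measurableType d) (P : probability T R) (Y : T -> R) : measurable_fun setT Y ->
   \int[P]_x ((sin_unit (n.+1%:R^-1) (- (a / n.+1%:R)) (Y x) < 1 / 2)%R%:R : R) @[n --> \oo] -->
   \int[P]_x ((Y x < a)%R%:R : R).
  move=> mY; apply: (Rint_dct _ (integ_cst P 1) _ _).2.
  - by move=> n; apply: (integ_measurable (steep_dct P _ _ mY).1).
  - by move=> n x; case: (_ < _); rewrite ?normr1 ?normr0.
  - by move=> x; exact: sin_unit_lt.
apply: (cvg_unique (@Rhausdorff R) (dct _ _ P1 X mX)).
apply: cvg_trans (dct _ _ P2 Z mZ).
by apply: near_eq_cvg; apply: nearW => n; rewrite eq_int_sin_neg.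
Qed.

Lemma Rint_preimage d (T : measurableType d) (P : probability T R) (Y : T -> R) a :
  measurable_fun setT Y -> P (Y @^-1` `]-oo, a[) = (\int[P]_x ((Y x < a)%R%:R : R))%:E.
Proof.
move=> mY; have mA : measurable (Y @^-1` `]-oo, a[%classic).
  by rewrite -[X in measurable X]setTI; apply: mY => //; exact: measurable_itv.
have e x : ((Y x < a)%R%:R : R) = \1_(Y @^-1` `]-oo, a[%classic) x.
  by rewrite indicE; congr (_%:R); congr nat_of_bool; apply/idP/idP; rewrite inE/= in_itv.
rewrite -RintE.
  transitivity (\int[P]_x (\1_(Y @^-1` `]-oo, a[%classic) x)%:E)%E.
    by rewrite integral_indic// setIT.
  by apply: eq_integral => x _; rewrite e.
apply: (@integ_bounded _ _ _ _ _ 1) => [|x]; first by rewrite (funext e); exact: measurable_indic.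
by case: (_ < _); rewrite ?normr1 ?normr0.
Qed.

Lemma law_unique A : measurable A -> P1 (X @^-1` A) = P2 (Z @^-1` A).
Proof.
pose X' : {mfun T1 >-> R} := mfun_Sub (mem_set mX).
pose Z' : {mfun T2 >-> R} := mfun_Sub (mem_set mZ).
apply: (@measure_unique _ R _ (@RGenInftyO.G R) (fun n => `]-oo, n%:R[%classic) _ _ _ _
  (distribution P1 X') (distribution P2 Z')).
- exact: RGenInftyO.measurableE.
- move=> _ _ [a ->] [b ->]; exists (Num.min a b).
  by apply/seteqP; split => x /=; rewrite !in_itv/= lt_min => /andP.
- by move=> n; exists n%:R.
- apply/seteqP; split => // x _; exists (Num.truncn `|x|).+1 => //=.
  by rewrite in_itv/=; apply: le_lt_trans (ler_norm x) (truncnS_gt _).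
- move=> _ [a ->].
  change (P1 (X @^-1` `]-oo, a[%classic) = P2 (Z @^-1` `]-oo, a[%classic)).
  by rewrite !Rint_preimage// eq_int_lt.
- by move=> n; apply: le_lt_trans (probability_le1 _ _) (ltry _); exact: measurable_itv.
Qed.

End LawUniqueness.

Section MomentLaw.
Context d1 d2 (T1 : measurableType d1) (T2 : measurableType d2) (R : realType)
  (P1 : probability T1 R) (P2 : probability T2 R).

(** The values on the real line determine the coefficients, and the same series on the imaginary
    axis are the characteristic functions. *)
Lemma law_unique_mgf (X : T1 -> R) (Z : T2 -> R) :
  measurable_fun setT X -> measurable_fun setT Z ->
  exp_integrable P1 X -> exp_integrable P2 Z ->
  (forall x, psum (moment P1 X) x = \int[P2]_z expR (x * Z z)) ->
  forall A, measurable A -> P1 (X @^-1` A) = P2 (Z @^-1` A).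
Proof.
move=> mX mZ eX eZ h.
have mm : moment P1 X = moment P2 Z.
  apply: (@psum_inj _ _ _ 1) => // [||x _]; [exact: entire_moment..|].
  by rewrite h (psum_moment x mZ eZ).2.
apply: law_unique => // t.
- by rewrite -!psum_cos_moment_pihalf// mm.
- by rewrite -!psum_sin_moment_pihalf// mm.
Qed.

End MomentLaw.

(** * Normal laws and their moment generating functions *)

Section Gaussian.
Variable R : realType.
Implicit Types (m s x : R).
Local Notation mu := (@lebesgue_measure R).

(** Completing the square: tilting shifts the mean by [l s^2], so the moment generating function
    reduces to the total mass of a normal density. *)
Lemma normal_pdf_tilt m s l z : s != 0 ->
  expR (l * z) * normal_pdf m s z = expR (l * m + l ^+ 2 * s ^+ 2 / 2) * normal_pdf (m + l * s ^+ 2) s z.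
Proof.
move=> s0; rewrite !normal_pdfE// /normal_fun mulrCA [RHS]mulrCA; congr (_ * _).
rewrite -!expRD; congr expR.
have s20 : s ^+ 2 *+ 2 != 0 by rewrite mulrn_eq0 expf_eq0/=.
by rewrite -mulr_natr; field.
Qed.

Lemma integral_normal_prob m s (f : R -> \bar R) : measurable_fun setT f -> (forall x, 0 <= f x)%E ->
  (\int[normal_prob m s]_x f x = \int[mu]_x (f x * (normal_pdf m s x)%:E))%E.
Proof.
move=> mf f0; have dom := @normal_prob_dominates R m s.
rewrite -(Radon_Nikodym_SigmaFinite.change_of_variables dom)//.
have iRN := Radon_Nikodym_SigmaFinite.f_integrable dom.
have mpdf : measurable_fun setT (fun x => (normal_pdf m s x)%:E).
  by apply/measurable_EFinP; exact: measurable_normal_pdf.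
apply: ae_eq_integral => //.
- by apply: emeasurable_funM => //; exact: (measurable_int mu).
- exact: emeasurable_funM.
- apply: ae_eqe_mul2l; apply: integral_ae_eq => //.
  by move=> E _ mE; rewrite -Radon_Nikodym_SigmaFinite.f_integral.
Qed.

Lemma integral_normal_expR m s l : s != 0 ->
  (\int[normal_prob m s]_x (expR (l * x))%:E = (expR (l * m + l ^+ 2 * s ^+ 2 / 2))%:E)%E.
Proof.
move=> s0; rewrite integral_normal_prob//; last first.
  apply/measurable_EFinP; exact: (measurable_expRM l (@measurable_id _ R setT)).
under eq_integral do rewrite -EFinM normal_pdf_tilt// EFinM.
rewrite integralZl//; last exact: integrable_normal_pdf.
by rewrite integral_normal_pdf mule1.
Qed.

Lemma normal_mgf m s l : s != 0 ->
  integ (normal_prob m s) (fun x => expR (l * x)) /\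
  \int[normal_prob m s]_x expR (l * x) = expR (l * m + l ^+ 2 * s ^+ 2 / 2).
Proof.
move=> s0; have e := integral_normal_expR m l s0.
have i : integ (normal_prob m s) (fun x => expR (l * x)).
  apply/integrableP; split.
    apply/measurable_EFinP; exact: (measurable_expRM l (@measurable_id _ R setT)).
  under eq_integral do rewrite /= ger0_norm ?expR_ge0//.
  by rewrite e ltry.
by split => //; rewrite /Rintegral e.
Qed.

Lemma exp_integrable_normal m s : s != 0 -> exp_integrable (normal_prob m s) id.
Proof.
move=> s0 l; have [i1 _] := normal_mgf m l s0; have [i2 _] := normal_mgf m (- l) s0.
apply: (integ_le _ (integD i1 i2)) => [|x].
  by apply: measurable_expRM; exact/measurable_abs/measurable_id.
rewrite ger0_norm ?expR_ge0//=; have [x0|x0] := lerP 0 x.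
  by rewrite ger0_norm// lerDl expR_ge0.
by rewrite ler0_norm ?(ltW x0)// mulrN -mulNr lerDr expR_ge0.
Qed.

Lemma normal_variable_mgf d (T : measurableType d) (P : probability T R) (X : T -> R) (b1 b2 : R) :
  measurable_fun setT X -> exp_integrable P X -> 0 <= b2 ->
  (forall x, psum (moment P X) x = expR (b1 * x + b2 * x ^+ 2)) -> normal_variable P X.
Proof.
(* A normal moment generating function has exponent [m x + s^2 x^2 / 2], hence [s^2 = 2 b2]; the
   case [b2 = 0] is the Dirac law. *)
move=> mX eX b20 h; exists b1, (Num.sqrt (2 * b2)); split; first exact: sqrtr_ge0.
move=> A mA; rewrite /normal_law; have [s0|s0] := eqVneq.
  have b2e : b2 = 0.
    apply/eqP; rewrite eq_le b20 andbT; move/eqP: s0; rewrite sqrtr_eq0; lra.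
  have ed l : integ (\d_b1 : probability _ R) (fun x => expR (l * `|x|)).
    apply/integrableP; split.
      apply/measurable_EFinP; apply: measurable_expRM; exact/measurable_abs/measurable_id.
    rewrite integral_dirac//; first by rewrite diracT mul1e ltry.
    apply: measurableT_comp => //; apply/measurable_EFinP; apply: measurable_expRM; exact/measurable_abs/measurable_id.
  rewrite (@law_unique_mgf _ _ _ _ R P (\d_b1 : probability _ R) X id)//.
  move=> x; rewrite h b2e mul0r addr0 /Rintegral integral_dirac//.
    by rewrite diracT mul1e mulrC.
  by apply/measurable_EFinP; apply: measurable_expRM; exact: measurable_id.
have s2 : Num.sqrt (2 * b2) ^+ 2 = 2 * b2 by rewrite sqr_sqrtr// mulr_ge0.
rewrite (@law_unique_mgf _ _ _ _ R P (normal_prob b1 (Num.sqrt (2 * b2))) X id)//.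
- exact: exp_integrable_normal.
- by move=> x; rewrite (normal_mgf b1 x s0).2 h s2; congr expR; field.
Qed.

End Gaussian.

(** * Complex expectations and independence *)

Section ComplexParts.
Variable R : realType.
Implicit Types x y : R[i].

Lemma complex_ReD x y : complex.Re (x + y) = complex.Re x + complex.Re y.
Proof. by case: x; case: y. Qed.
Lemma complex_ImD x y : complex.Im (x + y) = complex.Im x + complex.Im y.
Proof. by case: x; case: y. Qed.
Lemma complex_ReM x y :
  complex.Re (x * y) = complex.Re x * complex.Re y - complex.Im x * complex.Im y.
Proof. by case: x; case: y. Qed.
Lemma complex_ImM x y :
  complex.Im (x * y) = complex.Re x * complex.Im y + complex.Im x * complex.Re y.
Proof. by case: x; case: y. Qed.
Lemma Re_sum (I : Type) (r : seq I) (Q : pred I) (F : I -> R[i]) :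
  complex.Re (\sum_(i <- r | Q i) F i) = \sum_(i <- r | Q i) complex.Re (F i).
Proof. by rewrite (big_morph _ complex_ReD (erefl : complex.Re 0 = 0)). Qed.
Lemma Im_sum (I : Type) (r : seq I) (Q : pred I) (F : I -> R[i]) :
  complex.Im (\sum_(i <- r | Q i) F i) = \sum_(i <- r | Q i) complex.Im (F i).
Proof. by rewrite (big_morph _ complex_ImD (erefl : complex.Im 0 = 0)). Qed.

Definition normsq x := complex.Re x ^+ 2 + complex.Im x ^+ 2.

Lemma normsqM x y : normsq (x * y) = normsq x * normsq y.
Proof. by rewrite /normsq complex_ReM complex_ImM; ring. Qed.

Lemma normsq_prod (I : Type) (r : seq I) (Q : pred I) (F : I -> R[i]) :
  normsq (\prod_(i <- r | Q i) F i) = \prod_(i <- r | Q i) normsq (F i).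
Proof.
rewrite (big_morph _ normsqM (_ : normsq 1 = 1))// /normsq/=.
by rewrite expr1n expr0n addr0.
Qed.

Definition cis (t : R) : R[i] := Complex (cos t) (sin t).

Lemma cisD s t : cis (s + t) = cis s * cis t.
Proof. by apply/eqP; rewrite eq_complex/= cosD sinD addrC !eqxx/= addrC (mulrC (sin s)) eqxx. Qed.

Lemma cis0 : cis 0 = 1.
Proof. by rewrite /cis cos0 sin0. Qed.

Lemma cis_sum (I : Type) (r : seq I) (Q : pred I) (F : I -> R) :
  cis (\sum_(i <- r | Q i) F i) = \prod_(i <- r | Q i) cis (F i).
Proof. by rewrite (big_morph _ cisD cis0). Qed.

End ComplexParts.

Section StepApproximation.
Context d d' (T : measurableType d) (T' : measurableType d') (R : realType)
  (P : probability T R).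
Implicit Types (W : T -> R) (f : T' -> R).

(* Reduces to [f >= 0] and approximates [f] by [floor ((n + 1) f) / (n + 1)]. *)
Lemma step_approx_independent W (X : T -> T') f C :
  measurable_fun setT W -> (exists D, forall x, `|W x| <= D) ->
  measurable_fun setT X ->
  measurable_fun setT f -> (forall y, `|f y| <= C) ->
  (forall B, measurable B -> \int[P]_x (W x * \1_B (X x)) =
     (\int[P]_x W x) * (\int[P]_x \1_B (X x))) ->
  \int[P]_x (W x * f (X x)) = (\int[P]_x W x) * (\int[P]_x f (X x)).
Proof.
move=> mW [D WD] mX mf fC indep.
wlog f0 : f C mf fC / forall y, 0 <= f y.
  move=> H; have := H (fun y => f y + C) (C + C).
  have fC' y : - C <= f y <= C by rewrite -ler_norml.
  have iW : integ P W by exact: integ_bounded mW WD.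
  have ifX : integ P (fun x => f (X x)).
    by apply: (@integ_bounded _ _ _ _ _ C) => //; exact: measurableT_comp mf mX.
  have iWf : integ P (fun x => W x * f (X x)).
    apply: (@integ_bounded _ _ _ _ _ (D * C)).
      by apply: measurable_funM => //; exact: measurableT_comp mf mX.
    by move=> x; rewrite normrM ler_pM.
  have e1 : \int[P]_x (W x * (f (X x) + C)) = \int[P]_x (W x * f (X x)) + C * \int[P]_x W x.
    rewrite -RintZ// -RintD//; last exact: integZ.
    by apply: eq_Rintegral => x _; ring.
  have e2 : \int[P]_x (f (X x) + C) = \int[P]_x f (X x) + C.
    by rewrite RintD//; [rewrite Rint_cst|exact: integ_cst].
  rewrite e1 e2 mulrDr (mulrC C) => h; apply: (addIr ((\int[P]_x W x) * C)); apply: h.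
  - by apply: measurable_funD.
  - move=> y; have /andP[h1 h2] := fC' y; rewrite ger0_norm; lra.
  - by move=> y; have /andP[h1 h2] := fC' y; lra.
pose cell (n j : nat) := (fun y => n.+1%:R * f y) @^-1` `[j%:R, j.+1%:R[%classic.
have mcell n j : measurable (cell n j).
  rewrite /cell -[X in measurable X]setTI.
  have : measurable_fun setT (fun y => n.+1%:R * f y) by exact: measurable_funM.
  by apply => //; exact: measurable_itv.
pose M n := (Num.truncn (n.+1%:R * C)).+1.
pose g n y : R := \sum_(j < M n) (j%:R / n.+1%:R) * \1_(cell n j) y.
have n0 n : (0 : R) < n.+1%:R by rewrite ltr0n.
have gE n y : g n y = (Num.truncn (n.+1%:R * f y))%:R / n.+1%:R.
  have nf : 0 <= n.+1%:R * f y by rewrite mulr_ge0.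
  have tM : (Num.truncn (n.+1%:R * f y) < M n)%N.
    rewrite ltnS truncn_le_nat; apply: le_lt_trans (truncnS_gt _).
    by rewrite ler_wpM2l//; apply: le_trans (fC y); exact: ler_norm.
  rewrite /g (bigD1 (Ordinal tM))//= big1 => [|j jt].
    rewrite addr0 indicE mem_set ?mulr1//= /cell/= in_itv/=.
    exact: truncn_itv.
  rewrite indicE memNset ?mulr0//= /cell/= in_itv/= => jf.
  have := truncn_def jf => tj; move: jt; rewrite -val_eqE/= tj eqxx//.
have gf n y : `|f y - g n y| <= n.+1%:R^-1.
  have nf : 0 <= n.+1%:R * f y by rewrite mulr_ge0.
  have /andP[l1 l2] := truncn_itv nf.
  have -> : f y - g n y = (n.+1%:R * f y - (Num.truncn (n.+1%:R * f y))%:R) / n.+1%:R.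
    by rewrite gE mulrBl mulrAC divff ?mul1r// gt_eqF.
  rewrite normrM [`|_^-1|]gtr0_norm ?invr_gt0// ler_piMl// ?invr_ge0 ?(ltW (n0 n))//.
  rewrite ger0_norm ?subr_ge0// lerBlDl natr1; exact: ltW.
have mg n : measurable_fun setT (g n).
  by apply: measurable_sum => j; apply: measurable_funM => //; exact: measurable_indic.
have D0 : 0 <= D by apply: le_trans (normr_ge0 _) (WD point).
have gb n y : `|g n y| <= C + 1.
  have -> : g n y = f y - (f y - g n y) by ring.
  apply: le_trans (ler_normB _ _) _; apply: lerD => //.
  by apply: le_trans (gf n y) _; rewrite invf_le1// ler1n.
have gcv y : g n y @[n --> \oo] --> f y.
  apply/cvgrPdist_le => e e0; near=> n; apply: le_trans (gf n y) _.
  near: n; have := near_infty_natSinv_lt (PosNum e0).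
  by apply: filterS => n /ltW.
have gi n : \int[P]_x (W x * g n (X x)) = (\int[P]_x W x) * (\int[P]_x g n (X x)).
  have mi j : measurable_fun setT (fun x => \1_(cell n j) (X x) : R).
    by apply: measurableT_comp mX; exact: measurable_indic.
  have i1 j : integ P (fun x => \1_(cell n j) (X x) : R).
    by apply: (@integ_bounded _ _ _ _ _ 1) => // x; rewrite indicE; case: (_ \in _); rewrite ?normr1 ?normr0.
  have iW1 j : integ P (fun x => W x * \1_(cell n j) (X x)).
    apply: (@integ_bounded _ _ _ _ _ D); first exact: measurable_funM.
    move=> x; rewrite normrM indicE; case: (_ \in _); rewrite ?normr1 ?normr0 ?mulr1// mulr0//.
  transitivity (\int[P]_x \sum_(j < M n) (j%:R / n.+1%:R) * (W x * \1_(cell n j) (X x))).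
    by apply: eq_Rintegral => x _; rewrite /g mulr_sumr; apply: eq_bigr => j _; ring.
  rewrite Rint_sum => [|j]; last exact: integZ.
  rewrite [X in _ = _ * X](_ : _ = \sum_(j < M n) (j%:R / n.+1%:R) * \int[P]_x \1_(cell n j) (X x)); last first.
    rewrite Rint_sum => [|j]; last exact: integZ.
    by apply: eq_bigr => j _; rewrite RintZ.
  rewrite mulr_sumr; apply: eq_bigr => j _.
  by rewrite RintZ// indep//; ring.
have mWg n : measurable_fun setT (fun x => W x * g n (X x)).
  by apply: measurable_funM => //; exact: measurableT_comp (mg n) mX.
have Wgb n x : `|W x * g n (X x)| <= D * (C + 1) by rewrite normrM ler_pM.
have Wgc x : W x * g n (X x) @[n --> \oo] --> W x * f (X x) by apply: cvgMr; exact: gcv.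
have mgX n : measurable_fun setT (fun x => g n (X x)) by exact: measurableT_comp (mg n) mX.
have [_ c1] := Rint_dct mWg (integ_cst P (D * (C + 1))) Wgb Wgc.
have [_ c2] := Rint_dct mgX (integ_cst P (C + 1)) (fun n x => gb n (X x)) (fun x => gcv (X x)).
apply: (cvg_unique (@Rhausdorff R) c1).
rewrite (_ : (fun n => _) = (fun n => (\int[P]_x W x) * (\int[P]_x g n (X x)))); last exact/funext.
exact: cvgMr.
Unshelve. all: by end_near. Qed.

End StepApproximation.

Section ComplexExpectation.
Context d (T : measurableType d) (R : realType) (P : probability T R).
Implicit Types (f g W : T -> R[i]).

Definition cexp f : R[i] :=
  Complex (\int[P]_x complex.Re (f x)) (\int[P]_x complex.Im (f x)).

Definition bounded_complex (S : Type) (f : S -> R[i]) :=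
  exists C, forall x, `|complex.Re (f x)| <= C /\ `|complex.Im (f x)| <= C.

Definition measurable_complex d' (S : measurableType d') (f : S -> R[i]) :=
  measurable_fun setT (fun x => complex.Re (f x)) /\
  measurable_fun setT (fun x => complex.Im (f x)).

Lemma bounded_complexM (S : Type) (f g : S -> R[i]) :
  bounded_complex f -> bounded_complex g -> bounded_complex (fun x => f x * g x).
Proof.
move=> [C fC] [D gD]; exists (C * D + C * D) => x.
have [fr fi] := fC x; have [gr gi] := gD x.
rewrite complex_ReM complex_ImM; split.
  by apply: le_trans (ler_normB _ _) _; rewrite !normrM lerD// ler_pM.
by apply: le_trans (ler_normD _ _) _; rewrite !normrM lerD// ler_pM.
Qed.

Lemma measurable_complexM d' (S : measurableType d') (f g : S -> R[i]) :
  measurable_complex f -> measurable_complex g -> measurable_complex (fun x => f x * g x).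
Proof.
move=> [f1 f2] [g1 g2]; split.
  under eq_fun do rewrite complex_ReM.
  by apply: measurable_funB; apply: measurable_funM.
under eq_fun do rewrite complex_ImM.
by apply: measurable_funD; apply: measurable_funM.
Qed.

Lemma bounded_complex_indic (S : Type) (B : set S) :
  bounded_complex (fun y => Complex (\1_B y : R) 0).
Proof.
by exists 1 => x /=; rewrite indicE; case: (_ \in _); rewrite ?normr1 ?normr0.
Qed.

Lemma measurable_complex_indic d' (S : measurableType d') (B : set S) : measurable B ->
  measurable_complex (fun y => Complex (\1_B y : R) 0).
Proof. by move=> mB; split => //=; exact: measurable_indic. Qed.

Lemma bounded_complex_prod (S J : Type) (r : seq J) (f : J -> S -> R[i]) :
  (forall j, bounded_complex (f j)) -> bounded_complex (fun x => \prod_(j <- r) f j x).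
Proof.
move=> bf; elim: r => [|j r IH].
  by exists 1 => x; rewrite big_nil/= normr1 normr0.
have [C H] := bounded_complexM (bf j) IH.
by exists C => x; rewrite big_cons.
Qed.

Lemma measurable_complex_prod d' (S : measurableType d') (J : Type) (r : seq J)
    (f : J -> S -> R[i]) :
  (forall j, measurable_complex (f j)) -> measurable_complex (fun x => \prod_(j <- r) f j x).
Proof.
move=> bf; elim: r => [|j r IH].
  by split; under eq_fun do rewrite big_nil/=; exact: measurable_cst.
have [h1 h2] := measurable_complexM (bf j) IH.
by split; under eq_fun do rewrite big_cons.
Qed.

(** Passes from indicators to bounded functions of one variable; [W] is a general bounded factor, so
    that the lemma can be applied to one variable after another. *)
Lemma cexp_indicM d' (S : measurableType d') (X : T -> S) W :
  measurable_fun setT X -> measurable_complex W -> bounded_complex W ->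
  (forall B, measurable B ->
     cexp (fun x => W x * Complex (\1_B (X x)) 0) =
     cexp W * cexp (fun x => Complex (\1_B (X x)) 0)) ->
  forall g : S -> R[i], measurable_complex g -> bounded_complex g ->
  cexp (fun x => W x * g (X x)) = cexp W * cexp (fun x => g (X x)).
Proof.
move=> mX [mW1 mW2] [D WD] indep g [mg1 mg2] [C gC].
have WD1 x : `|complex.Re (W x)| <= D by case: (WD x).
have WD2 x : `|complex.Im (W x)| <= D by case: (WD x).
have gC1 x : `|complex.Re (g x)| <= C by case: (gC x).
have gC2 x : `|complex.Im (g x)| <= C by case: (gC x).
have I1 B : measurable B -> \int[P]_x (complex.Re (W x) * \1_B (X x)) =
    (\int[P]_x complex.Re (W x)) * \int[P]_x \1_B (X x).
  move=> /indep/(congr1 (@complex.Re R)); rewrite complex_ReM/= Rint_cst mulr0 subr0 => <-.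
  by apply: eq_Rintegral => x _; rewrite complex_ReM/= mulr0 subr0.
have I2 B : measurable B -> \int[P]_x (complex.Im (W x) * \1_B (X x)) =
    (\int[P]_x complex.Im (W x)) * \int[P]_x \1_B (X x).
  move=> /indep/(congr1 (@complex.Im R)); rewrite complex_ImM/= Rint_cst mulr0 add0r => <-.
  by apply: eq_Rintegral => x _; rewrite complex_ImM/= mulr0 add0r.
have step (V : T -> R) (f : S -> R) (E : R) : measurable_fun setT V -> (forall x, `|V x| <= D) ->
    measurable_fun setT f -> (forall y, `|f y| <= E) ->
    integ P (fun x => V x * f (X x)).
  move=> mV VD mf fE; apply: (@integ_bounded _ _ _ _ _ (D * E)).
    by apply: measurable_funM => //; exact: measurableT_comp mf mX.
  by move=> x; rewrite normrM ler_pM.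
have S11 := step_approx_independent mW1 (ex_intro _ D WD1) mX mg1 gC1 I1.
have S12 := step_approx_independent mW1 (ex_intro _ D WD1) mX mg2 gC2 I1.
have S21 := step_approx_independent mW2 (ex_intro _ D WD2) mX mg1 gC1 I2.
have S22 := step_approx_independent mW2 (ex_intro _ D WD2) mX mg2 gC2 I2.
apply/eqP; rewrite eq_complex; apply/andP; split; apply/eqP; rewrite ?complex_ReM ?complex_ImM/=.
  rewrite -S11 -S22 -RintB; [|exact: step mg1 gC1|exact: step mg2 gC2].
  by apply: eq_Rintegral => x _; rewrite complex_ReM.
rewrite -S12 -S21 -RintD; [|exact: step mg2 gC2|exact: step mg1 gC1].
by apply: eq_Rintegral => x _; rewrite complex_ImM.
Qed.

Lemma cexp_indic (A : set T) : measurable A ->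
  cexp (fun x => Complex (\1_A x) 0) = Complex (fine (P A)) 0.
Proof. by move=> mA; rewrite /cexp/= Rint_cst /Rintegral integral_indic// setIT. Qed.

Lemma indic_compE d' (S : measurableType d') (X : T -> S) (B : set S) :
  (fun x => Complex (\1_B (X x) : R) 0) = (fun x => Complex (\1_(X @^-1` B) x) 0).
Proof. by apply/funext => x; rewrite !indicE. Qed.

Lemma measurable_preimage d' (S : measurableType d') (X : T -> S) (B : set S) :
  measurable_fun setT X -> measurable B -> measurable (X @^-1` B).
Proof. by move=> mX mB; rewrite -[X in measurable X]setTI; exact: mX. Qed.

Lemma cexp_independent d1 d2 (T1 : measurableType d1) (T2 : measurableType d2)
    (X : T -> T1) (Y : T -> T2) (f : T1 -> R[i]) (g : T2 -> R[i]) :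
  independent P X Y -> measurable_fun setT X -> measurable_fun setT Y ->
  measurable_complex f -> bounded_complex f -> measurable_complex g -> bounded_complex g ->
  cexp (fun x => f (X x) * g (Y x)) = cexp (fun x => f (X x)) * cexp (fun x => g (Y x)).
Proof.
move=> ind mX mY mf bf mg bg.
have mfX : measurable_complex (fun x => f (X x)).
  by case: mf => m1 m2; split; [exact: measurableT_comp m1 mX|exact: measurableT_comp m2 mX].
have bfX : bounded_complex (fun x => f (X x)) by case: bf => C H; exists C.
apply: (cexp_indicM mY mfX bfX) => // B mB.
have mYB := measurable_preimage mY mB.
rewrite indic_compE [LHS](_ : _ = cexp (fun x => Complex (\1_(Y @^-1` B) x) 0 * f (X x))); last first.
  by congr cexp; apply/funext => x; rewrite mulrC indicE.
rewrite mulrC; apply: cexp_indicM => //.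
- exact: measurable_complex_indic.
- exact: bounded_complex_indic.
move=> A mA; have mXA := measurable_preimage mX mA.
rewrite indic_compE !cexp_indic//.
rewrite [LHS](_ : _ = cexp (fun x => Complex (\1_((X @^-1` A) `&` (Y @^-1` B)) x) 0)); last first.
  congr cexp; apply/funext => x; apply/eqP; rewrite eq_complex complex_ReM complex_ImM/=.
  rewrite !indicE in_setI !mulr0 !mul0r subr0 addr0 eqxx andbT.
  change (X x \in A) with (x \in X @^-1` A).
  by case: (x \in X @^-1` A); case: (x \in Y @^-1` B); rewrite ?mulr1 ?mulr0.
rewrite cexp_indic; last exact: measurableI.
rewrite ind// fineM ?fin_num_measure//.
by apply/eqP; rewrite eq_complex complex_ReM complex_ImM/= !mulr0 !mul0r subr0 addr0 eqxx andbT mulrC.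
Qed.

Lemma cexp_mutually_independent d' (S : measurableType d') (n : nat) (X : 'I_n -> T -> S)
    (g : 'I_n -> S -> R[i]) :
  mutually_independent P X -> (forall i, measurable_fun setT (X i)) ->
  (forall i, measurable_complex (g i)) -> (forall i, bounded_complex (g i)) ->
  cexp (fun x => \prod_(i < n) g i (X i x)) = \prod_(i < n) cexp (fun x => g i (X i x)).
Proof.
move=> ind mX mg bg.
(* Replace indicators by the functions [g i] one index at a time. *)
pose mix m (B : 'I_n -> set S) (i : 'I_n) : S -> R[i] :=
  if (i < m)%N then g i else fun y => Complex (\1_(B i) y) 0.
suff H m B : (m <= n)%N -> (forall i, measurable (B i)) ->
    cexp (fun x => \prod_(i < n) mix m B i (X i x)) = \prod_(i < n) cexp (fun x => mix m B i (X i x)).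
  have := H n (fun=> setT) (leqnn _) (fun=> measurableT).
  rewrite (_ : mix n _ = g)//; apply/funext => i; by rewrite /mix ltn_ord.
have mmix k C i : (forall j, measurable (C j)) -> measurable_complex (mix k C i).
  by move=> mC; rewrite /mix; case: ifP => // _; exact: measurable_complex_indic.
have bmix k C i : bounded_complex (mix k C i).
  by rewrite /mix; case: ifP => // _; exact: bounded_complex_indic.
elim: m B => [|m IH] B mn mB.
  (* For [m = 0] the product of indicators is the indicator of an intersection, where mutual
     independence applies with all indices. *)
  rewrite [LHS](_ : _ = cexp (fun x => Complex (\1_(\bigcap_(i in [set` [set: 'I_n]%SET]) (X i @^-1` B i)) x) 0)); last first.
    congr cexp; apply/funext => x; rewrite indicE.
    have [xB|xB] := boolP (x \in _).
      rewrite big1// => i _; rewrite /mix/= indicE mem_set//.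
      by move/set_mem : xB; apply; rewrite /= inE.
    have [i iB] : exists i, ~ B i (X i x).
      apply/existsNP => H; move/negP : xB; apply; apply/mem_set => i _; exact: H.
    by rewrite (bigD1 i)//= /mix/= indicE memNset// mul0r.
  rewrite cexp_indic; last first.
    by apply: fin_bigcap_measurable => // i _; exact: measurable_preimage.
  rewrite ind//.
  under eq_bigl do rewrite inE.
  under [RHS]eq_bigr => i _.
    rewrite /mix/= indic_compE cexp_indic; last exact: measurable_preimage.
    over.
  rewrite -(rmorph_prod (real_complex R)); congr (Complex _ _).
  rewrite [X in fine X](_ : _ = (\prod_(i < n) fine (P (X i @^-1` B i)))%:E)//.
  rewrite -prodEFin; apply: eq_bigr => i _.
  by rewrite fineK// fin_num_measure//; exact: measurable_preimage.
pose im := Ordinal mn.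
have mixS C i : i != im -> mix m.+1 C i = mix m C i.
  move=> iim; rewrite /mix ltnS leq_eqVlt.
  by rewrite (_ : (i == m :> nat) = false)//; apply/negbTE.
have -> : \prod_(i < n) cexp (fun x => mix m.+1 B i (X i x)) =
   cexp (fun x => \prod_(i < n | i != im) mix m B i (X i x)) * cexp (fun x => g im (X im x)).
  (* The whole space in place [im] turns that factor into 1, which leaves the product over the other
     indices. *)
  have := IH (fun i => if i == im then setT else B i) (ltnW mn).
  have mB' i : measurable (if i == im then setT else B i) by case: ifP.
  move/(_ mB').
  have e1 : cexp (fun x => \prod_(i < n) mix m (fun i => if i == im then setT else B i) i (X i x)) =
     cexp (fun x => \prod_(i < n | i != im) mix m B i (X i x)).
    congr cexp; apply/funext => x; rewrite (bigD1 im)//= {1}/mix ltnn eqxx indicT.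
    rewrite mul1r; apply: eq_bigr => i /negbTE iim; by rewrite /mix iim.
  rewrite e1 => ->; rewrite (bigD1 im)//= mulrC [in RHS](bigD1 im)//=.
  rewrite [X in _ = X * _ * _](_ : _ = 1) ?mul1r.
    congr (_ * _); last by rewrite /mix ltnSn.
    apply: eq_bigr => i iim; rewrite mixS// /mix; by move/negbTE : iim => ->.
  rewrite /mix ltnn eqxx /cexp/= indicT/= !Rint_cst//.
have {1}-> : (fun x => \prod_(i < n) mix m.+1 B i (X i x)) =
   (fun x => \prod_(i < n | i != im) mix m B i (X i x) * g im (X im x)).
  apply/funext => x; rewrite (bigD1 im)//= mulrC {2}/mix ltnSn; congr (_ * _).
  by apply: eq_bigr => i iim; rewrite mixS.
have prodE (x : T) : \prod_(i < n | i != im) mix m B i (X i x) =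
  \prod_(i <- [seq i <- index_enum 'I_n | i != im]) mix m B i (X i x) by rewrite big_filter.
apply: (cexp_indicM (X := X im)) => //.
- under [X in measurable_complex X]eq_fun do rewrite prodE.
  apply: measurable_complex_prod => i; have [m1 m2] := mmix m B i mB; split.
    exact: measurableT_comp m1 (mX i).
  exact: measurableT_comp m2 (mX i).
- under [X in bounded_complex X]eq_fun do rewrite prodE.
  by apply: bounded_complex_prod => i; have [C H] := bmix m B i; exists C.
move=> A mA.
(* Factorization against the indicator of [A] is the induction hypothesis with [A] in place [im];
   with the whole space there, as [B1], it evaluates the remaining product. *)
pose B' i := if i == im then A else B i.
have mB' i : measurable (B' i) by rewrite /B'; case: ifP.
have e i : i != im -> mix m B' i = mix m B i by rewrite /mix /B' => /negbTE ->.
have e' : mix m B' im = (fun y => Complex (\1_A y) 0) by rewrite /mix /B' ltnn eqxx.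
have := IH B' (ltnW mn) mB'; rewrite (bigD1 im)//= e'.
have -> : (fun x => \prod_(i < n) mix m B' i (X i x)) =
   (fun x => (\prod_(i < n | i != im) mix m B i (X i x)) * Complex (\1_A (X im x)) 0).
  apply/funext => x; rewrite (bigD1 im)//= e' mulrC; congr (_ * _).
  by apply: eq_bigr => i iim; rewrite e.
move=> ->; rewrite mulrC; congr (_ * _).
pose B1 i := if i == im then setT else B i.
have mB1 i : measurable (B1 i) by rewrite /B1; case: ifP.
have e1 i : i != im -> mix m B1 i = mix m B i by rewrite /mix /B1 => /negbTE ->.
have e1' : mix m B1 im = (fun y => Complex 1 0).
  by rewrite /mix /B1 ltnn eqxx indicT.
have := IH B1 (ltnW mn) mB1; rewrite [X in _ = X](bigD1 im)//= e1' {2}/cexp/= !Rint_cst.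
rewrite mul1r.
rewrite (_ : (fun x => \prod_(i < n) mix m B1 i (X i x)) =
   (fun x => (\prod_(i < n | i != im) mix m B i (X i x)))); last first.
  apply/funext => x; rewrite (bigD1 im)//= e1' mul1r.
  by apply: eq_bigr => i iim; rewrite e1.
move=> ->.
apply: eq_bigr => i iim; by rewrite e// e1.
Qed.

End ComplexExpectation.

(** * The functional equation *)

Section ComplexSize.
Variable R : realType.
Implicit Types z w : R[i].

(** The 1-norm of the plane: real-valued, subadditive and submultiplicative, without square
    roots. *)
Definition taxi z : R := `|complex.Re z| + `|complex.Im z|.

Lemma taxi_ge0 z : 0 <= taxi z.
Proof. exact: addr_ge0. Qed.

Lemma taxi0 : taxi 0 = 0.
Proof. by rewrite /taxi/= normr0 addr0. Qed.

Lemma taxiD z w : taxi (z + w) <= taxi z + taxi w.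
Proof.
rewrite /taxi complex_ReD complex_ImD addrACA; apply: lerD; exact: ler_normD.
Qed.

Lemma taxiM z w : taxi (z * w) <= taxi z * taxi w.
Proof.
rewrite /taxi complex_ReM complex_ImM.
have := ler_normB (complex.Re z * complex.Re w) (complex.Im z * complex.Im w).
have := ler_normD (complex.Re z * complex.Im w) (complex.Im z * complex.Re w).
rewrite !normrM; lra.
Qed.

Lemma taxiZ (h : R) z : taxi (h%:C * z)%C = `|h| * taxi z.
Proof. by rewrite /taxi complex_ReM complex_ImM/= !mul0r subr0 addr0 !normrM mulrDr. Qed.

End ComplexSize.

Section IteratedDifferences.
Variables (R : realType) (V : zmodType).
Implicit Types (H : V -> R) (x e : V) (es : seq V).

(** A mixed difference with its own step for each order, since different summands are killed by
    different steps. *)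
Fixpoint diffs es H x : R :=
  if es is e :: es' then diffs es' H (x + e) - diffs es' H x else H x.

Lemma diffs_local (N : V -> R) (rho : R) es H H' x :
  (forall x y, N (x + y) <= N x + N y) -> (forall x, 0 <= N x) ->
  (forall x, N x <= rho -> H x = H' x) ->
  N x + \sum_(e <- es) N e <= rho -> diffs es H x = diffs es H' x.
Proof.
move=> ND N0 HH; elim: es x => [|e es IH] x; first by rewrite big_nil addr0 => /HH.
rewrite big_cons/= => le; rewrite !IH//.
  by apply: le_trans le; rewrite lerD2l lerDr.
by apply: le_trans le; rewrite addrA lerD2r.
Qed.

Lemma diffsD es H H' x : diffs es (fun y => H y + H' y) x = diffs es H x + diffs es H' x.
Proof. by elim: es x => [//|e es IH] x /=; rewrite !IH; ring. Qed.

Lemma diffsN es H x : diffs es (fun y => - H y) x = - diffs es H x.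
Proof. by elim: es x => [//|e es IH] x /=; rewrite !IH; ring. Qed.

Lemma diffs0 es x : diffs es (fun=> 0) x = 0.
Proof. by elim: es x => [//|e es IH] x /=; rewrite !IH subrr. Qed.

Lemma diffs_sum (I : Type) (r : seq I) (Q : pred I) (H : I -> V -> R) es x :
  diffs es (fun y => \sum_(i <- r | Q i) H i y) x = \sum_(i <- r | Q i) diffs es (H i) x.
Proof.
elim: r => [|i r IH]; first by rewrite big_nil -[RHS](diffs0 es x); congr diffs; apply/funext => y; rewrite big_nil.
rewrite big_cons -IH; case: ifP => Qi.
  by rewrite -diffsD; congr diffs; apply/funext => y; rewrite big_cons Qi.
by congr diffs; apply/funext => y; rewrite big_cons Qi.
Qed.

Lemma diffs_invariant e es H : (forall x, H (x + e) = H x) ->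
  forall x, diffs es H (x + e) = diffs es H x.
Proof. by move=> He; elim: es => [//|e' es IH] x /=; rewrite addrAC !IH. Qed.

Lemma diffs_invariant_eq0 e es H x : (forall x, H (x + e) = H x) -> e \in es -> diffs es H x = 0.
Proof.
move=> He; elim: es x => [//|e' es IH] x; rewrite inE => /predU1P[<-|ees] /=.
  by rewrite diffs_invariant// subrr.
by rewrite !IH// subrr.
Qed.

(** Read [l x t] as: [x] lies on level [t]. All steps raise the level by the same [h], so a function
    of the level cannot tell them apart. *)
Lemma diffs_line (f : R -> R) (l : V -> R -> Prop) es H h :
  (forall x t, l x t -> H x = f t) ->
  (forall x t e, e \in es -> l x t -> l (x + e) (t + h)) ->
  forall x t, l x t -> diffs es H x = iter (size es) (fdiff h) f t.
Proof.
move=> Hf; elim: es => [|e es IH] le x t lx; first exact: Hf.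
have le' y s e' : e' \in es -> l y s -> l (y + e') (s + h).
  by move=> e'es; apply: le; rewrite inE e'es orbT.
by rewrite iter_fdiffS /= -(IH le' _ _ lx) (IH le' _ (t + h))//; apply: le => //; rewrite inE eqxx.
Qed.

End IteratedDifferences.

Section FunctionalEquation.
Variables (R : realType) (n : nat) (alpha beta : 'I_n -> R[i]) (psi : 'I_n -> R[i] -> R)
  (rho : R).
Hypotheses (rho0 : 0 < rho)
  (psi_eq : forall u v : R[i], taxi u + taxi v <= rho ->
    \sum_k psi k (u * alpha k + v * beta k) =
    \sum_k psi k (u * alpha k) + \sum_k psi k (v * beta k)).

(** The first conjunct discards indices with both coefficients 0, which satisfy the second one
    trivially. *)
Definition proportional k0 k := (alpha k != 0) && (beta k == beta k0 / alpha k0 * alpha k).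

Lemma functional_equation_poly k0 (om : R[i]) : alpha k0 * beta k0 != 0 ->
  (exists2 d : R, 0 < d & forall k t, `|t| <= d ->
     {for t, continuous (fun t : R => psi k (t%:C%C * om * alpha k))}) ->
  exists2 d : R, 0 < d & exists p : {poly R}, forall t, `|t| <= d ->
    \sum_(k | proportional k0 k) psi k (t%:C%C * om * alpha k) = p.[t].
Proof.
rewrite mulf_eq0 negb_or => /andP[a0 b0] [d1 d10 psic].
pose r0 := beta k0 / alpha k0.
have r00 : r0 != 0 by rewrite mulf_neq0// invr_neq0.
(* [dir k] leaves the argument [u alpha_k + v beta_k] unchanged and moves
   [u + r0 v] by [om]. *)
pose dir k : R[i] * R[i] := if beta k == r0 * alpha k then (om, 0) else
  (- beta k / (r0 * alpha k - beta k) * om, alpha k / (r0 * alpha k - beta k) * om).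
(* The first step fixes every [u alpha_k] and the second every [v beta_k], which kills the
   right-hand side of [psi_eq]; both also raise [u + r0 v] by [om]. *)
pose es1 : seq (R[i] * R[i]) := (0, om / r0) :: (om, 0) :: [seq dir k | k <- enum 'I_n].
pose scale (h : R) (e : R[i] * R[i]) := (h%:C%C * e.1, h%:C%C * e.2).
pose N (e : R[i] * R[i]) := taxi e.1 + taxi e.2.
have ND (x y : R[i] * R[i]) : N (x + y) <= N x + N y.
  by rewrite /N [leRHS]addrACA; exact: (lerD (taxiD x.1 y.1) (taxiD x.2 y.2)).
have N0 x : 0 <= N x by apply: addr_ge0; exact: taxi_ge0.
have NZ h e : N (scale h e) = `|h| * N e by rewrite mulrDr -!taxiZ.
pose c := N (om, 0) + \sum_(e <- es1) N e.
have c0 : 0 <= c by apply: addr_ge0 => //; apply: sumr_ge0.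
pose f t := \sum_(k | proportional k0 k) psi k (t%:C%C * om * alpha k).
(* With [|t| <= d] and [h <= 2 d] every sampled point has size at most [2 d c <= rho]; [c + 1]
   guards against [c = 0]. *)
pose d := Num.min d1 (rho / (2 * (c + 1))).
have d0 : 0 < d by rewrite lt_min d10 divr_gt0// mulr_gt0//; lra.
exists d => //; apply: (@frechet _ f (size es1) d) => //.
  move=> t td; apply: cvg_big => [|k _].
    by move=> [x y]; exact: add_continuous.
  by apply: psic; apply: le_trans td _; rewrite ge_min lexx.
move=> t h td h0 thd.
pose es := map (scale h) es1.
have ess : size es = size es1 by rewrite size_map.
pose ell (x : R[i] * R[i]) := x.1 + r0 * x.2.
pose l (x : R[i] * R[i]) (t : R) := ell x = t%:C%C * om.
pose H x := \sum_(k | proportional k0 k) psi k (x.1 * alpha k + x.2 * beta k).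
have Hf x s : l x s -> H x = f s.
  move=> lx; apply: eq_bigr => k /andP[_ /eqP bk]; congr psi.
  by rewrite bk -lx /ell -/r0; ring.
have le x s e : e \in es -> l x s -> l (x + e) (s + h).
  move=> /mapP[e' e'in ->]; rewrite /l => lx.
  have ell1 : ell e' = om.
    move: e'in; rewrite !inE => /or3P[/eqP->|/eqP->|/mapP[k _ ->]]; rewrite /ell/=.
    - by rewrite add0r mulrC divfK.
    - by rewrite mulr0 addr0.
    rewrite /dir; case: eqVneq => [_|bk]/=; first by rewrite mulr0 addr0.
    have bk' : r0 * alpha k - beta k != 0 by rewrite subr_eq0 eq_sym.
    by field.
  rewrite rmorphD mulrDl -lx -ell1 /ell/=; ring.
rewrite -ess -(diffs_line Hf le (x := (t%:C%C * om, 0))); last by rewrite /l /ell/= mulr0 addr0.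
(* By the functional equation the class sum equals, on the ball of radius [rho], a combination of
   terms each invariant under one of the steps. *)
pose H' x := (\sum_k psi k (x.1 * alpha k) + \sum_k psi k (x.2 * beta k)) -
  \sum_(k | ~~ proportional k0 k) psi k (x.1 * alpha k + x.2 * beta k).
rewrite (@diffs_local _ _ N rho es H H') //.
- rewrite diffsD diffsN diffsD !diffs_sum !big1 ?addr0 ?subr0//.
  + move=> k nk; apply: (@diffs_invariant_eq0 _ _ (scale h (dir k))); last first.
      by apply: map_f; rewrite !inE map_f ?orbT// mem_enum.
    move=> x; congr psi; rewrite /dir; case: eqVneq => [bk|bk]/=.
      have ak : alpha k = 0.
        by apply/eqP; move: nk; rewrite /proportional -/r0 -bk eqxx andbT negbK.
      by rewrite bk ak !mulr0.
    have bk' : r0 * alpha k - beta k != 0 by rewrite subr_eq0 eq_sym.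
    by field.
  + move=> k _; apply: (@diffs_invariant_eq0 _ _ (scale h (om, 0))); last first.
      by apply: map_f; rewrite !inE eqxx ?orbT.
    by move=> x /=; rewrite mulr0 addr0.
  + move=> k _; apply: (@diffs_invariant_eq0 _ _ (scale h (0, om / r0))); last first.
      by apply: map_f; rewrite !inE eqxx.
    by move=> x /=; rewrite mulr0 addr0.
- by move=> x Nx; rewrite /H' -psi_eq// /H [in RHS](bigID (proportional k0))/= addrK.
rewrite big_map; under eq_bigr do rewrite NZ.
rewrite -mulr_sumr (ger0_norm h0).
have -> : N (t%:C%C * om, 0) = `|t| * N (om, 0) by rewrite -NZ /scale/= mulr0.
have hd : h <= 2 * d.
  have m1 : h <= (size es1)%:R * h.
    by rewrite ler_peMl// ler1n.
  by apply: le_trans m1 _; move: td thd; rewrite !ler_norml => /andP[? ?] /andP[? ?]; lra.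
have t2 : `|t| <= 2 * d by lra.
apply: (@le_trans _ _ (2 * d * c)).
  by rewrite [leRHS]mulrDr; apply: lerD; apply: ler_wpM2r => //; apply: sumr_ge0.
have : d <= rho / (2 * (c + 1)) by rewrite /d ge_min lexx orbT.
rewrite ler_pdivlMr; last by lra.
by nra.
Qed.

End FunctionalEquation.

(** * Characteristic functions of complex variables *)

Section CharacteristicFunction.
Context d (T : measurableType d) (R : realType) (P : probability T R).
Implicit Types (s : T -> R[i]) (w : R[i]).

Definition charf s w := cexp P (fun x => cis (complex.Re (w * s x))).

Lemma measurable_real_vector s : complex_random_variable s ->
  measurable_fun setT (real_vector s).
Proof. by move=> [m1 m2]; exact: measurable_fun_pair. Qed.

Lemma measurable_linear_form s w : complex_random_variable s ->
  measurable_fun setT (fun x => complex.Re (w * s x)).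
Proof.
move=> [m1 m2]; under eq_fun do rewrite complex_ReM.
by apply: measurable_funB; apply: measurable_funM.
Qed.

Definition phase w (y : R * R) : R[i] :=
  cis (complex.Re w * y.1 - complex.Im w * y.2).

Lemma phaseE s w x : phase w (real_vector s x) = cis (complex.Re (w * s x)).
Proof. by rewrite complex_ReM. Qed.

Lemma measurable_cis d' (S : measurableType d') (f : S -> R) : measurable_fun setT f ->
  measurable_complex (fun x => cis (f x)).
Proof.
move=> mf; split => /=; apply: (measurable_comp_cont _ mf); [exact: continuous_cos|exact: continuous_sin].
Qed.

Lemma bounded_cis (S : Type) (f : S -> R) : bounded_complex (fun x => cis (f x)).
Proof. by exists 1 => x /=; rewrite !ler_norml cos_geN1 cos_le1 sin_geN1 sin_le1. Qed.

Lemma measurable_phase w : measurable_complex (phase w).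
Proof.
by apply: measurable_cis; apply: measurable_funB; apply: measurable_funM.
Qed.

Lemma charf_sum n (s : 'I_n -> T -> R[i]) (Q : pred 'I_n) (w : 'I_n -> R[i]) :
  (forall k, complex_random_variable (s k)) ->
  mutually_independent P (fun k => real_vector (s k)) ->
  cexp P (fun x => cis (\sum_(k | Q k) complex.Re (w k * s k x))) =
  \prod_(k | Q k) charf (s k) (w k).
Proof.
move=> ms ind; pose g k := if Q k then phase (w k) else fun=> 1.
have := @cexp_mutually_independent _ _ _ P _ _ _ _ g ind (fun k => measurable_real_vector (ms k)).
have mg k : measurable_complex (g k).
  rewrite /g; case: ifP => _; first exact: measurable_phase.
  by split; exact: measurable_cst.
have bg k : bounded_complex (g k).
  rewrite /g; case: ifP => // _; first exact: bounded_cis.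
  by exists 1 => x /=; rewrite normr1 normr0.
move=> /(_ mg bg) e.
rewrite big_mkcond [RHS](_ : _ = \prod_k cexp P (fun x => g k (real_vector (s k) x))).
  rewrite -e; congr cexp; apply/funext => x; rewrite cis_sum big_mkcond.
  by apply: eq_bigr => k _; rewrite /g; case: ifP => // _; rewrite phaseE.
apply: eq_bigr => k _; rewrite /g; case: ifP => _.
  by congr cexp; apply/funext => x; rewrite phaseE.
by rewrite /cexp/= !Rint_cst.
Qed.

(** Where [Y <= a] and [w] is small the cosine is at least 1/2, elsewhere at least -1. Hence it
    dominates [3/2 b - 1], whose integral is positive because 7/8 exceeds 2/3. *)
Lemma charf_pos s : complex_random_variable s ->
  exists2 r : R, 0 < r & forall w, taxi w <= r -> 0 < normsq (charf s w).
Proof.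
move=> ms; have [mr mi] := ms; pose Y x := taxi (s x).
have mY : measurable_fun setT Y by apply: measurable_funD; exact: measurable_abs.
have h78 : 7 / 8 < 1 :> R by lra.
have [a [b [a0 mb b01 bY bh]]] := tight P mY h78.
have /cvgrPdist_le /(_ (1 / 2)) := @continuous_cos R 0.
rewrite divr_gt0// => /(_ isT) /nbhs_ballP [c /= c0 bc].
exists (c / 2 / (a + 1)) => [|w wr]; first by rewrite !divr_gt0//; lra.
suff c1 : 0 < complex.Re (charf s w).
  by rewrite /normsq ltr_pwDl ?exprn_gt0// sqr_ge0.
have ib : integ P b.
  by apply: (@integ_bounded _ _ _ _ _ 1) => // x; have /andP[? ?] := b01 x; rewrite ger0_norm.
have ic : integ P (fun x => cos (complex.Re (w * s x))).
  have := integ_cos P 1 (measurable_linear_form w ms).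
  by under eq_fun do rewrite mul1r.
have i1 := integB (integZ (3 / 2) ib) (integ_cst P 1).
apply: (@lt_le_trans _ _ (\int[P]_x (3 / 2 * b x - 1))).
  rewrite RintB; [|exact: integZ|exact: integ_cst].
  rewrite RintZ// Rint_cst; lra.
apply: Rint_le => // x; have /andP[b0 b1] := b01 x.
case: (bY x) => [->|Ya]; first by rewrite mulr0 sub0r cos_geN1.
have h : `|complex.Re (w * s x)| < c.
  apply: (@le_lt_trans _ _ (taxi w * taxi (s x))).
    by apply: le_trans (taxiM _ _); rewrite lerDl.
  apply: (@le_lt_trans _ _ (c / 2 / (a + 1) * a)).
    apply: ler_pM => //; first exact: taxi_ge0. exact: taxi_ge0.
    by apply: le_trans Ya; rewrite ler_norm.
  by rewrite mulrAC ltr_pdivrMr; [nra|lra].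
have := bc (complex.Re (w * s x)); rewrite /ball/= sub0r normrN cos0 => /(_ h).
rewrite ler_norml => /andP[_]; lra.
Qed.

Lemma charf_line s w t : complex_random_variable s -> charf s (t%:C%C * w) =
  Complex (\int[P]_x cos (t * complex.Re (w * s x))) (\int[P]_x sin (t * complex.Re (w * s x))).
Proof.
move=> ms; rewrite /charf /cexp; congr Complex; apply: eq_Rintegral => x _ /=;
by rewrite -mulrA complex_ReM/= mul0r subr0.
Qed.

Lemma continuous_Rint_cos X : measurable_fun setT X ->
  continuous (fun t : R => \int[P]_x cos (t * X x)).
Proof.
move=> mX t; apply/(@cvg_nbhsP R R^o) => u ut.
have [] := @Rint_dct _ _ _ P (fun n x => cos (u n * X x)) (fun x => cos (t * X x)) (fun=> 1) => //.
- by move=> n; exact: measurable_cosM.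
- exact: integ_cst.
- by move=> n x; rewrite ler_norml cos_geN1 cos_le1.
move=> x; apply: (@continuous_cvg _ _ _ \oo _ (fun n => u n * X x) cos); first exact: continuous_cos.
exact: cvgMl.
Qed.

Lemma continuous_Rint_sin X : measurable_fun setT X ->
  continuous (fun t : R => \int[P]_x sin (t * X x)).
Proof.
move=> mX t; apply/(@cvg_nbhsP R R^o) => u ut.
have [] := @Rint_dct _ _ _ P (fun n x => sin (u n * X x)) (fun x => sin (t * X x)) (fun=> 1) => //.
- by move=> n; exact: measurable_sinM.
- exact: integ_cst.
- by move=> n x; rewrite ler_norml sin_geN1 sin_le1.
move=> x; apply: (@continuous_cvg _ _ _ \oo _ (fun n => u n * X x) sin); first exact: continuous_sin.
exact: cvgMl.
Qed.

Lemma continuous_normsq_charf s w : complex_random_variable s ->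
  continuous (fun t : R => normsq (charf s (t%:C%C * w))).
Proof.
move=> ms; have mX := measurable_linear_form w ms.
pose C t := \int[P]_x cos (t * complex.Re (w * s x)).
pose S t := \int[P]_x sin (t * complex.Re (w * s x)).
rewrite (_ : (fun t => _) = (fun t => C t * C t + S t * S t)); last first.
  by apply/funext => t; rewrite charf_line.
have cC : continuous C := continuous_Rint_cos mX.
have cS : continuous S := continuous_Rint_sin mX.
by move=> t; exact: (cvgD (cvgM (cC t) (cC t)) (cvgM (cS t) (cS t))).
Qed.

End CharacteristicFunction.

Lemma ln_prod (R : realType) (I : Type) (r : seq I) (Q : pred I) (F : I -> R) :
  (forall i, Q i -> 0 < F i) -> ln (\prod_(i <- r | Q i) F i) = \sum_(i <- r | Q i) ln (F i).
Proof.
move=> F0; apply: expR_inj; rewrite expR_sum lnK ?posrE ?prodr_gt0//.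
by apply: eq_bigr => i /F0 Fi; rewrite lnK.
Qed.

(** * The Darmois-Skitovich argument *)

Section DarmoisSkitovich.
Context d (T : measurableType d) (R : realType) (P : probability T R) (n : nat)
  (s : 'I_n -> T -> R[i]) (alpha beta : 'I_n -> R[i]).
Hypotheses (ms : forall k, complex_random_variable (s k))
  (ind : mutually_independent P (fun k => real_vector (s k)))
  (indL : independent P
    (real_vector (fun t => \sum_(k < n) alpha k * s k t))
    (real_vector (fun t => \sum_(k < n) beta k * s k t))).

Let q k w := normsq (charf P (s k) w).

Lemma linear_form_sum (a : 'I_n -> R[i]) u x :
  complex.Re (u * \sum_(k < n) a k * s k x) = \sum_(k < n) complex.Re (u * a k * s k x).
Proof. by rewrite mulr_sumr Re_sum; apply: eq_bigr => k _; rewrite mulrA. Qed.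

Lemma linear_form_random (a : 'I_n -> R[i]) :
  complex_random_variable (fun x => \sum_(k < n) a k * s k x).
Proof.
split.
  rewrite (_ : (fun x => _) = (fun x => \sum_(k < n) complex.Re (a k * s k x))).
    by apply: measurable_sum => k; exact: measurable_linear_form.
  by apply/funext => x; rewrite Re_sum.
(* The imaginary part is again a real form of this kind: [Im z = Re (- i z)]. *)
rewrite (_ : (fun x => _) = (fun x => \sum_(k < n) complex.Re ('i%C * - a k * s k x))).
  by apply: measurable_sum => k; exact: measurable_linear_form.
apply/funext => x; rewrite Im_sum; apply: eq_bigr => k _.
by rewrite -mulrA mulNr; case: (a k * s k x) => zr zi /=; ring.
Qed.

Lemma normsq_charf_prod u v : \prod_k q k (u * alpha k + v * beta k) =
  (\prod_k q k (u * alpha k)) * \prod_k q k (v * beta k).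
Proof.
rewrite -!normsq_prod -normsqM; congr normsq; rewrite -!(charf_sum _ _ ms ind).
have := cexp_independent indL (measurable_real_vector (linear_form_random alpha))
  (measurable_real_vector (linear_form_random beta)) (measurable_phase u) (bounded_cis _)
  (measurable_phase v) (bounded_cis _).
set c1 := cexp P _; set c2 := cexp P _; set c3 := cexp P _ => e.
rewrite (_ : cexp P _ = c1).
  rewrite e; congr (_ * _); congr cexp; apply/funext => x; rewrite phaseE linear_form_sum//.
congr cexp; apply/funext => x; rewrite !phaseE -cisD; congr cis.
rewrite !linear_form_sum -big_split/=; apply: eq_bigr => k _.
by rewrite -complex_ReD mulrDl.
Qed.

Lemma normsq_charf_pos : exists2 r : R, 0 < r & forall k w, taxi w <= r -> 0 < q k w.
Proof.
have h k : exists r : R, 0 < r /\ forall w, taxi w <= r -> 0 < q k w.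
  by have [r r0 H] := charf_pos P (ms k); exists r.
have [r rP] := choice h; exists (\big[Num.min/1]_k r k).
  by apply: lt_bigmin => // k _; have [] := rP k.
move=> k w wr; have [_] := rP k; apply; apply: le_trans wr _; exact: bigmin_le.
Qed.

Lemma normsq_charf_exp_poly k0 om : alpha k0 * beta k0 != 0 ->
  exists2 dl : R, 0 < dl & exists p : {poly R}, forall t, `|t| <= dl ->
    \prod_(k | proportional alpha beta k0 k) q k (t%:C%C * om * alpha k) = expR (- p.[t]).
Proof.
move=> ab0; have [r r0 qr] := normsq_charf_pos.
(* [C] bounds all coefficients, so that [taxi u + taxi v <= r / C] keeps every argument in the ball
   where [q] is positive and has a logarithm. *)
pose C := \sum_k (taxi (alpha k) + taxi (beta k)) + 1.
have C0 : 0 < C.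
  by rewrite ltr_wpDl// sumr_ge0// => k _; rewrite addr_ge0// taxi_ge0.
have aC k : taxi (alpha k) + taxi (beta k) <= C.
  rewrite /C (bigD1 k)//= -[leRHS]addrA lerDl addr_ge0// sumr_ge0// => j _.
  by rewrite addr_ge0// taxi_ge0.
have aC1 k : taxi (alpha k) <= C by apply: le_trans (aC k); rewrite lerDl taxi_ge0.
have bC1 k : taxi (beta k) <= C by apply: le_trans (aC k); rewrite lerDr taxi_ge0.
have small u v : taxi u + taxi v <= r / C -> forall k, taxi (u * alpha k + v * beta k) <= r.
  move=> uv k; apply: le_trans (taxiD _ _) _.
  apply: (@le_trans _ _ ((taxi u + taxi v) * C)).
    by rewrite mulrDl lerD//; apply: le_trans (taxiM _ _) _; apply: ler_wpM2l => //; exact: taxi_ge0.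
  by rewrite -ler_pdivlMr.
have smalla u : taxi u <= r / C -> forall k, taxi (u * alpha k) <= r.
  by move=> uC k; have := small u 0; rewrite taxi0 addr0 => /(_ uC k); rewrite mul0r addr0.
have smallb v : taxi v <= r / C -> forall k, taxi (v * beta k) <= r.
  by move=> uC k; have := small 0 v; rewrite taxi0 add0r => /(_ uC k); rewrite mul0r add0r.
pose psi k w := - ln (q k w).
have psi_eq u v : taxi u + taxi v <= r / C ->
    \sum_k psi k (u * alpha k + v * beta k) =
    \sum_k psi k (u * alpha k) + \sum_k psi k (v * beta k).
  move=> uv.
  have uC : taxi u <= r / C by apply: le_trans uv; rewrite lerDl taxi_ge0.
  have vC : taxi v <= r / C by apply: le_trans uv; rewrite lerDr taxi_ge0.
  rewrite !sumrN -opprD -!ln_prod; try by move=> k _; apply: qr; auto.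
  rewrite normsq_charf_prod lnM ?posrE ?prodr_gt0// => k _; apply: qr; auto.
have rC : 0 < r / C by rewrite divr_gt0.
pose d1 := r / C / (taxi om + 1).
have om1 : 0 < taxi om + 1 by have := taxi_ge0 om; lra.
have d10 : 0 < d1 by rewrite divr_gt0.
have tom t : `|t| <= d1 -> taxi (t%:C%C * om) <= r / C.
  rewrite /d1 ler_pdivlMr// taxiZ => h; apply: le_trans h.
  by rewrite ler_wpM2l// lerDl.
have psic : exists2 dl : R, 0 < dl & forall k t, `|t| <= dl ->
     {for t, continuous (fun t : R => psi k (t%:C%C * om * alpha k))}.
  exists d1 => // k t td; apply: cvgN.
  have cq : {for t, continuous (fun t : R => q k (t%:C%C * om * alpha k))}.
    have := @continuous_normsq_charf _ _ _ P (s k) (om * alpha k) (ms k) t.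
    by under eq_fun do rewrite mulrA.
  apply: (@continuous_comp _ _ _ (fun t : R => q k (t%:C%C * om * alpha k)) (@ln R)) => //.
  by apply: continuous_ln; apply: qr; apply: smalla; exact: tom.
have [dl dl0 [p pE]] := functional_equation_poly rC psi_eq ab0 psic.
exists (Num.min dl d1); first by rewrite lt_min dl0.
exists p => t; rewrite le_min => /andP[tdl td1].
rewrite -pE// -sumrN expR_sum; apply: eq_bigr => k _.
by rewrite opprK lnK ?posrE//; apply: qr; apply: smalla; exact: tom.
Qed.

Lemma normal_linear_form k0 om : alpha k0 * beta k0 != 0 ->
  normal_variable P (fun x => complex.Re (om * alpha k0 * s k0 x)).
Proof.
move=> ab0; have [dl dl0 [p qp]] := normsq_charf_exp_poly om ab0.
pose G := proportional alpha beta k0.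
have Gk0 : G k0.
  move: ab0; rewrite mulf_eq0 negb_or /G /proportional => /andP[a0 _].
  by rewrite a0 divfK//=.
pose L k x := complex.Re (om * alpha k * s k x).
have mL k : measurable_fun setT (L k) by exact: measurable_linear_form.
(* The polynomial is known only for the whole class of [k0], so [L k0] is treated as a summand of
   [U] with remainder [Y]. *)
pose U x := \sum_(k | G k) L k x.
pose Y x := \sum_(k | G k && (k != k0)) L k x.
have mS (Q : pred 'I_n) : measurable_fun setT (fun x => \sum_(k | Q k) L k x).
  under eq_fun do rewrite big_mkcond/=.
  by apply: measurable_sum => k; case: (Q k) => //; exact: mL.
have mU : measurable_fun setT U := mS _.
have mY : measurable_fun setT Y := mS _.
have mU' : measurable_fun setT (fun x => - U x) by exact: measurableT_comp.
pose phi (V : T -> R) t := cexp P (fun x => cis (t * V x)).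
have phiE (Q : pred 'I_n) t : phi (fun x => \sum_(k | Q k) L k x) t =
    \prod_(k | Q k) charf P (s k) (t%:C%C * om * alpha k).
  rewrite -(charf_sum _ _ ms ind); congr cexp; apply/funext => x; congr cis.
  rewrite mulr_sumr; apply: eq_bigr => k _.
  by rewrite -!mulrA [RHS]complex_ReM/= mul0r subr0 /L -!mulrA.
have phiX t : phi (L k0) t = charf P (s k0) (t%:C%C * om * alpha k0).
  congr cexp; apply/funext => x; congr cis.
  by rewrite -!mulrA [RHS]complex_ReM/= mul0r subr0 /L -!mulrA.
have phiXY t : phi (L k0) t * phi Y t = phi U t.
  by rewrite phiX !phiE [RHS](bigD1 k0).
have phiU t : `|t| <= dl -> normsq (phi U t) = expR (- p.[t]).
  by move=> tdl; rewrite phiE normsq_prod -qp.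
have [eX [b1 [b2 [b20 mgf]]]] : exp_integrable P (L k0) /\ exists b1 b2 : R, 0 <= b2 /\
    forall x, psum (moment P (L k0)) x = expR (b1 * x + b2 * x ^+ 2).
  have cU t : \int[P]_x cos (t * - U x) = complex.Re (phi U t).
    by apply: eq_Rintegral => x _; rewrite mulrN cosN.
  have sU t : \int[P]_x sin (t * - U x) = - complex.Im (phi U t).
    rewrite -Rint_sinN//; apply: eq_Rintegral => x _; by rewrite mulrN mulNr.
  have cX t : \int[P]_x cos (t * L k0 x) = complex.Re (phi (L k0) t) by [].
  have sX t : \int[P]_x sin (t * L k0 x) = complex.Im (phi (L k0) t) by [].
  have cY t : \int[P]_x cos (t * Y x) = complex.Re (phi Y t) by [].
  have sY t : \int[P]_x sin (t * Y x) = complex.Im (phi Y t) by [].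
  have RU t : complex.Re (phi U t) = complex.Re (phi (L k0) t) * complex.Re (phi Y t) -
     complex.Im (phi (L k0) t) * complex.Im (phi Y t) by rewrite -phiXY complex_ReM.
  have IU t : complex.Im (phi U t) = complex.Re (phi (L k0) t) * complex.Im (phi Y t) +
     complex.Im (phi (L k0) t) * complex.Re (phi Y t) by rewrite -phiXY complex_ImM.
  (* The second factor is [Y - U'] with [U'] an independent copy of [U], so that the
     product of the characteristic functions is the squared modulus of that of [U]. *)
  apply: (@cramer_moment _ _ _ _ R P (P \x P)%E (L k0) (sum_pair Y (fun x => - U x)) p dl) => //.
  - exact: measurable_sum_pair.
  - move=> t /ltW tdl; rewrite cos_sum_pair// sin_sum_pair// cX sX cY sY cU sU.
    rewrite -phiU// /normsq RU IU; ring.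
  - move=> t /ltW tdl; rewrite cos_sum_pair// sin_sum_pair// cX sX cY sY cU sU RU IU; ring.
exact: (normal_variable_mgf (mL k0) eX b20 mgf).
Qed.

End DarmoisSkitovich.

Theorem theorem4 (d : measure_display) (T : measurableType d) (R : realType)
    (P : probability T R) (n : nat) (s : 'I_n -> T -> R[i])
    (alpha beta : 'I_n -> R[i]) :
  (forall k, complex_random_variable (s k)) ->
  mutually_independent P (fun k => real_vector (s k)) ->
  independent P
    (real_vector (fun t => \sum_(k < n) alpha k * s k t))
    (real_vector (fun t => \sum_(k < n) beta k * s k t)) ->
  forall k : 'I_n, alpha k * beta k != 0 -> complex_normal P (s k).
Proof.
move=> ms ind indL k abk a b.
have ak : alpha k != 0 by move: abk; rewrite mulf_eq0 negb_or => /andP[].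
(* Since [a x + b y = Re ((a - i b) (x + i y))], the right [om] is [(a - i b) / alpha_k]. *)
have := normal_linear_form ms ind indL (Complex a (- b) / alpha k) abk.
rewrite divfK//; congr (normal_variable P _); apply/funext => x.
by rewrite complex_ReM/= mulNr opprK.
Qed.
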